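(* Let $n=2m\ge 4$ be an even integer, let $B_1\subset\mathbb{R}^n$ be the open unit ball and let $K\in L^\infty(B_1)$ be nonnegative. Let $u\in C^{2m}(B_1\setminus\{0\})$ be a solution of \[ (-\Delta)^{m}u=K(x)e^{u}\quad\text{in }B_1\setminus\{0\} \] satisfying \[ \int_{B_1\setminus\{0\}}e^{u(x)}\,dx<+\infty \quad\text{and}\quad \int_{B_r\setminus\{0\}}|u(x)|\,dx=o\big(r^{2m-2}\big)\ \text{ as } r\to0 . \] Then there exist a constant $\alpha>-2m$, a radius $\rho\in(0,1)$, an exponent $\gamma\in(0,1)$ and a function $\varphi\in C^{\gamma}(B_\rho)$ such that \[ u(x)=\alpha\ln|x|+\varphi(x)\quad\text{for all }x\in B_\rho\setminus\{0\}. \]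
   Context: $B_r$ denotes the open ball of radius $r$ centered at the origin in $\mathbb{R}^n$; the equation holds pointwise. *)

(* Defs.v *)
From HB Require Import structures.
From mathcomp Require Import all_boot all_order all_algebra.
From mathcomp Require Import all_classical all_reals all_analysis.
Set Implicit Arguments. Unset Strict Implicit. Unset Printing Implicit Defensive.
Import Order.TTheory GRing.Theory Num.Theory.
Import numFieldNormedType.Exports.
Local Open Scope classical_set_scope.
Local Open Scope ring_scope.

Section Defs.
Variable R : realType.

Definition enorm (n : nat) (x : 'rV[R]_n) : R :=
  Num.sqrt (\sum_(i < n) (x ord0 i) ^+ 2).

Definition eball (n : nat) (r : R) : set 'rV[R]_n := [set x | enorm x < r].
Definition pball (n : nat) (r : R) : set 'rV[R]_n := [set x | 0 < enorm x < r].

(* Lebesgue integral over R^n of a nonnegative extended-real function, as the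
   iterated one-dimensional Lebesgue integral (equal to the n-dimensional
   Lebesgue integral by Tonelli for nonnegative measurable functions). *)
Fixpoint iint (n : nat) (F : (nat -> R) -> \bar R) : \bar R :=
  match n with
  | 0 => F (fun _ => 0)
  | k.+1 => (\int[@lebesgue_measure R]_t
               iint k (fun g => F (fun i => if i is j.+1 then g j else t)))%E
  end.

Definition rn_integral (n : nat) (f : 'rV[R]_n -> \bar R) : \bar R :=
  iint n (fun g => f (\row_(i < n) g (nat_of_ord i))).

Definition rn_measure (n : nat) (A : set 'rV[R]_n) : \bar R :=
  rn_integral (fun x => (\1_A x)%:E).

Definition evec (n : nat) (i : 'I_n) : 'rV[R]_n := delta_mx ord0 i.
Definition partial (n : nat) (i : 'I_n) (f : 'rV[R]_n -> R) : 'rV[R]_n -> R :=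
  fun x => 'D_(evec i) f x.

Fixpoint Ck (n : nat) (k : nat) (U : set 'rV[R]_n) (f : 'rV[R]_n -> R) : Prop :=
  match k with
  | 0 => {in U, continuous f}
  | k'.+1 => {in U, continuous f} /\
             (forall i : 'I_n, forall x, U x -> derivable f x (evec i)) /\
             (forall i : 'I_n, Ck k' U (partial i f))
  end.

Definition laplacian (n : nat) (f : 'rV[R]_n -> R) : 'rV[R]_n -> R :=
  fun x => \sum_(i < n) partial i (partial i f) x.

Definition polylap (n m : nat) (f : 'rV[R]_n -> R) : 'rV[R]_n -> R :=
  iter m (fun g => fun x => - laplacian g x) f.

Definition holder_on (n : nat) (gamma : R) (U : set 'rV[R]_n)
    (phi : 'rV[R]_n -> R) : Prop :=
  (exists M : R, forall x, U x -> `|phi x| <= M) /\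
  (exists C : R, forall x y, U x -> U y ->
      `|phi x - phi y| <= C * powR (enorm (x - y)) gamma).

End Defs.
Arguments eball {R} n r.
Arguments pball {R} n r.

(* Main.v *)
Require Import Defs.
From HB Require Import structures.
From mathcomp Require Import all_boot all_order all_algebra.
From mathcomp Require Import all_classical all_reals all_analysis.
From mathcomp Require Import measurable_realfun ring lra zify.
Import Order.TTheory GRing.Theory Num.Theory.
Import numFieldNormedType.Exports.
Set Implicit Arguments. Unset Strict Implicit. Unset Printing Implicit Defensive.
Local Open Scope classical_set_scope.
Local Open Scope ring_scope.

(* Cut u off to U = chi u and put F = (-Delta)^m U, which near 0 is K e^u and is
   integrable.  Up to a constant c0, -ln|x - y| is the fundamental solution of
   (-Delta)^m on R^(2m); subtracting its first-order Taylor polynomial in y at 0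
   makes the kernel O(|y|^2), and the hypothesis int_{B_r} |u| = o(r^(2m-2)) is
   what makes the error terms of cutting out a small ball around 0 vanish.  Hence

     c0 u(x) = a ln|x| - b.x / |x|^2 - int ln|x - y| F(y) dy,
       a = int F, b = int y F(y) dy.

   The potential is bounded below since F >= 0 near 0, so integrability of e^u on
   shrinking boxes forces b = 0 and alpha = a / c0 > -2m.  For the Hoelder bound,
   split off the part V of the potential created by a ball so small that its mass
   is at most c0 tau: by Jensen (the Brezis-Merle argument) e^(V / (c0 tau)) is
   integrable, and Young's inequality then bounds the integral of |x - y|^-tau F(y)
   uniformly in x near 0. *)

(** * Lebesgue measure on row vectors *)

(** The factor c0 comes from an explicit regularisation: with s = t^2 + |x - y|^2, applying
    (-Delta)^m to -(1/2) ln s in dimension 2m leaves a single term, a multiple of t^(2m) s^(-2m).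
    After rescaling this is an approximate identity with profile (1 + |z|^2)^(-2m), and c0 is its
    mass. Every integration by parts is made between functions that are C^(2m) on all of R^(2m), one
    of them compactly supported, so no boundary term appears. The Taylor subtraction gains exactly
    the powers that the hypothesis pays for: a cutoff at scale e costs e^(-2m), the kernel there is
    O(e^2), and the error is e^(2 - 2m) times the integral of |u| over a ball of radius 4e. The
    parameter tau couples the last steps. Near 0 the source is at most a constant times |y|^alpha
    e^(V / c0), and alpha > -2m leaves room for some beta < 2m with beta >= -alpha and beta / (1 - 2
    tau) < 2m. Young's inequality with exponents tau, 1 - 2 tau, tau then splits the integrand into
    three separately integrable terms, and tau is also the final Hoelder exponent. *)

Section rv_measurable.
Context {R : realType}.

(** Preimages under single coordinates generate the product sigma-algebra, so measurability of a map
    into row vectors is a coordinatewise question. That open sets belong to it is proved separately,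
    in [rv_open_measurable]. *)
Definition rv_gen (n : nat) : set (set 'rV[R]_n) :=
  [set A | exists (i : 'I_n) (B : set R), measurable B /\
                  A = (fun x : 'rV[R]_n => x ord0 i) @^-1` B].

Definition rv_measurable (n : nat) : set (set 'rV[R]_n) := <<s @rv_gen n >>.

Let rv_measurable0 n : @rv_measurable n set0.
Proof. exact: sigma_algebra0. Qed.

Let rv_measurableC n A : @rv_measurable n A -> @rv_measurable n (~` A).
Proof. by move=> mA; rewrite -setTD; exact: sigma_algebraCD. Qed.

Let rv_measurableU n (F : (set 'rV[R]_n)^nat) :
  (forall i, @rv_measurable n (F i)) -> @rv_measurable n (\bigcup_i F i).
Proof. exact: sigma_algebra_bigcup. Qed.

HB.instance Definition _ n := @isMeasurable.Build default_measure_display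
  'rV[R]_n (@rv_measurable n) (@rv_measurable0 n) (@rv_measurableC n)
  (@rv_measurableU n).

Lemma measurable_coord n (i : 'I_n) :
  measurable_fun setT (fun x : 'rV[R]_n => x ord0 i).
Proof.
move=> _ B mB; rewrite setTI; apply: sub_sigma_algebra.
by exists i, B.
Qed.

Lemma measurable_fun_rv d (T : measurableType d) n (f : T -> 'rV[R]_n) :
  (forall i, measurable_fun setT (fun t => f t ord0 i)) ->
  measurable_fun setT f.
Proof.
move=> mf; apply: (measurability (@rv_gen n)) => //.
move=> _ [_ [i [B [mB ->]]] <-].
exact: (mf i).
Qed.

(** The scalar goes to index 0, in front of the row: this is the order of [iint], whose outermost
    variable is coordinate 0. *)
Definition rcons_row n (p : measurableTypeR R * 'rV[R]_n) : 'rV[R]_n.+1 :=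
  \row_(i < n.+1) (if unlift ord0 i is Some j then p.2 ord0 j else p.1).

Lemma rcons_row0 n (p : measurableTypeR R * 'rV[R]_n) : rcons_row p ord0 ord0 = p.1.
Proof. by rewrite mxE unlift_none. Qed.

Lemma rcons_rowS n (p : measurableTypeR R * 'rV[R]_n) j : rcons_row p ord0 (lift ord0 j) = p.2 ord0 j.
Proof. by rewrite mxE liftK. Qed.

Lemma measurable_rcons_row n : measurable_fun setT (@rcons_row n).
Proof.
apply: measurable_fun_rv => i.
case: (unliftP ord0 i) => [j ->|->].
  under eq_fun do rewrite rcons_rowS.
  by apply: (measurableT_comp (@measurable_coord n j)); exact: measurable_snd.
under eq_fun do rewrite rcons_row0.
exact: measurable_fst.
Qed.

Section step.
Variables (n : nat) (m : {sigma_finite_measure set 'rV[R]_n -> \bar R}).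

Definition rv_step : set 'rV[R]_n.+1 -> \bar R :=
  pushforward (@lebesgue_measure R \x m)%E (@rcons_row n).

Let rv_stepE A : rv_step A = (@lebesgue_measure R \x m)%E (@rcons_row n @^-1` A).
Proof. by []. Qed.

Let measurable_pre A : measurable A -> measurable (@rcons_row n @^-1` A).
Proof. by move=> mA; rewrite -[X in measurable X]setTI; exact: measurable_rcons_row. Qed.

Let rv_step0 : rv_step set0 = 0%E.
Proof. by rewrite rv_stepE preimage_set0 measure0. Qed.

Let rv_step_ge0 A : (0 <= rv_step A)%E.
Proof. by rewrite rv_stepE. Qed.

Let rv_step_sigma_additive : semi_sigma_additive rv_step.
Proof.
move=> F mF tF mUF; rewrite /rv_step /pushforward preimage_bigcup.
apply: measure_semi_sigma_additive.
- by move=> k; exact: measurable_pre.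
- apply/trivIsetP => /= i j _ _ ij; rewrite -preimage_setI.
  by move/trivIsetP : tF => /(_ _ _ _ _ ij) ->//; rewrite preimage_set0.
- by rewrite -preimage_bigcup; exact: measurable_pre.
Qed.

HB.instance Definition _ := isMeasure.Build _ _ _
  rv_step rv_step0 rv_step_ge0 rv_step_sigma_additive.

Lemma measurable_tail_row :
  measurable_fun setT (fun y : 'rV[R]_n.+1 => \row_j y ord0 (lift ord0 j)).
Proof.
apply: measurable_fun_rv => i; under eq_fun do rewrite mxE.
exact: measurable_coord.
Qed.

Let rv_step_sigma_finite : sigma_finite setT rv_step.
Proof.
have [F [FT Fnd Fm]] := (sigma_finiteP _ _).1 (@sigma_finiteT _ _ _ (@lebesgue_measure R)).
have [G [GT Gnd Gm]] := (sigma_finiteP _ _).1 (@sigma_finiteT _ _ _ m).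
pose H i : set 'rV[R]_n.+1 := [set y | F i (y ord0 ord0) /\ G i (\row_j y ord0 (lift ord0 j))].
have preH i : @rcons_row n @^-1` (H i) = F i `*` G i.
  apply/seteqP; split => -[a x] /=; rewrite /H /= rcons_row0;
  by have -> : \row_j rcons_row (a, x) ord0 (lift ord0 j) = x
    by apply/rowP => j; rewrite mxE rcons_rowS.
exists H.
  apply/seteqP; split => // y _.
  have : setT (y ord0 ord0) by [].
  rewrite FT => -[i _ Fi].
  have : setT (\row_j y ord0 (lift ord0 j)) by [].
  rewrite GT => -[j _ Gj].
  exists (maxn i j) => //; split => /=.
    by have /subsetPset := Fnd _ _ (leq_maxl i j); exact.
  by have /subsetPset := Gnd _ _ (leq_maxr i j); exact.
move=> i; split.
  apply: measurableI.
    by rewrite -[X in measurable X]setTI; apply: measurable_coord => //; exact: (Fm i).1.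
  by rewrite -[X in measurable X]setTI; apply: measurable_tail_row => //; exact: (Gm i).1.
rewrite /rv_step /pushforward preH product_measure1E; [|exact: (Fm i).1|exact: (Gm i).1].
by rewrite lte_mul_pinfty// ?ge0_fin_numE// ?measure_ge0//; [exact: (Fm i).2|exact: (Gm i).2].
Qed.

HB.instance Definition _ := @Measure_isSigmaFinite.Build _ _ _
  rv_step rv_step_sigma_finite.
End step.

(** The base case is a Dirac mass because the rows of length 0 form a single point; it mirrors the
    base case of [iint]. *)
Fixpoint rv_mu (n : nat) : {sigma_finite_measure set 'rV[R]_n -> \bar R} :=
  match n with
  | 0 => \d_(0 : 'rV[R]_0)
  | k.+1 => rv_step (rv_mu k)
  end.

Lemma integral_rv_muS n (f : 'rV[R]_n.+1 -> \bar R) :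
  measurable_fun setT f -> (forall x, 0 <= f x)%E ->
  (\int[rv_mu n.+1]_x f x =
   \int[@lebesgue_measure R]_t \int[rv_mu n]_y f (rcons_row (t, y)))%E.
Proof.
move=> mf f0.
have mfr : measurable_fun setT (f \o @rcons_row n).
  by apply: measurableT_comp => //; exact: measurable_rcons_row.
have -> : (\int[rv_mu n.+1]_x f x = \int[pushforward (@lebesgue_measure R \x rv_mu n)
  (@rcons_row n)]_x f x)%E by [].
rewrite (ge0_integral_pushforward (@measurable_rcons_row n))//.
by rewrite preimage_setT fubini_tonelli1 // => x; exact: f0.
Qed.

(** The bridge from the iterated integrals of the statement to integrals against one measure, to
    which the convergence theorems apply. Tonelli is unfolded one coordinate at a time. *)
Lemma rn_integralE n (f : 'rV[R]_n -> \bar R) :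
  measurable_fun setT f -> (forall x, 0 <= f x)%E ->
  rn_integral f = (\int[rv_mu n]_x f x)%E.
Proof.
elim: n f => [|n IH] f mf f0.
  rewrite /rn_integral /= integral_dirac// diracT mul1e.
  by congr f; apply/rowP => -[].
rewrite integral_rv_muS// /rn_integral /=; apply: eq_integral => t _.
rewrite -IH; last by [].
  rewrite /rn_integral; congr iint; apply/funext => g; congr f.
  apply/rowP => i; rewrite !mxE; case: (unliftP ord0 i) => [j ->|->] //=.
  by rewrite mxE.
apply: measurableT_comp => //.
by apply: (measurableT_comp (@measurable_rcons_row n)); exact: measurable_fun_pair.
Qed.

End rv_measurable.

(** * Borel sets, affine changes of variables and cubes *)

Section rv_borel.
Context {R : realType}.

(** An open set is the union of the grid cubes it contains, and the half-open cubes of side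
    [1 / k.+1] with corners on the scaled integer lattice form a countable family. *)
Lemma rv_open_measurable n (O : set 'rV[R]_n) : open O -> measurable O.
Proof.
move=> oO.
pose cell (p : nat * 'rV[int]_n) : set 'rV[R]_n :=
  [set y | forall i, (p.2 ord0 i)%:~R <= y ord0 i * p.1.+1%:R < (p.2 ord0 i + 1)%:~R].
have mcell p : measurable (cell p).
  rewrite (_ : cell p = \bigcap_(i in [set: 'I_n])
     ((fun y : 'rV[R]_n => y ord0 i * p.1.+1%:R) @^-1`
        `[(p.2 ord0 i)%:~R, (p.2 ord0 i + 1)%:~R[%classic)); last first.
    apply/seteqP; split => y /=.
      by move=> h i _ /=; rewrite in_itv/= h.
    by move=> h i; have := h i I; rewrite /= in_itv/=.
  apply: fin_bigcap_measurable => // i _.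
  rewrite -[X in measurable X]setTI; apply: measurable_funM => //.
  exact: measurable_coord.
rewrite (_ : O = \bigcup_(p in setT) (if `[< cell p `<=` O >] then cell p else set0)).
  apply: countable_bigcupT_measurable => // p.
  by case: ifP.
apply/seteqP; split => [x Ox|x [p _]]; last first.
  by case: ifPn => [/asboolP|//]; exact.
have /nbhs_ballP[e /= e0 eO] : nbhs x O by exact: open_nbhs_nbhs.
pose k := Num.truncn (e^-1).
have ke : (k.+1%:R)^-1 < e.
  by rewrite invf_plt ?posrE// truncnS_gt.
exists (k, \row_i Num.floor (x ord0 i * k.+1%:R)) => //.
have xc : cell (k, \row_i Num.floor (x ord0 i * k.+1%:R)) x.
  by move=> i /=; rewrite mxE floor_itv.
rewrite ifT//; apply/asboolP => y yc; apply: eO.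
split => // i j; rewrite (ord1 i) /ball /=.
have /andP[x1 x2] := xc j; have /andP[y1 y2] := yc j.
move: x1 x2 y1 y2; rewrite /= mxE rmorphD /= => x1 x2 y1 y2.
apply: lt_trans ke.
rewrite -[X in _ < X]div1r ltr_pdivlMr// -[X in _ * X]gtr0_norm// -normrM.
rewrite mulrBl ltr_norml; apply/andP; split; lra.
Qed.

Lemma rv_continuous_measurable n (O : set 'rV[R]_n) (f : 'rV[R]_n -> R) :
  open O -> {in O, continuous f} -> measurable_fun O f.
Proof.
move=> oO cf; apply: (measurability _ (RGenOpens.measurableE R)).
move=> _ [_ [a [b ->] <-]]; apply: rv_open_measurable.
rewrite openE => x [Ox fx]; apply: filterI.
  exact: open_nbhs_nbhs.
apply: cf; first by rewrite inE.
by apply: open_nbhs_nbhs; split => //; exact: interval_open.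
Qed.

Lemma rv_set1_measurable n (x : 'rV[R]_n) : measurable [set x].
Proof.
rewrite (_ : [set x] = \bigcap_(i in [set: 'I_n])
   ((fun y : 'rV[R]_n => y ord0 i) @^-1` [set x ord0 i])).
  apply: fin_bigcap_measurable => // i _.
  by rewrite -[X in measurable X]setTI; apply: measurable_coord.
apply/seteqP; split => y /=; first by move=> ->.
by move=> h; apply/rowP => i; exact: h.
Qed.

Lemma measurable_affine n (a : R) (b : 'rV[R]_n) :
  measurable_fun setT (fun y : 'rV[R]_n => b + a *: y).
Proof.
apply: measurable_fun_rv => i; under eq_fun do rewrite !mxE.
by apply: measurable_funD => //; apply: measurable_funM => //; exact: measurable_coord.
Qed.

(** The image of Lebesgue measure under [t |-> b + a t], multiplied by [a], agrees with Lebesgue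
    measure on half-open intervals; uniqueness of Lebesgue measure gives the rest. *)
Lemma integral_affine1 (a b : R) (F : R -> \bar R) : 0 < a ->
  measurable_fun setT F -> (forall t, 0 <= F t)%E ->
  (\int[lebesgue_measure]_t F t =
   a%:E * \int[lebesgue_measure]_t F (b + a * t)%R)%E.
Proof.
move=> a0 mF F0.
pose phi := (fun t : measurableTypeR R => (b + a * t)%R : measurableTypeR R).
have mphi : measurable_fun setT phi by apply: measurable_funD => //; exact: measurable_funM.
pose pm : {measure set (measurableTypeR R) -> \bar R} :=
  measure_function_pushforward__canonical__measure_function_Measure
   (@lebesgue_measure R) mphi.
pose nu : {measure set (measurableTypeR R) -> \bar R} :=
  mscale (NngNum (ltW a0)) pm.
transitivity (\int[nu]_t F t)%E.
  apply: eq_measure_integral => A mA _.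
  apply: lebesgue_measure_unique => // _ [[x y]] _ <-.
  rewrite /nu /= /mscale /pm /= /pushforward.
  rewrite (_ : phi @^-1` _ = `](x - b) / a, (y - b) / a]%classic).
    rewrite !lebesgue_measure_itv/= !lte_fin ltr_pM2r ?invr_gt0// ltrD2r.
    case: ifP => _; last by rewrite mule0.
    rewrite -EFinB -EFinM; congr EFin; field; exact: lt0r_neq0.
  apply/seteqP; split => t /=; rewrite !in_itv/= /phi ltr_pdivrMr// ler_pdivlMr//;
    move=> /andP[? ?]; apply/andP; split; lra.
rewrite ge0_integral_mscale//=.
congr (_ * _)%E.
by rewrite (ge0_integral_pushforward mphi)// preimage_setT.
Qed.

Lemma integral_affine n (a : R) (b : 'rV[R]_n) (F : 'rV[R]_n -> \bar R) : 0 < a ->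
  measurable_fun setT F -> (forall y, 0 <= F y)%E ->
  (\int[rv_mu n]_y F y =
   (a ^+ n)%:E * \int[rv_mu n]_y F (b + a *: y)%R)%E.
Proof.
elim: n b F => [|n IH] b F a0 mF F0.
  rewrite expr0 mul1e !integral_dirac//; last first.
    by apply: measurableT_comp => //; exact: measurable_affine.
  by congr (_ * F _)%E; apply/rowP => -[].
have mr : measurable_fun setT (fun y : 'rV[R]_n.+1 => F (b + a *: y)).
  by apply: measurableT_comp => //; exact: measurable_affine.
have mFt t : measurable_fun setT (fun y : 'rV[R]_n => F (rcons_row (t, y))).
  apply: measurableT_comp => //.
  by apply: (measurableT_comp (@measurable_rcons_row _ n)); exact: measurable_fun_pair.
rewrite !integral_rv_muS//.
pose b' : 'rV[R]_n := \row_j b ord0 (lift ord0 j).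
rewrite (integral_affine1 (b ord0 ord0) a0).
- rewrite exprS EFinM -muleA; congr (_ * _)%E.
  rewrite -ge0_integralZl//.
  + apply: eq_integral => t _.
    rewrite (IH b')//; congr (_ * _)%E.
    apply: eq_integral => y _; congr F; apply/rowP => i.
    case: (unliftP ord0 i) => [j ->|->].
      by rewrite rcons_rowS !mxE liftK.
    by rewrite rcons_row0 !mxE unlift_none.
  + apply: (measurable_fun_fubini_tonelli_F (m2 := rv_mu n)
       (fun p : measurableTypeR R * 'rV[R]_n => F (b + a *: rcons_row p))) => //.
    by apply: (measurableT_comp mr); exact: measurable_rcons_row.
  + by move=> t _; exact: integral_ge0.
  + by rewrite lee_fin exprn_ge0// ltW.
- apply: (measurable_fun_fubini_tonelli_F (m2 := rv_mu n)
       (fun p : measurableTypeR R * 'rV[R]_n => F (rcons_row p))) => //.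
  by apply: (measurableT_comp mF); exact: measurable_rcons_row.
- by move=> t; exact: integral_ge0.
Qed.

Lemma measurable_prod_coord n (h : 'I_n -> R -> R) :
  (forall i, measurable_fun setT (h i)) ->
  measurable_fun setT (fun y : 'rV[R]_n => \prod_(i < n) h i (y ord0 i)).
Proof.
move=> mh; apply: measurable_prod => i _.
by apply: measurableT_comp => //; exact: measurable_coord.
Qed.

Lemma integral_prod_coord n (h : 'I_n -> R -> R) (c : 'I_n -> R) :
  (forall i, measurable_fun setT (h i)) -> (forall i t, 0 <= h i t) ->
  (forall i, \int[lebesgue_measure]_t (h i t)%:E = (c i)%:E)%E ->
  (\int[rv_mu n]_y (\prod_(i < n) h i (y ord0 i))%:E = (\prod_i c i)%:E)%E.
Proof.
elim: n h c => [|n IH] h c mh h0 hc.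
  rewrite integral_dirac//; first by rewrite diracT mul1e !big_ord0.
  by apply/measurable_EFinP; exact: measurable_prod_coord.
rewrite integral_rv_muS//; last first.
- by move=> y; rewrite lee_fin prodr_ge0.
- by apply/measurable_EFinP; exact: measurable_prod_coord.
rewrite big_ord_recl EFinM -hc -ge0_integralZr//.
- apply: eq_integral => t _.
  rewrite -(IH (fun i => h (lift ord0 i)))//.
  rewrite -ge0_integralZl//.
  + apply: eq_integral => y _; rewrite big_ord_recl EFinM rcons_row0; congr (_ * _%:E)%E.
    by apply: eq_bigr => i _; rewrite rcons_rowS.
  + by apply/measurable_EFinP; exact: (@measurable_prod_coord n (fun i => h (lift ord0 i))).
  + by move=> y _; rewrite lee_fin prodr_ge0.
  + by rewrite lee_fin.
- by apply/measurable_EFinP; exact: (mh ord0).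
- by move=> t _; rewrite lee_fin.
- rewrite lee_fin prodr_ge0// => i _; rewrite -lee_fin -hc.
  by apply: integral_ge0 => t _; rewrite lee_fin.
Qed.

Lemma integral_prod_coord_le n (h : 'I_n -> R -> R) (C : R) :
  (forall i, measurable_fun setT (h i)) -> (forall i t, 0 <= h i t) ->
  (forall i, \int[lebesgue_measure]_t (h i t)%:E <= C%:E)%E ->
  (\int[rv_mu n]_y (\prod_(i < n) h i (y ord0 i))%:E <= (C ^+ n)%:E)%E.
Proof.
move=> mh h0 hC.
pose c i := fine (\int[lebesgue_measure]_t (h i t)%:E)%E.
have cE i : (\int[lebesgue_measure]_t (h i t)%:E = (c i)%:E)%E.
  rewrite fineK// ge0_fin_numE; first by rewrite (le_lt_trans (hC i))// ltry.
  by apply: integral_ge0 => t _; rewrite lee_fin.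
rewrite (integral_prod_coord mh h0 cE) lee_fin.
rewrite -[X in _ <= _ ^+ X]card_ord -prodr_const ler_prod// => i _.
rewrite -!lee_fin -cE hC andbT.
by apply: integral_ge0 => t _; rewrite lee_fin.
Qed.

(** Cubes are used where a measure has to be computed or bounded below: the indicator is a product
    over the coordinates, so the measure is explicit. *)
Definition rv_box n (a : 'rV[R]_n) (k : R) : set 'rV[R]_n :=
  [set y | forall i, `|y ord0 i - a ord0 i| <= k].

Lemma indic_rv_box n (a : 'rV[R]_n) (k : R) (y : 'rV[R]_n) :
  \1_(rv_box a k) y =
  \prod_(i < n) \1_(`[a ord0 i - k, a ord0 i + k]%classic : set R) (y ord0 i) :> R.
Proof.
rewrite indicE; have [yb|yb] := boolP (y \in rv_box a k).
  rewrite big1// => i _; rewrite indicE mem_set//= in_itv/=.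
  by move: yb; rewrite inE => /(_ i); rewrite ler_distl.
apply/esym/eqP/prodf_eq0.
apply: contra_notP (negP yb) => h; rewrite inE => i /=.
rewrite leNgt; apply/negP => hi; apply: h; exists i => //.
rewrite indicE memNset//= in_itv/= => h; move: hi; rewrite ltNge => /negP; apply.
by rewrite ler_distl.
Qed.

Lemma measurable_rv_box n (a : 'rV[R]_n) (k : R) : measurable (rv_box a k).
Proof.
rewrite (_ : rv_box a k = \bigcap_(i in [set: 'I_n])
   ((fun y : 'rV[R]_n => y ord0 i) @^-1` `[a ord0 i - k, a ord0 i + k]%classic)).
  apply: fin_bigcap_measurable => // i _.
  by rewrite -[X in measurable X]setTI; apply: measurable_coord.
apply/seteqP; split => y /=.
  by move=> h i _ /=; rewrite in_itv/= -ler_distl.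
by move=> h i; have := h i I; rewrite /= in_itv/= -ler_distl.
Qed.

Lemma rv_mu_box n (a : 'rV[R]_n) (k : R) : 0 <= k ->
  (rv_mu n (rv_box a k) = ((2 * k) ^+ n)%:E)%E.
Proof.
move=> k0.
rewrite -[rv_box a k]setIT -integral_indic//; last exact: measurable_rv_box.
under eq_integral do rewrite indic_rv_box.
rewrite (@integral_prod_coord n
  (fun i => \1_(`[a ord0 i - k, a ord0 i + k]%classic : set R)) (fun=> 2 * k)).
- by rewrite prodr_const card_ord.
- move=> i; exact: measurable_indic.
- by move=> i t.
- move=> i; rewrite integral_indic// setIT.
  apply: (etrans (lebesgue_measure_itv `[a ord0 i - k, a ord0 i + k])).
  rewrite /= lte_fin.
  case: ltP => h; first by rewrite -EFinB; congr EFin; lra.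
  by congr EFin; lra.
Qed.

Lemma rv_mu_set1 n (x : 'rV[R]_n.+1) : (rv_mu n.+1 [set x] = 0)%E.
Proof.
have : (rv_mu n.+1 [set x] <= rv_mu n.+1 (rv_box x 0))%E.
  apply: le_measure; rewrite ?inE; [exact: rv_set1_measurable|exact: measurable_rv_box|].
  by move=> y -> i; rewrite subrr normr0.
rewrite rv_mu_box// mulr0 expr0n /= => h.
by apply/eqP; rewrite eq_le h measure_ge0.
Qed.

End rv_borel.

(** * The Euclidean norm *)

Section enorm_theory.
Context {R : realType}.
Variable n : nat.
Implicit Types x y z : 'rV[R]_n.

Definition dotp x y : R := \sum_(i < n) x ord0 i * y ord0 i.

Lemma sqr_enorm x : enorm x ^+ 2 = \sum_(i < n) x ord0 i ^+ 2.
Proof. by rewrite /enorm sqr_sqrtr// sumr_ge0// => i _; exact: sqr_ge0. Qed.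

Lemma dotpxx x : dotp x x = enorm x ^+ 2.
Proof. by rewrite sqr_enorm; apply: eq_bigr => i _; rewrite expr2. Qed.

Lemma enorm_ge0 x : 0 <= enorm x. Proof. exact: sqrtr_ge0. Qed.

Lemma enorm_eq0 x : enorm x = 0 -> x = 0.
Proof.
move=> h; apply/rowP => i; rewrite mxE.
have : enorm x ^+ 2 = 0 by rewrite h expr0n.
rewrite sqr_enorm => /psumr_eq0P h0.
by apply/eqP; rewrite -sqrf_eq0 h0// => j _; exact: sqr_ge0.
Qed.

Lemma enorm0 : enorm (0 : 'rV[R]_n) = 0.
Proof.
by rewrite /enorm big1 ?sqrtr0// => i _; rewrite mxE expr0n.
Qed.

Lemma enorm_gt0 x : (0 < enorm x) = (x != 0).
Proof.
rewrite lt0r enorm_ge0 andbT; apply/idP/idP; apply: contra => /eqP.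
  by move=> ->; rewrite enorm0.
by move=> /enorm_eq0 ->.
Qed.

Lemma enormZ (a : R) x : enorm (a *: x) = `|a| * enorm x.
Proof.
apply/eqP; rewrite -(eqrXn2 (n := 2))// ?mulr_ge0 ?enorm_ge0//.
rewrite exprMn real_normK ?num_real// !sqr_enorm mulr_sumr.
by apply/eqP; apply: eq_bigr => i _; rewrite mxE exprMn.
Qed.

Lemma enormN x : enorm (- x) = enorm x.
Proof. by rewrite -scaleN1r enormZ normrN1 mul1r. Qed.

Lemma enormB x y : enorm (x - y) = enorm (y - x).
Proof. by rewrite -opprB enormN. Qed.

Lemma coord_le_enorm x i : `|x ord0 i| <= enorm x.
Proof.
rewrite -(ler_pXn2r (n := 2))// ?nnegrE ?enorm_ge0// real_normK ?num_real//.
rewrite sqr_enorm (bigD1 i)//= lerDl sumr_ge0// => j _; exact: sqr_ge0.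
Qed.

(** Cauchy-Schwarz, from the nonnegativity of the squared norm of [|x|^2 y - (x.y) x]. *)
Lemma dotp_le x y : dotp x y <= enorm x * enorm y.
Proof.
have [->|x0] := eqVneq x 0.
  by rewrite /dotp big1 ?enorm0 ?mul0r// => i _; rewrite mxE mul0r.
have A0 : 0 < enorm x by rewrite enorm_gt0.
have e (a c : R) : \sum_(i < n) (a * y ord0 i - c * x ord0 i) ^+ 2 =
    a ^+ 2 * enorm y ^+ 2 - 2 * a * c * dotp x y + c ^+ 2 * enorm x ^+ 2.
  rewrite /dotp !sqr_enorm !mulr_sumr -sumrB -big_split/=.
  by apply: eq_bigr => i _; ring.
have : 0 <= \sum_(i < n) (enorm x ^+ 2 * y ord0 i - dotp x y * x ord0 i) ^+ 2.
  by apply: sumr_ge0 => i _; exact: sqr_ge0.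
rewrite e; set A := enorm x in A0 *; set B := enorm y; set C := dotp x y.
rewrite (_ : _ + _ = A ^+ 2 * (A ^+ 2 * B ^+ 2 - C ^+ 2)); last by ring.
rewrite pmulr_rge0 ?exprn_gt0// subr_ge0 -exprMn => h.
have [C0|C0] := leP C 0.
  by rewrite (le_trans C0)// mulr_ge0// enorm_ge0.
by rewrite -(ler_pXn2r (n := 2))// nnegrE ?mulr_ge0 ?enorm_ge0// ltW.
Qed.

Lemma sqr_enormD x y : enorm (x + y) ^+ 2 = enorm x ^+ 2 + 2 * dotp x y + enorm y ^+ 2.
Proof.
rewrite !sqr_enorm /dotp mulr_sumr -!big_split/=; apply: eq_bigr => i _.
rewrite mxE; ring.
Qed.

Lemma dotpNr x y : dotp x (- y) = - dotp x y.
Proof. by rewrite /dotp -sumrN; apply: eq_bigr => i _; rewrite mxE mulrN. Qed.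

Lemma dotpNl x y : dotp (- x) y = - dotp x y.
Proof. by rewrite /dotp -sumrN; apply: eq_bigr => i _; rewrite mxE mulNr. Qed.

Lemma sqr_enormB x y : enorm (x - y) ^+ 2 = enorm x ^+ 2 - 2 * dotp x y + enorm y ^+ 2.
Proof. by rewrite sqr_enormD dotpNr enormN mulrN. Qed.

Lemma normr_dotp_le x y : `|dotp x y| <= enorm x * enorm y.
Proof.
rewrite ler_norml dotp_le andbT lerNl -dotpNl.
by rewrite (le_trans (dotp_le _ _))// enormN.
Qed.

Lemma ler_enormD x y : enorm (x + y) <= enorm x + enorm y.
Proof.
rewrite -(ler_pXn2r (n := 2))// ?nnegrE ?addr_ge0 ?enorm_ge0//.
rewrite sqr_enormD; have := dotp_le x y; nra.
Qed.

Lemma ler_enormBB x y : enorm x - enorm y <= enorm (x - y).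
Proof. by rewrite lerBlDr (le_trans _ (ler_enormD _ _))// subrK. Qed.

Lemma ler_enormB x y : enorm (x - y) <= enorm x + enorm y.
Proof. by rewrite (le_trans (ler_enormD _ _))// enormN. Qed.

Lemma ler_dist_enorm x y : `|enorm x - enorm y| <= enorm (x - y).
Proof. by rewrite ler_norml ler_enormBB andbT lerNl opprB enormB ler_enormBB. Qed.

Lemma enorm_le_sum x : enorm x <= \sum_(i < n) `|x ord0 i|.
Proof.
rewrite -(ler_pXn2r (n := 2))// ?nnegrE ?enorm_ge0 ?sumr_ge0//.
rewrite sqr_enorm expr2 mulr_suml ler_sum// => i _.
rewrite -real_normK ?num_real// expr2 ler_wpM2l//.
by rewrite (bigD1 i)//= lerDl sumr_ge0.
Qed.

Lemma enorm_le_coord x k : (forall i, `|x ord0 i| <= k) -> enorm x <= n%:R * k.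
Proof.
move=> h; rewrite (le_trans (enorm_le_sum _))// mulr_natl -[X in _ *+ X]card_ord.
by rewrite -sumr_const ler_sum.
Qed.

Lemma continuous_sqnorm : continuous (fun x : 'rV[R]_n => \sum_(i < n) x ord0 i ^+ 2).
Proof.
apply: (@continuous_big R _ +%R 0 xpredT) => [|i _ x]; first exact: add_continuous.
apply: (@continuous_comp _ _ _ (fun x : 'rV[R]_n => x ord0 i) (fun t : R => t ^+ 2)).
  exact: coord_continuous.
exact: exprn_continuous.
Qed.

Lemma continuous_enorm : continuous (@enorm R n).
Proof.
move=> x; apply: (@continuous_comp _ _ _ _ (@Num.sqrt R)); last exact: sqrt_continuous.
exact: continuous_sqnorm.
Qed.

Lemma open_eball (r : R) : open (@eball R n r).
Proof.
rewrite [eball n r](_ : _ = enorm (n := n) @^-1` `]-oo, r[%classic).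
  apply: open_comp; last exact: interval_open.
  by move=> x _; exact: continuous_enorm.
by apply/seteqP; split => x /=; rewrite in_itv.
Qed.

Lemma open_enorm_gt (r : R) : open [set x : 'rV[R]_n | r < enorm x].
Proof.
rewrite [[set _ | _]](_ : _ = enorm (n := n) @^-1` `]r, +oo[%classic).
  apply: open_comp; last exact: interval_open.
  by move=> x _; exact: continuous_enorm.
by apply/seteqP; split => x /=; rewrite in_itv/= andbT.
Qed.

Lemma open_pball (r : R) : open (@pball R n r).
Proof.
rewrite [pball n r](_ : _ = [set x : 'rV[R]_n | 0 < enorm x] `&` eball n r).
  by apply: openI; [exact: open_enorm_gt|exact: open_eball].
by apply/seteqP; split => x /=; [move=> /andP[]|move=> [? ?]; apply/andP].
Qed.

Lemma compact_ceball (r : R) : compact [set x : 'rV[R]_n | enorm x <= r].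
Proof.
apply: bounded_closed_compact.
  exists r; split; first exact: num_real.
  move=> M rM x /= xr; rewrite [leLHS]/Num.norm/= mx_normrE; apply: bigmax_le.
    by rewrite (le_trans _ (ltW rM))// (le_trans (enorm_ge0 x)).
  move=> [i j] _ /=; rewrite (ord1 i); apply: le_trans (ltW rM).
  exact: (le_trans (coord_le_enorm _ _)).
rewrite [[set _ | _]](_ : _ = ~` [set x : 'rV[R]_n | r < enorm x]).
  exact/open_closedC/open_enorm_gt.
by apply/seteqP; split => x /=; [rewrite leNgt => /negP|move=> /negP; rewrite -leNgt].
Qed.

Lemma measurable_enorm : measurable_fun setT (@enorm R n).
Proof.
by apply: rv_continuous_measurable; [exact: openT|move=> x _; exact: continuous_enorm].
Qed.

Lemma measurable_enormB x : measurable_fun setT (fun y => enorm (x - y)).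
Proof.
under eq_fun do rewrite -scaleN1r.
exact: (measurableT_comp measurable_enorm (@measurable_affine R n (-1) x)).
Qed.

End enorm_theory.

(** * Kernel integrals in one and several dimensions *)

Section kernel_integrals.
Context {R : realType}.
Local Notation leb := (@lebesgue_measure R).

Lemma integral_even_le (f : R -> R) (C : R) :
  measurable_fun setT f -> (forall t, 0 <= f t) -> (forall t, f (- t) = f t) ->
  (\int[leb]_(t in `[0%R, +oo[) (f t)%:E <= C%:E)%E ->
  (\int[leb]_t (f t)%:E <= (2 * C)%:E)%E.
Proof.
move=> mf f0 fe fC.
have mfE : measurable_fun setT (EFin \o f) by exact/measurable_EFinP.
have h := @ge0_integration_by_substitution0 R (EFin \o f) mfE (fun r => _).
have {}h : (\int[leb]_(t in `]-oo, 0%R]) (f t)%:E <= C%:E)%E.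
  rewrite (le_trans _ fC)// h => [|r]; last by rewrite lee_fin.
  by under [leRHS]eq_integral do rewrite /= fe.
have -> : [set: R] = `]-oo, 0[%classic `|` `[0, +oo[%classic.
  by apply/seteqP; split => // t _ /=; rewrite !in_itv/= andbT; case: ltP; [left|right].
rewrite ge0_integral_setU//=.
- rewrite mulrDl mul1r EFinD leeD//.
  apply: le_trans h; apply: ge0_subset_integral => //=.
  + exact: measurable_funTS.
  + by move=> t _; rewrite lee_fin.
  + by move=> t /=; rewrite !in_itv/=; exact: ltW.
- exact: measurable_funTS.
- by move=> t _; rewrite lee_fin.
- apply/disj_setPS => t [] /=; rewrite !in_itv/= andbT => a b.
  by move: (lt_le_trans a b); rewrite ltxx.
Qed.

(** Turns a uniform bound on compact intervals, where an antiderivative is available, into a bound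
    on the improper integral by monotone convergence. *)
Lemma integral_exhaust_le d (T : measurableType d) (mu : {measure set T -> \bar R})
    (F : (set T)^nat) (f : T -> \bar R) (C : R) :
  nondecreasing_seq F -> (forall i, measurable (F i)) -> measurable_fun setT f ->
  (forall x, 0 <= f x)%E -> (forall i, \int[mu]_(x in F i) f x <= C%:E)%E ->
  (\int[mu]_(x in \bigcup_i F i) f x <= C%:E)%E.
Proof.
move=> Fnd mF mf f0 FC.
apply: (cvge_le _ (ge0_nondecreasing_set_cvg_integral Fnd mF _ _)).
- by near=> i; exact: FC.
- by move=> i; exact: measurable_funTS.
- by move=> i x _; exact: f0.
Unshelve. all: by end_near. Qed.

(** On [[0, i]] the integral is an arctangent, hence below pi/2. This is the one-dimensional factor
    of the majorant of [bubble]. *)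
Lemma integral_oneDsqrV_le : (\int[leb]_t ((oneDsqr t)^-1)%:E <= (2 * (pi / 2))%:E)%E.
Proof.
have pos t : 0 <= (oneDsqr t)^-1 :> R by rewrite invr_ge0 (le_trans _ (oneDsqr_ge1 t)).
have mf0 : measurable_fun setT (fun t : R => (oneDsqr t)^-1).
  by apply: continuous_measurable_fun => x; exact: continuous_oneDsqrV.
apply: integral_even_le => //.
  by move=> t; rewrite /oneDsqr sqrrN.
have mf : measurable_fun setT (fun t : R => ((oneDsqr t)^-1)%:E) by exact/measurable_EFinP.
pose F (i : nat) := `[0, i%:R]%classic : set R.
have -> : `[0, +oo[%classic = \bigcup_i F i.
  apply/seteqP; split => t /=.
    rewrite in_itv/= andbT => t0; exists (Num.truncn t).+1 => //=.
    by rewrite /F /= in_itv/= t0 ltW// truncnS_gt.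
  by move=> [i _]; rewrite /F /= !in_itv/= andbT => /andP[].
apply: integral_exhaust_le => //.
- move=> i j ij; apply/subsetPset => t; rewrite /F /= !in_itv/= => /andP[-> h].
  by rewrite (le_trans h)// ler_nat.
- by move=> i; exact: measurable_itv.
- move=> i; have := @integral0_oneDsqr R i%:R (ler0n _ _).
  rewrite /Rintegral => h.
  have fin : (\int[leb]_(t in F i) ((oneDsqr t)^-1)%:E)%E \is a fin_num.
    apply: integrable_fin_num; first exact: measurable_itv.
    apply: continuous_compact_integrable; first exact: segment_compact.
    by apply: continuous_in_subspaceT => x ?; exact: continuous_oneDsqrV.
  by rewrite -(fineK fin) lee_fin h ltW// atan_ltpi2.
Qed.

Lemma integral_powR01_le (a : R) : 0 < a < 1 ->
  (\int[leb]_(t in `]0%R, 1%R]) (t `^ (- a))%:E <= ((1 - a)^-1)%:E)%E.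
Proof.
move=> /andP[a0 a1].
have mf : measurable_fun setT (fun t : R => (t `^ (- a))%:E).
  by apply/measurable_EFinP; exact: measurable_powR.
pose F (i : nat) := `[i.+1%:R^-1, 1]%classic : set R.
have -> : `]0, 1]%classic = \bigcup_i F i.
  apply/seteqP; split => t /=.
    rewrite in_itv/= => /andP[t0 t1]; exists (Num.truncn t^-1) => //=.
    by rewrite /F /= in_itv/= t1 andbT invf_ple ?posrE// ltW// truncnS_gt.
  move=> [i _]; rewrite /F /= !in_itv/= => /andP[h ->]; rewrite andbT.
  by rewrite (lt_le_trans _ h).
apply: integral_exhaust_le => //.
- move=> i j ij; apply/subsetPset => t; rewrite /F /= !in_itv/= => /andP[h ->].
  by rewrite andbT (le_trans _ h)// lef_pV2 ?posrE// ler_nat.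
- by move=> i; exact: measurable_itv.
- by move=> t; rewrite lee_fin powR_ge0.
(* For index 0 the interval is the single point 1, so the fundamental theorem of calculus is applied
   from index 1 on. *)
move=> [|i].
  rewrite /F invr1 set_itv1 integral_set1 lee_fin invr_ge0; lra.
have i0 : 0 < (i.+2%:R : R)^-1 by [].
have i1 : (i.+2%:R : R)^-1 < 1 by rewrite invf_lt1// ltr1n.
rewrite /F (@continuous_FTC2 R (fun t => t `^ (- a)) (fun t => (1 - a)^-1 * t `^ (1 - a)))//.
- rewrite -EFinB lee_fin powR1 mulr1 lerBlDr lerDl mulr_ge0 ?powR_ge0// invr_ge0; lra.
- apply: continuous_in_subspaceT => t; rewrite inE/= in_itv/= => /andP[h _].
  apply: differentiable_continuous; apply/derivable1_diffP; apply: derivable_powR.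
  by rewrite in_itv/= andbT (lt_le_trans i0).
- have dF t : 0 < t -> derivable (fun t => (1 - a)^-1 * t `^ (1 - a)) t 1.
    move=> t0; apply: derivableM; first exact: derivable_cst.
    by apply: derivable_powR; rewrite in_itv/= t0.
  have cF t : 0 < t -> {for t, continuous (fun t => (1 - a)^-1 * t `^ (1 - a))}.
    by move=> t0; apply: differentiable_continuous; apply/derivable1_diffP; exact: dF.
  split.
  + by move=> t; rewrite in_itv/= => /andP[h _]; apply: dF; rewrite (lt_trans i0).
  + by apply: cvg_at_right_filter; exact: cF.
  + by apply: cvg_at_left_filter; exact: cF.
- move=> t; rewrite in_itv/= => /andP[h _].
  have t0 : 0 < t by rewrite (lt_trans i0).
  rewrite derive1Ml; last by apply: derivable_powR; rewrite in_itv/= t0.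
  rewrite powR_derive1 ?in_itv/= ?t0// mulrA mulVf; last by rewrite subr_eq0 gt_eqF.
  by rewrite mul1r; congr (_ `^ _); ring.
Qed.

(** At [t = c] the convention for powers of 0 gives the value 0 when [a] is nonzero, not infinity.
    The product majorant below is therefore valid only off the hyperplanes where a coordinate of [y]
    equals that of [x]. *)
Definition cut_powR (a c t : R) : R := \1_(`[-1, 1]%classic : set R) t * `|t - c| `^ (- a).

Lemma measurable_cut_powR a c : measurable_fun setT (cut_powR a c).
Proof.
apply: measurable_funM; first exact: measurable_indic.
apply: (measurableT_comp (@measurable_powR R (- a))).
by apply: measurableT_comp => //; exact: measurable_funB.
Qed.

Lemma cut_powR_ge0 a c t : 0 <= cut_powR a c t.
Proof. by rewrite mulr_ge0// powR_ge0. Qed.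

Lemma integral_cut_powR0_le (a : R) : 0 < a < 1 ->
  (\int[leb]_t (cut_powR a 0 t)%:E <= (2 * (1 - a)^-1)%:E)%E.
Proof.
move=> a01; apply: integral_even_le.
- exact: measurable_cut_powR.
- exact: cut_powR_ge0.
- move=> t; rewrite /cut_powR !subr0 normrN; congr (_ * _).
  rewrite !indicE; congr (_%:R); congr nat_of_bool; apply/idP/idP;
  rewrite !inE/= !in_itv/= => /andP[? ?]; apply/andP; split; lra.
apply: le_trans (integral_powR01_le a01).
have -> : (\int[leb]_(t in `]0%R, 1%R]) (t `^ (- a))%:E =
          \int[leb]_(t in `]0%R, 1%R]) (cut_powR a 0 t)%:E)%E.
  apply: eq_integral => t; rewrite inE/= in_itv/= => /andP[t0 t1].
  rewrite /cut_powR subr0 gtr0_norm// indicE mem_set ?mul1r//= in_itv/= t1 andbT; lra.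
have mE D : measurable_fun D (EFin \o cut_powR a 0).
  by apply/measurable_EFinP; apply: measurable_funTS; exact: measurable_cut_powR.
have -> : `[0, +oo[%classic = [set 0] `|` (`]0, 1]%classic `|` `]1, +oo[%classic) :> set R.
  apply/seteqP; split => t /=; rewrite !in_itv/= !andbT.
    rewrite le_eqVlt => /predU1P[<-|t0]; first by left.
    by right; case: (leP t 1); [left; rewrite t0|right].
  by move=> [->//|[/andP[/ltW]//|h]]; rewrite (le_trans _ (ltW h)).
rewrite ge0_integral_setU//=; last 4 first.
- exact: measurableU.
- exact: mE.
- by move=> t _; rewrite lee_fin cut_powR_ge0.
- by apply/disj_setPS => t [] /= ->; rewrite !in_itv/= ltxx andbT => -[//|]; rewrite ltNge ler01.
rewrite integral_set1 add0e ge0_integral_setU//=; last 3 first.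
- exact: mE.
- by move=> t _; rewrite lee_fin cut_powR_ge0.
- apply/disj_setPS => t [] /=; rewrite !in_itv/= andbT => /andP[_ h] h'.
  by move: (lt_le_trans h' h); rewrite ltxx.
rewrite [X in (_ + X)%E](_ : _ = 0%E) ?adde0//.
apply: integral0_eq => t /=; rewrite in_itv/= andbT => t1.
rewrite /cut_powR indicE memNset ?mul0r//= in_itv/= => /andP[_] h.
by move: (lt_le_trans t1 h); rewrite ltxx.
Qed.

(** The bound is uniform in [c]: where [|t - c| <= 1] the kernel is below the translate of the one
    centred at 0, elsewhere it is at most 1. The summand 2 is the length of [[-1, 1]]. *)
Lemma integral_cut_powR_le (a c : R) : 0 < a < 1 ->
  (\int[leb]_t (cut_powR a c t)%:E <= (2 + 2 * (1 - a)^-1)%:E)%E.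
Proof.
move=> a01; have /andP[a0 a1] := a01.
have sh : (\int[leb]_t (cut_powR a 0 (t - c))%:E <= (2 * (1 - a)^-1)%:E)%E.
  have := integral_cut_powR0_le a01.
  rewrite (@integral_affine1 R 1 (- c) (EFin \o cut_powR a 0))//=.
  - by rewrite mul1e; under eq_integral do rewrite mul1r addrC.
  - by apply/measurable_EFinP; exact: measurable_cut_powR.
  - by move=> t; rewrite lee_fin cut_powR_ge0.
have m1 : measurable_fun setT (fun t : R => (\1_(`[-1, 1]%classic : set R) t : R)).
  exact: measurable_indic.
have m2 : measurable_fun setT (fun t : R => cut_powR a 0 (t - c)).
  by apply: (measurableT_comp (measurable_cut_powR a 0)); exact: measurable_funB.
have := leeD (lexx 2%:E) sh.
rewrite -EFinD; apply: le_trans.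
have -> : (2%:E = \int[leb]_t (\1_(`[-1, 1]%classic : set R) t)%:E)%E.
  rewrite integral_indic// setIT; apply/esym.
  apply: (etrans (lebesgue_measure_itv `[-1, 1])).
  rewrite /= lte_fin ifT; last by lra.
  by rewrite -EFinB; congr EFin; lra.
rewrite -ge0_integralD//=; last 3 first.
- exact/measurable_EFinP.
- by move=> t _; rewrite lee_fin cut_powR_ge0.
- exact/measurable_EFinP.
apply: ge0_le_integral => //=.
- by move=> t _; rewrite lee_fin cut_powR_ge0.
- by apply/measurable_EFinP; exact: measurable_cut_powR.
- by apply/measurable_EFinP; apply: measurable_funD.
move=> t _; rewrite -EFinD lee_fin /cut_powR subr0.
have [h|h] := leP `|t - c| 1.
  rewrite [X in _ + X * _]indicE mem_set ?mul1r; last by rewrite /= in_itv/= -ler_norml.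
  rewrite indicE; case: (t \in _); rewrite ?mul1r ?mul0r; rewrite ?addr_ge0 ?powR_ge0// lerDr//.
apply: le_trans (_ : \1_(`[-1, 1]%classic : set R) t <= _).
  rewrite ler_piMr// powRN invf_le1 ?powR_gt0//; last by rewrite (lt_trans ltr01).
  apply: le_trans (_ : 1 `^ a <= _); first by rewrite powR1.
  by rewrite ge0_ler_powR ?nnegrE// ltW.
by rewrite lerDl mulr_ge0// powR_ge0.
Qed.

(** The exponent [s] is shared equally among the coordinates. Each factor then has exponent
    [s / n.+1], which is below 1, and so integrable on the line, exactly when [s < n.+1]. *)
Lemma prod_cut_powR_ge n (s : R) (x y : 'rV[R]_n.+1) : 0 <= s ->
  (forall i, y ord0 i != x ord0 i) ->
  \1_(@eball R n.+1 1) y * enorm (x - y) `^ (- s) <=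
  \prod_(i < n.+1) cut_powR (s / n.+1%:R) (x ord0 i) (y ord0 i).
Proof.
move=> s0 yx.
have pr : \prod_(i < n.+1) cut_powR (s / n.+1%:R) (x ord0 i) (y ord0 i) >= 0.
  by apply: prodr_ge0 => i _; exact: cut_powR_ge0.
rewrite indicE; case: (boolP (y \in _)) => [|_]; last by rewrite mul0r.
rewrite inE /eball /= mul1r => y1.
have e0 : 0 < enorm (x - y).
  rewrite enorm_gt0; apply: contra (yx ord0); rewrite subr_eq0 => /eqP ->.
  by rewrite eqxx.
have -> : enorm (x - y) `^ (- s) = \prod_(i < n.+1) enorm (x - y) `^ (- (s / n.+1%:R)).
  rewrite prodr_const card_ord -powR_mulrn ?powR_ge0// -powRrM; congr (_ `^ _).
  by rewrite mulNr divfK// pnatr_eq0.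
apply: ler_prod => i _; rewrite powR_ge0/= /cut_powR indicE mem_set ?mul1r; last first.
  by rewrite /= in_itv/= -ler_norml (le_trans (coord_le_enorm y i))// ltW.
rewrite !powRN lef_pV2 ?posrE ?powR_gt0//; last by rewrite normr_gt0 subr_eq0.
rewrite ge0_ler_powR ?nnegrE ?enorm_ge0 ?divr_ge0//.
by rewrite distrC; have := coord_le_enorm (x - y) i; rewrite !mxE.
Qed.

(** Intersecting the hyperplane with a cube keeps the factors of the other coordinates finite, so
    the zero factor kills the product. *)
Lemma negligible_coord_eq n (x : 'rV[R]_n) (i : 'I_n) :
  (rv_mu n (rv_box 0 1 `&` [set y | y ord0 i = x ord0 i]) = 0)%E.
Proof.
pose h (j : 'I_n) : R -> R := if j == i then \1_[set x ord0 i] else \1_(`[-1, 1]%classic : set R).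
have mA : measurable (rv_box 0 1 `&` [set y : 'rV[R]_n | y ord0 i = x ord0 i]).
  apply: measurableI; first exact: measurable_rv_box.
  rewrite -[X in measurable X]setTI.
  exact: (@measurable_coord R n i measurableT [set x ord0 i] (measurable_set1 _)).
apply/eqP; rewrite eq_le measure_ge0 andbT.
rewrite -[X in rv_mu _ X]setIT -integral_indic//.
apply: (@le_trans _ _ (\int[rv_mu n]_y (\prod_(j < n) h j (y ord0 j))%:E)%E).
  apply: ge0_le_integral => //=.
  - by apply/measurable_EFinP; exact: measurable_indic.
  - apply/measurable_EFinP; apply: measurable_prod_coord => j; rewrite /h.
    by case: ifP => _; exact: measurable_indic.
  - move=> y _; rewrite lee_fin indicE; case: (boolP (y \in _)) => [|_]; last first.
      by apply: prodr_ge0 => j _; rewrite /h; case: ifP.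
    rewrite inE => -[yb yi]; rewrite big1// => j _; rewrite /h.
    case: eqP => [->|_]; rewrite indicE mem_set//.
    by have := yb j; rewrite /= mxE subr0 in_itv/= -ler_norml.
rewrite (@integral_prod_coord R n h (fun j => if j == i then 0 else 2)).
- by rewrite lee_fin (bigD1 i)//= eqxx mul0r.
- by move=> j; rewrite /h; case: ifP => _; exact: measurable_indic.
- by move=> j t; rewrite /h; case: ifP.
- move=> j; rewrite /h; case: eqP => _.
    by rewrite integral_indic// setIT; exact: lebesgue_measure_set1.
  rewrite integral_indic// setIT.
  apply: (etrans (lebesgue_measure_itv `[-1, 1])).
  rewrite /= lte_fin ifT; last by lra.
  by rewrite -EFinB; congr EFin; lra.
Qed.

Lemma measurable_riesz n (s : R) (x : 'rV[R]_n) :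
  measurable_fun setT (fun y : 'rV[R]_n => enorm (x - y) `^ (- s)).
Proof.
by apply: (measurableT_comp (@measurable_powR R (- s))); exact: measurable_enormB.
Qed.

Lemma measurable_eball n (r : R) : measurable (@eball R n r).
Proof. by apply: rv_open_measurable; exact: open_eball. Qed.

(* The radial kernel is dominated by a product of one-dimensional kernels,
   because |x - y| bounds each |x_i - y_i|. *)
Lemma integral_riesz_le n (s : R) : 0 < s < n.+1%:R ->
  exists C : R, forall x : 'rV[R]_n.+1,
  (\int[rv_mu n.+1]_y (\1_(@eball R n.+1 1) y * enorm (x - y) `^ (- s))%:E <= C%:E)%E.
Proof.
move=> /andP[s0 sn].
have a01 : 0 < s / n.+1%:R < 1 by rewrite divr_gt0//= ltr_pdivrMr// mul1r.
exists ((2 + 2 * (1 - s / n.+1%:R)^-1) ^+ n.+1) => x.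
apply: le_trans (@integral_prod_coord_le R n.+1
  (fun i => cut_powR (s / n.+1%:R) (x ord0 i)) _ _ _ _); last 3 first.
- by move=> i; exact: measurable_cut_powR.
- by move=> i t; exact: cut_powR_ge0.
- by move=> i; exact: integral_cut_powR_le.
apply: ae_ge0_le_integral => //.
- by move=> y _; rewrite lee_fin mulr_ge0// powR_ge0.
- apply/measurable_EFinP; apply: measurable_funM; last exact: measurable_riesz.
  by apply: measurable_indic; exact: measurable_eball.
- by move=> y _; rewrite lee_fin prodr_ge0// => i _; exact: cut_powR_ge0.
- apply/measurable_EFinP.
  apply: (@measurable_prod_coord R n.+1 (fun i => cut_powR (s / n.+1%:R) (x ord0 i))) => i.
  exact: measurable_cut_powR.
(* The hyperplanes on which the pointwise comparison fails. Indexing them by naturals through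
   [inord] allows countable subadditivity of null sets. *)
pose N (i : nat) : set 'rV[R]_n.+1 := rv_box 0 1 `&` [set y | y ord0 (inord i) = x ord0 (inord i)].
apply: (@negligibleS _ _ _ _ (\bigcup_i N i)); last first.
  apply: negligible_bigcup => i; apply/negligibleP; last exact: negligible_coord_eq.
  apply: measurableI; first exact: measurable_rv_box.
  rewrite -[X in measurable X]setTI.
  exact: (@measurable_coord R n.+1 (inord i) measurableT [set x ord0 (inord i)] (measurable_set1 _)).
move=> y /= /not_implyP[_ h].
apply: contrapT => yN; apply: h; rewrite lee_fin.
have [y1|y1] := boolP (y \in @eball R n.+1 1); last first.
  rewrite indicE (negbTE y1) mul0r prodr_ge0// => i _; exact: cut_powR_ge0.
apply: prod_cut_powR_ge => [|i]; first exact: ltW.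
apply/eqP => e; apply: yN; exists (nat_of_ord i) => //; split.
  move=> j; rewrite mxE subr0; apply: le_trans (coord_le_enorm y j) _.
  by move: y1; rewrite inE => /ltW.
by rewrite /= inord_val.
Qed.

End kernel_integrals.

(** * Calculus of C^k functions *)

Section Ck_theory.
Context {R : realType} {n : nat}.
Local Notation V := 'rV[R]_n.
Implicit Types (U O : set V) (f g : V -> R) (x y v : V).

Lemma is_derive_line f x v (t d : R) :
  is_derive (x + t *: v) v f d -> is_derive t 1 (fun h : R => f (x + h *: v)) d.
Proof.
have e : (fun h : R => h^-1 *: ((f \o shift (x + t *: v)) (h *: v) - f (x + t *: v))) =
  (fun h : R => h^-1 *: (((fun h : R => f (x + h *: v)) \o shift t) (h *: 1) - f (x + t *: v))).
  apply/funext => h; congr (_ *: (f _ - _)) => /=.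
  by rewrite [h%:A]mulr1 scalerDl addrC -addrA [t *: v + _]addrC.
move=> [df fd]; apply: DeriveDef.
  by move: df; rewrite /derivable e.
by rewrite -fd /derive e.
Qed.

Lemma is_derive_line0 f x v (d : R) :
  is_derive (0 : R) 1 (fun h : R => f (x + h *: v)) d -> is_derive x v f d.
Proof.
have e : (fun h : R => h^-1 *: ((f \o shift x) (h *: v) - f x)) =
  (fun h : R => h^-1 *: (((fun h : R => f (x + h *: v)) \o shift 0) (h *: 1) - f (x + 0 *: v))).
  apply/funext => h; rewrite scale0r addr0; congr (_ *: (f _ - _)) => /=.
  by rewrite [h%:A]mulr1 addr0 addrC.
move=> [df fd]; apply: DeriveDef.
  by rewrite /derivable e.
by rewrite /derive e.
Qed.

(** [Ck] provides directional derivatives only, so the chain rule is taken along the line through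
    [x] in direction [v], where it is the one-variable rule. *)
Lemma is_derive_comp1 (phi : R -> R) f x v (a b : R) :
  is_derive (f x) 1 phi a -> is_derive x v f b ->
  is_derive x v (fun y => phi (f y)) (a * b).
Proof.
move=> dphi df; apply: is_derive_line0.
apply: (@is_derive1_comp R phi (fun h : R => f (x + h *: v)) 0).
  by rewrite scale0r addr0.
by apply: is_derive_line; rewrite scale0r addr0.
Qed.

Lemma near_open U x (P : V -> Prop) : open U -> U x ->
  (forall y, U y -> P y) -> \forall y \near x, P y.
Proof.
by move=> oU Ux h; apply: (filterS (P := U)) => //; exact: open_nbhs_nbhs.
Qed.

Lemma derivable_ext U f g x v : open U -> U x -> {in U, f =1 g} ->
  derivable f x v -> derivable g x v.
Proof.
move=> oU Ux fg; apply: near_eq_derivable.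
by apply: (near_open oU Ux) => y Uy; rewrite fg// inE.
Qed.

Lemma partial_ext U f g x i : open U -> U x -> {in U, f =1 g} ->
  partial i f x = partial i g x.
Proof.
move=> oU Ux fg; apply: near_eq_derive.
by apply: (near_open oU Ux) => y Uy; rewrite fg// inE.
Qed.

Lemma partialD i f g x : derivable f x (evec R i) -> derivable g x (evec R i) ->
  partial i (fun y => f y + g y) x = partial i f x + partial i g x.
Proof. by move=> df dg; exact: deriveD. Qed.

Lemma partialM i f g x : derivable f x (evec R i) -> derivable g x (evec R i) ->
  partial i (fun y => f y * g y) x = partial i f x * g x + f x * partial i g x.
Proof.
move=> df dg; apply: (etrans (deriveM df dg)); rewrite addrC; congr (_ + _).
exact: mulrC.
Qed.

Lemma partialZ i (k : R) f x : derivable f x (evec R i) ->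
  partial i (fun y => k * f y) x = k * partial i f x.
Proof. by move=> df; exact: deriveZ. Qed.

Lemma partial_cst i (k : R) x : partial i (fun _ => k) x = 0.
Proof. exact: derive_cst. Qed.

Lemma is_derive_coord (i j : 'I_n) x :
  is_derive x (evec R i) (fun y : V => y ord0 j) (i == j)%:R.
Proof.
apply: is_derive_line0.
have h (c : R) : is_derive (0 : R) 1 (fun h : R => x ord0 j + h * c) c.
  have := @is_deriveD _ _ _ _ _ _ _ _ _ (is_derive_cst (x ord0 j) (0 : R) 1)
    (@is_deriveM _ _ id (cst c) (0 : R) 1 1 0 (is_derive_id _ _) (is_derive_cst _ _ _)).
  by rewrite add0r scaler0 add0r [c *: 1]mulr1.
rewrite (_ : (fun _ => _) = (fun h : R => x ord0 j + h * (i == j)%:R))//.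
by apply/funext => t; rewrite !mxE eqxx /= eq_sym.
Qed.

Lemma partial_coord (i j : 'I_n) x : partial i (fun y : V => y ord0 j) x = (i == j)%:R.
Proof. by have [_] := is_derive_coord i j x. Qed.

Lemma Ck_cont k U f : Ck k U f -> {in U, continuous f}.
Proof. by case: k => [|k] //= -[]. Qed.

Lemma CkS k U f : Ck k.+1 U f -> Ck k U f.
Proof.
elim: k f => [|k IH] f /=; first by case.
by move=> [cf [df pf]]; split => //; split => // i; apply: IH; exact: pf.
Qed.

Lemma Ck_le j k U f : (j <= k)%N -> Ck k U f -> Ck j U f.
Proof.
move=> /subnK <-; elim: (k - j)%N => [//|d IH].
by rewrite addSn => /CkS.
Qed.

Lemma Ck_sub k U O f : O `<=` U -> Ck k U f -> Ck k O f.
Proof.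
move=> OU; elim: k f => [|k IH] f /=.
  by move=> cf x; rewrite inE => /OU Ux; apply: cf; rewrite inE.
move=> [cf [df pf]]; split.
  by move=> x; rewrite inE => /OU Ux; apply: cf; rewrite inE.
by split => [i x /OU|i]; [exact: df|apply: IH; exact: pf].
Qed.

Lemma in_continuous_ext U f g : open U -> {in U, f =1 g} ->
  {in U, continuous f} -> {in U, continuous g}.
Proof.
move=> oU fg cf x xU; have Ux := xU; rewrite inE in Ux.
rewrite /continuous_at -(fg x xU).
apply: cvg_trans (cf x xU); apply: (@near_eq_cvg _ _ (nbhs x)).
near=> y; apply: fg; rewrite inE; near: y.
exact: open_nbhs_nbhs.
Unshelve. all: by end_near. Qed.

Lemma Ck_ext k U f g : open U -> {in U, f =1 g} -> Ck k U f -> Ck k U g.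
Proof.
move=> oU; elim: k f g => [|k IH] f g fg /=; first exact: in_continuous_ext.
move=> [cf [df pf]]; split; first exact: in_continuous_ext cf.
split => [i x Ux|i]; first by apply: (derivable_ext oU Ux fg); exact: df.
apply: IH (pf i) => x; rewrite inE => Ux; exact: (partial_ext _ oU Ux fg).
Qed.

(** Serves to glue: the functions cut off near 0 are smooth on two overlapping open pieces for two
    different reasons. *)
Lemma Ck_local k U f :
  (forall x, U x -> exists O, [/\ O x & Ck k O f]) -> Ck k U f.
Proof.
elim: k f => [|k IH] f h /=.
  move=> x; rewrite inE => /h [W [Wx cW]].
  by apply: cW; rewrite inE.
split.
  by move=> x; rewrite inE => /h [W [Wx [cW _]]]; apply: cW; rewrite inE.
split => [i x /h [W [Wx [_ [dW _]]]]|i]; first exact: dW.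
apply: IH => x /h [W [Wx [_ [_ pW]]]]; exists W; split => //; exact: pW.
Qed.

Lemma Ck_cst k U (c : R) : Ck k U (fun _ => c).
Proof.
elim: k c => [|k IH] c /=; first by move=> x _; exact: cst_continuous.
split; first by move=> x _; exact: cst_continuous.
split => [i x _|i]; first exact: derivable_cst.
rewrite (_ : partial i _ = fun=> 0); first exact: IH.
by apply/funext => x; exact: partial_cst.
Qed.

Lemma Ck_coord k U (j : 'I_n) : Ck k U (fun y => y ord0 j).
Proof.
have c0 : {in U, continuous (fun y : V => y ord0 j)}.
  by move=> x _; exact: coord_continuous.
case: k => [//|k]; split => //; split => [i x _|i].
  by have [] := is_derive_coord i j x.
rewrite (_ : partial i _ = fun=> (i == j)%:R); first exact: Ck_cst.
by apply/funext => x; exact: partial_coord.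
Qed.

Lemma CkD k U f g : open U -> Ck k U f -> Ck k U g -> Ck k U (fun y => f y + g y).
Proof.
move=> oU; elim: k f g => [|k IH] f g /=.
  by move=> cf cg x xU; exact: (continuousD (cf x xU) (cg x xU)).
move=> [cf [df pf]] [cg [dg pg]]; split.
  by move=> x xU; exact: (continuousD (cf x xU) (cg x xU)).
split => [i x Ux|i]; first by apply: derivableD; [exact: df|exact: dg].
apply: (Ck_ext oU) (IH _ _ (pf i) (pg i)) => x; rewrite inE => Ux.
by rewrite partialD//; [exact: df|exact: dg].
Qed.

Lemma CkM k U f g : open U -> Ck k U f -> Ck k U g -> Ck k U (fun y => f y * g y).
Proof.
move=> oU; elim: k f g => [|k IH] f g.
  by move=> cf cg x xU; exact: (continuousM (cf x xU) (cg x xU)).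
move=> hf hg; have := hf; have := hg.
move=> [cg [dg pg]] [cf [df pf]]; split.
  by move=> x xU; exact: (continuousM (cf x xU) (cg x xU)).
split => [i x Ux|i]; first by apply: derivableM; [exact: df|exact: dg].
apply: (Ck_ext oU) (CkD oU (IH _ _ (pf i) (CkS hg)) (IH _ _ (CkS hf) (pg i))).
by move=> x; rewrite inE => Ux; rewrite partialM//; [exact: df|exact: dg].
Qed.

Lemma CkZ k U (c : R) f : open U -> Ck k U f -> Ck k U (fun y => c * f y).
Proof. by move=> oU hf; apply: CkM => //; exact: Ck_cst. Qed.

Lemma CkN k U f : open U -> Ck k U f -> Ck k U (fun y => - f y).
Proof.
move=> oU hf; apply: (Ck_ext oU) (CkZ (-1) oU hf) => x _.
by rewrite mulN1r.
Qed.

Lemma CkB k U f g : open U -> Ck k U f -> Ck k U g -> Ck k U (fun y => f y - g y).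
Proof. by move=> oU hf hg; apply: CkD => //; exact: CkN. Qed.

Lemma Ck_sum k U (I : Type) (r : seq I) (F : I -> V -> R) : open U ->
  (forall i, Ck k U (F i)) -> Ck k U (fun y => \sum_(i <- r) F i y).
Proof.
move=> oU hF; elim: r => [|i r IH].
  by apply: (Ck_ext oU) (Ck_cst k U 0) => x _; rewrite big_nil.
by apply: (Ck_ext oU) (CkD oU (hF i) IH) => x _; rewrite big_cons.
Qed.

(** [phi] lists the successive derivatives of the outer function, [phi 0] being the function itself.
    The induction shifts the list by one, which is why a whole family is quantified rather than one
    function. *)
Lemma Ck_comp k U (phi : nat -> R -> R) (D : set R) f : open U ->
  (forall j t, (j < k)%N -> D t -> is_derive t 1 (phi j) (phi j.+1 t)) ->
  (forall j t, (j <= k)%N -> D t -> {for t, continuous (phi j)}) ->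
  (forall x, U x -> D (f x)) -> Ck k U f -> Ck k U (fun y => phi 0%N (f y)).
Proof.
move=> oU; elim: k phi => [|k IH] phi hd hc hD hf.
  move=> x xU; apply: (@continuous_comp _ _ _ f (phi 0%N)); first exact: hf.
  by apply: hc => //; apply: hD; move: xU; rewrite inE.
have dphi x i : U x -> is_derive x (evec R i) (fun y => phi 0%N (f y))
    (phi 1%N (f x) * partial i f x).
  move=> Ux; apply: is_derive_comp1; first by apply: hd => //; exact: hD.
  by apply: derivableP; apply: (hf.2).1.
split.
  move=> x xU; apply: (@continuous_comp _ _ _ f (phi 0%N)); first exact: (Ck_cont hf).
  by apply: hc => //; apply: hD; move: xU; rewrite inE.
split => [i x Ux|i]; first by have [] := dphi x i Ux.
have h1 : Ck k U (fun y => phi 1%N (f y)).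
  apply: (IH (fun j => phi j.+1)) => //.
  - by move=> j t jk; exact: hd.
  - by move=> j t jk; exact: hc.
  - exact: CkS.
apply: (Ck_ext oU) (CkM oU h1 (hf.2.2 i)) => x; rewrite inE => Ux.
by have [_] := dphi x i Ux; rewrite /partial => ->.
Qed.

Lemma Ck_partial k U f i : Ck k.+1 U f -> Ck k U (partial i f).
Proof. by move=> [_ [_ h]]; exact: h. Qed.

Lemma Ck_derivable k U f i x : U x -> Ck k.+1 U f -> derivable f x (evec R i).
Proof. by move=> Ux [_ [h _]]; exact: h. Qed.
Arguments Ck_derivable {k U f} i {x}.

Lemma Ck_laplacian k U f : open U -> Ck k.+2 U f -> Ck k U (laplacian f).
Proof.
move=> oU hf; apply: Ck_sum => // i; apply: Ck_partial; exact: Ck_partial.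
Qed.

Lemma polylapS m f : polylap m.+1 f = fun x => - laplacian (polylap m f) x.
Proof. by []. Qed.

Lemma Ck_polylap m k U f : open U -> Ck (m.*2 + k) U f -> Ck k U (polylap m f).
Proof.
move=> oU; elim: m k f => [|m IH] k f hf //.
rewrite polylapS; apply: CkN => //; apply: Ck_laplacian => //; apply: IH.
by move: hf; rewrite doubleS !addSn !addnS.
Qed.

Lemma laplacian_ext U f g x : open U -> U x -> {in U, f =1 g} ->
  laplacian f x = laplacian g x.
Proof.
move=> oU Ux fg; apply: eq_bigr => i _; apply: (partial_ext _ oU Ux) => y.
by rewrite inE => Uy; exact: (partial_ext _ oU Uy).
Qed.

Lemma polylap_ext m U f g : open U -> {in U, f =1 g} ->
  {in U, polylap m f =1 polylap m g}.
Proof.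
move=> oU fg; elim: m => [//|m IH] x; rewrite inE => Ux.
change (- laplacian (polylap m f) x = - laplacian (polylap m g) x).
by rewrite (@laplacian_ext U (polylap m f) (polylap m g) x oU Ux IH).
Qed.

Lemma laplacianD U f g x : open U -> U x -> Ck 2 U f -> Ck 2 U g ->
  laplacian (fun y => f y + g y) x = laplacian f x + laplacian g x.
Proof.
move=> oU Ux hf hg; rewrite /laplacian -big_split/=; apply: eq_bigr => i _.
have d1 : derivable (partial i f) x (evec R i).
  exact: (Ck_derivable i Ux (Ck_partial i hf)).
have d2 : derivable (partial i g) x (evec R i).
  exact: (Ck_derivable i Ux (Ck_partial i hg)).
rewrite -(partialD d1 d2).
apply: (partial_ext _ oU Ux) => y; rewrite inE => Uy.
exact: (partialD (Ck_derivable i Uy hf) (Ck_derivable i Uy hg)).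
Qed.

Lemma laplacianZ U (c : R) f x : open U -> U x -> Ck 2 U f ->
  laplacian (fun y => c * f y) x = c * laplacian f x.
Proof.
move=> oU Ux hf; rewrite /laplacian mulr_sumr; apply: eq_bigr => i _.
have d1 : derivable (partial i f) x (evec R i).
  exact: (Ck_derivable i Ux (Ck_partial i hf)).
rewrite -(partialZ c d1).
apply: (partial_ext _ oU Ux) => y; rewrite inE => Uy.
exact: (partialZ c (Ck_derivable i Uy hf)).
Qed.

Lemma laplacian_cst (c : R) x : laplacian (fun=> c) x = 0.
Proof.
rewrite /laplacian big1// => i _.
have -> : partial i (fun=> c) = (fun=> 0) :> (V -> R).
  by apply/funext => y; exact: partial_cst.
exact: partial_cst.
Qed.

Lemma laplacian_sum U (I : Type) (r : seq I) (F : I -> V -> R) x : open U -> U x ->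
  (forall i, Ck 2 U (F i)) ->
  laplacian (fun y => \sum_(i <- r) F i y) x = \sum_(i <- r) laplacian (F i) x.
Proof.
move=> oU Ux hF; elim: r => [|j r IH].
  have -> : (fun y => \sum_(i <- [::]) F i y) = fun=> 0.
    by apply/funext => y; rewrite big_nil.
  by rewrite big_nil laplacian_cst.
rewrite big_cons -IH -(laplacianD oU Ux (hF j) (Ck_sum _ oU hF)).
by apply: (laplacian_ext oU Ux) => y _; rewrite big_cons.
Qed.

End Ck_theory.
Arguments Ck_derivable {R n k U f} i {x}.

(** * Integration by parts *)

Section rint.
Context {R : realType} {n : nat}.
Local Notation V := 'rV[R]_n.
Local Notation mu := (@rv_mu R n).
Implicit Types (f g : V -> R) (x y : V).

Definition rintegrable f : Prop := mu.-integrable setT (EFin \o f).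
Definition rint f : R := \int[mu]_x f x.

Lemma rintegrable_measurable f : rintegrable f -> measurable_fun setT f.
Proof. by move=> /measurable_int/measurable_EFinP. Qed.

Lemma rintE f : rintegrable f -> ((rint f)%:E = \int[mu]_x (f x)%:E)%E.
Proof. by move=> hf; rewrite fineK//; exact: integrable_fin_num. Qed.

Lemma rintegrable_lty f : measurable_fun setT f ->
  (\int[mu]_x (`|f x|)%:E < +oo)%E -> rintegrable f.
Proof. by move=> mf hf; apply/integrableP; split => //; exact/measurable_EFinP. Qed.

Lemma rintegrable_leC f (C : R) : measurable_fun setT f ->
  (\int[mu]_x (`|f x|)%:E <= C%:E)%E -> rintegrable f.
Proof. by move=> mf hf; apply: rintegrable_lty => //; rewrite (le_lt_trans hf)// ltry. Qed.

Lemma rintegrable_le f g : measurable_fun setT f -> (forall x, `|f x| <= g x) ->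
  rintegrable g -> rintegrable f.
Proof.
move=> mf fg; apply: le_integrable => //; first exact/measurable_EFinP.
by move=> x _ /=; rewrite lee_fin (le_trans (fg x))// ler_norm.
Qed.

Lemma rintegrableD f g : rintegrable f -> rintegrable g -> rintegrable (fun x => f x + g x).
Proof. by move=> hf hg; exact: (integrableD _ hf hg). Qed.

Lemma rintegrableZ (c : R) f : rintegrable f -> rintegrable (fun x => c * f x).
Proof. by move=> hf; exact: (integrableZl _ c hf). Qed.

Lemma rintegrableN f : rintegrable f -> rintegrable (fun x => - f x).
Proof.
move=> /(rintegrableZ (-1)); rewrite (_ : (fun x => -1 * f x) = fun x => - f x)//.
by apply/funext => x; rewrite mulN1r.
Qed.

Lemma rintegrableB f g : rintegrable f -> rintegrable g -> rintegrable (fun x => f x - g x).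
Proof. by move=> hf /rintegrableN hg; exact: rintegrableD. Qed.

Lemma rintegrable_norm f : rintegrable f -> rintegrable (fun x => `|f x|).
Proof. by move=> hf; exact: integrable_norm. Qed.

Lemma rintegrable0 : rintegrable (fun=> 0).
Proof. exact: integrable0. Qed.

Lemma rintegrable_sum (I : Type) (r : seq I) (F : I -> V -> R) :
  (forall i, rintegrable (F i)) -> rintegrable (fun x => \sum_(i <- r) F i x).
Proof.
move=> hF; elim: r => [|i r IH].
  rewrite (_ : (fun x => _) = fun=> 0); first exact: rintegrable0.
  by apply/funext => x; rewrite big_nil.
rewrite (_ : (fun x => _) = fun x => F i x + \sum_(j <- r) F j x).
  exact: rintegrableD.
by apply/funext => x; rewrite big_cons.
Qed.

Lemma rintD f g : rintegrable f -> rintegrable g ->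
  rint (fun x => f x + g x) = rint f + rint g.
Proof. by move=> hf hg; exact: RintegralD. Qed.

Lemma rintB f g : rintegrable f -> rintegrable g ->
  rint (fun x => f x - g x) = rint f - rint g.
Proof. by move=> hf hg; exact: RintegralB. Qed.

Lemma rintZ (c : R) f : rintegrable f -> rint (fun x => c * f x) = c * rint f.
Proof. by move=> hf; exact: RintegralZl. Qed.

Lemma rintN f : rintegrable f -> rint (fun x => - f x) = - rint f.
Proof.
move=> hf; rewrite -mulN1r -rintZ//; congr rint.
by apply/funext => x; rewrite mulN1r.
Qed.

Lemma rint0 : rint (fun=> 0) = 0.
Proof. by rewrite /rint /Rintegral integral0. Qed.

Lemma rint_sum (I : Type) (r : seq I) (F : I -> V -> R) :
  (forall i, rintegrable (F i)) ->
  rint (fun x => \sum_(i <- r) F i x) = \sum_(i <- r) rint (F i).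
Proof.
move=> hF; elim: r => [|i r IH].
  rewrite big_nil (_ : (fun x => _) = fun=> 0) ?rint0//.
  by apply/funext => x; rewrite big_nil.
rewrite big_cons -IH -rintD//; last exact: rintegrable_sum.
by congr rint; apply/funext => x; rewrite big_cons.
Qed.

Lemma rint_le f g : rintegrable f -> rintegrable g -> (forall x, f x <= g x) ->
  rint f <= rint g.
Proof. by move=> hf hg fg; apply: le_Rintegral. Qed.

Lemma rint_ge0 f : (forall x, 0 <= f x) -> 0 <= rint f.
Proof. by move=> h; apply: Rintegral_ge0. Qed.

Lemma rint_norm f : rintegrable f -> `|rint f| <= rint (fun x => `|f x|).
Proof. by move=> hf; exact: le_normr_Rintegral. Qed.

Lemma rint_norm_le f g : rintegrable f -> rintegrable g -> (forall x, `|f x| <= g x) ->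
  `|rint f| <= rint g.
Proof.
move=> hf hg fg; apply: le_trans (rint_norm hf) _; apply: rint_le => //.
exact: rintegrable_norm.
Qed.

Lemma rint_leC f (C : R) : (forall x, 0 <= f x) ->
  (\int[mu]_x (f x)%:E <= C%:E)%E -> rint f <= C.
Proof.
move=> f0 fC; rewrite -lee_fin /rint /Rintegral fineK// ge0_fin_numE.
  by rewrite (le_lt_trans fC)// ltry.
by apply: integral_ge0 => x _; rewrite lee_fin.
Qed.

(** Dominated convergence with an explicit null set [N], on which nothing is asked of the sequence.
    With a constant sequence it also transfers integrability and integrals across null sets. *)
Lemma rint_cvg (f_ : nat -> V -> R) f g (N : set V) :
  measurable N -> (mu N = 0)%E ->
  (forall k, measurable_fun setT (f_ k)) -> measurable_fun setT f -> rintegrable g ->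
  (forall k x, ~ N x -> `|f_ k x| <= g x) ->
  (forall x, ~ N x -> f_ k x @[k --> \oo] --> f x) ->
  rintegrable f /\ rint (f_ k) @[k --> \oo] --> rint f.
Proof.
move=> mN muN mf_ mf hg f_g f_f.
have h1 : {ae mu, forall x, setT x -> (EFin \o f_ k) x @[k --> \oo] --> (EFin \o f) x}.
  apply: (@negligibleS _ _ _ _ N); last exact/negligibleP.
  move=> x /= h; apply: contrapT => Nx; apply: h => _ /=.
  by apply: cvg_EFin; [near=> k|exact: f_f].
have h2 : {ae mu, forall x k, setT x -> (`|(EFin \o f_ k) x| <= (EFin \o g) x)%E}.
  apply: (@negligibleS _ _ _ _ N); last exact/negligibleP.
  move=> x /= h; apply: contrapT => Nx; apply: h => k _ /=.
  by rewrite lee_fin f_g.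
have mE k : measurable_fun setT (EFin \o f_ k) by exact/measurable_EFinP.
have [hf _ cv] := dominated_convergence measurableT mE
  ((measurable_EFinP _ _).2 mf) h1 hg h2.
split => //.
by apply: fine_cvg; rewrite /= (rintE hf).
Unshelve. all: by end_near. Qed.

End rint.

Section ibp.
Context {R : realType} {n : nat}.
Local Notation V := 'rV[R]_n.
Local Notation mu := (@rv_mu R n).
Implicit Types (f g h : V -> R) (x y : V).

Lemma rintegrable_affine (a : R) (b : V) f : 0 < a -> rintegrable f ->
  rintegrable (fun y => f (b + a *: y)).
Proof.
move=> a0 hf; have mf := rintegrable_measurable hf.
have mfa : measurable_fun setT (fun y => f (b + a *: y)).
  by apply: (measurableT_comp mf); exact: measurable_affine.
apply: rintegrable_lty => //.
have : (\int[mu]_x (`|f x|)%:E < +oo)%E by have /integrableP[] := hf.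
rewrite (@integral_affine R n a b)//; last first.
  by apply/measurable_EFinP; exact: measurableT_comp.
move=> h; rewrite ltNge; apply/negP; rewrite leye_eq => /eqP e.
by move: h; rewrite [X in (_ * X)%E]e mulry gtr0_sg ?exprn_gt0// mul1e.
Qed.

Lemma rint_affine (a : R) (b : V) f : 0 < a -> rintegrable f ->
  rint f = a ^+ n * rint (fun y => f (b + a *: y)).
Proof.
move=> a0 hf; have hfa := rintegrable_affine b a0 hf.
have mf : measurable_fun setT (EFin \o f) by exact: measurable_int hf.
apply: EFin_inj; rewrite EFinM !rintE//.
have i1 : (\int[mu]_x (EFin \o f)^\+ x)%E \is a fin_num.
  exact: (integrable_pos_fin_num _ hf).
rewrite [LHS]integralE [X in (_ * X)%E]integralE muleBr//; last first.
  apply: fin_num_adde_defl; rewrite fin_numN.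
  exact: (integrable_neg_fin_num _ hfa).
rewrite (@integral_affine R n a b)//; last exact: measurable_funepos.
rewrite [X in (_ - X)%E](@integral_affine R n a b)//; last exact: measurable_funeneg.
by congr (_ - _)%E; congr (_ * _)%E; apply: eq_integral => y _; rewrite ?funeposE ?funenegE.
Qed.

(** Support in a closed ball, phrased as vanishing on an open set, so that derivatives vanish on the
    same set. *)
Definition vanish (r : R) f := forall x, r < enorm x -> f x = 0.

Lemma vanish_partial r f i : vanish r f -> vanish r (partial i f).
Proof.
move=> h x rx; rewrite (@partial_ext R n [set y | r < enorm y] f (fun=> 0) x i) ?partial_cst//.
  exact: open_enorm_gt.
by move=> y; rewrite inE; exact: h.
Qed.

Lemma vanishM r f g : vanish r g -> vanish r (fun x => f x * g x).
Proof. by move=> h x /h ->; rewrite mulr0. Qed.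

Lemma vanish_laplacian r f : vanish r f -> vanish r (laplacian f).
Proof.
move=> h x rx; rewrite /laplacian big1// => i _.
by rewrite (vanish_partial i (vanish_partial i h)).
Qed.

Lemma vanish_polylap m r f : vanish r f -> vanish r (polylap m f).
Proof.
move=> h; elim: m => [//|m IH]; rewrite polylapS => x rx.
by rewrite (vanish_laplacian IH)// oppr0.
Qed.

Lemma compact_bounded_fun (U S : set V) f : compact S -> S `<=` U ->
  {in U, continuous f} -> exists A : R, 0 < A /\ forall x, S x -> `|f x| <= A.
Proof.
move=> cS SU cf.
have [S0|/set0P[x0 Sx0]] := eqVneq S set0.
  by exists 1; split => // x; rewrite S0.
have [|c cSc hc] := @EVT_max_rV R n (fun x => `|f x|) S (ex_intro _ x0 Sx0) cS.
  apply: continuous_in_subspaceT => x; rewrite inE => /SU Ux.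
  apply: (@continuous_comp _ _ _ f (fun t : R => `|t|)); last exact: norm_continuous.
  by apply: cf; rewrite inE.
exists (`|f c| + 1); split; first by rewrite ltr_wpDl.
by move=> x Sx; rewrite ler_wpDr// hc// inE.
Qed.

Lemma vanish_bounded r f : {in setT, continuous f} -> vanish r f ->
  exists A : R, 0 < A /\ forall x, `|f x| <= A.
Proof.
move=> cf h.
have [A [A0 hA]] := compact_bounded_fun (@compact_ceball R n r) (@subsetT _ _) cf.
exists A; split => // x; have [xr|xr] := leP (enorm x) r; first exact: hA.
by rewrite h// normr0 ltW.
Qed.

Lemma rv_mu_eball r : (mu (eball n r) < +oo)%E.
Proof.
have r0 : 0 <= `|r| by [].
apply: (@le_lt_trans _ _ (mu (rv_box 0 `|r|))); last by rewrite rv_mu_box ?ltry.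
apply: le_measure; rewrite ?inE; [exact: measurable_eball|exact: measurable_rv_box|].
move=> x xr i; rewrite mxE subr0 (le_trans (coord_le_enorm x i))//.
by rewrite (le_trans (ltW xr))// ler_norm.
Qed.

Lemma rintegrable_indic_eball r : rintegrable (\1_(eball n r) : V -> R).
Proof.
apply: rintegrable_lty; first by apply: measurable_indic; exact: measurable_eball.
under eq_integral do rewrite ger0_norm//.
rewrite integral_indic//; last exact: measurable_eball.
by rewrite setIT rv_mu_eball.
Qed.

Lemma rintegrable_bounded r f (A : R) : measurable_fun setT f ->
  (forall x, `|f x| <= A) -> vanish r f -> rintegrable f.
Proof.
move=> mf fA h.
apply: (rintegrable_le mf _ (rintegrableZ A (rintegrable_indic_eball (r + 1)))) => x.
have A0 : 0 <= A by exact: le_trans (fA x).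
have [xr|xr] := leP (enorm x) r; last by rewrite h// normr0 mulr_ge0.
rewrite indicE mem_set ?mulr1//=.
by rewrite /eball /= (le_lt_trans xr)// ltrDl.
Qed.

Lemma Ck_measurable k f : Ck k setT f -> measurable_fun setT f.
Proof.
by move=> /Ck_cont cf; apply: rv_continuous_measurable => //; exact: openT.
Qed.

Lemma rintegrable_Ck k r f : Ck k setT f -> vanish r f -> rintegrable f.
Proof.
move=> hf h; have [A [_ hA]] := vanish_bounded (Ck_cont hf) h.
exact: (rintegrable_bounded (Ck_measurable hf) hA h).
Qed.

Lemma CkT_derivable k f i x : Ck k.+1 setT f -> derivable f x (evec R i).
Proof. by move=> [_ [h _]]; exact: h. Qed.

Arguments CkT_derivable {k f} i x.

Lemma coord_mvt f i x (t A : R) : Ck 1 setT f -> 0 < t ->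
  (forall y, `|partial i f y| <= A) -> `|f (x + t *: evec R i) - f x| <= A * t.
Proof.
move=> hf t0 hA.
have dl (s : R) : is_derive s 1 (fun h : R => f (x + h *: evec R i)) (partial i f (x + s *: evec R i)).
  apply: is_derive_line.
  exact: (derivableP (CkT_derivable i (x + s *: evec R i) hf)).
have [|c _] := @MVT R (fun h : R => f (x + h *: evec R i)) _ 0 t t0 (fun s _ => dl s).
  apply: continuous_subspaceT => s; apply: differentiable_continuous.
  by apply/derivable1_diffP; have [] := dl s.
rewrite scale0r addr0 subr0 => ->.
by rewrite normrM (gtr0_norm t0) ler_wpM2r// ltW.
Qed.

(** Difference quotients have integral 0 by translation invariance, and they converge to the partial
    derivative under a common integrable bound. *)
Lemma rint_partial r f i : Ck 1 setT f -> vanish r f -> rint (partial i f) = 0.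
Proof.
move=> hf h.
have hp : Ck 0 setT (partial i f) by exact: Ck_partial.
have [A [A0 hA]] := vanish_bounded (Ck_cont hp) (vanish_partial i h).
have If := rintegrable_Ck hf h.
pose t (k : nat) : R := k.+1%:R^-1.
have t0 k : 0 < t k by rewrite invr_gt0.
pose F k y := (t k)^-1 * (f (y + t k *: evec R i) - f y).
have Ift k : rintegrable (fun y => f (y + t k *: evec R i)).
  have := rintegrable_affine (t k *: evec R i) ltr01 If.
  by under eq_fun do rewrite scale1r addrC.
have IF k : rintegrable (F k) by apply: rintegrableZ; exact: rintegrableB.
have F0 k : rint (F k) = 0.
  rewrite rintZ ?rintB//; last exact: rintegrableB.
  rewrite (@rint_affine 1 (t k *: evec R i) f)// expr1n mul1r.
  rewrite [X in _ * (X - _)](_ : _ = rint (fun y => f (t k *: evec R i + 1 *: y))).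
    by rewrite subrr mulr0.
  by congr rint; apply/funext => y; rewrite scale1r addrC.
have ev1 : enorm (evec R i : V) <= n%:R * 1.
  apply: enorm_le_coord => j; rewrite mxE; case: andP => _; rewrite ?normr1 ?normr0//.
(* Since [t k <= 1] and a basis vector has norm at most [n], all quotients live in one ball, where
   the mean value theorem bounds them by [A]. *)
have FA k y : `|F k y| <= A * \1_(eball n (`|r| + n%:R + 1)) y.
  have [yr|yr] := leP (enorm y) (`|r| + n%:R).
    rewrite indicE mem_set; last by rewrite /eball/= (le_lt_trans yr)// ltrDl.
    rewrite mulr1.
    rewrite normrM gtr0_norm ?invr_gt0// mulrC ler_pdivrMr//.
    exact: coord_mvt.
  rewrite /F h; last first.
    rewrite ltNge; apply/negP => c.
    have : enorm y <= r + n%:R.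
      rewrite (_ : y = y + t k *: evec R i - t k *: evec R i); last by rewrite addrK.
      rewrite (le_trans (ler_enormB _ _))// lerD// enormZ.
      rewrite (le_trans _ (_ : n%:R * 1 <= _)) ?mulr1//.
      rewrite -[leRHS]mul1r ler_pM ?enorm_ge0// ?(le_trans ev1) ?mulr1//.
      by rewrite gtr0_norm// invf_le1// ler1n.
    by rewrite leNgt (le_lt_trans _ yr)// lerD2r ler_norm.
  rewrite h; last by rewrite (le_lt_trans _ yr)// ler_wpDr// ler_norm.
  by rewrite subrr mulr0 normr0 mulr_ge0// ltW.
have ct : t k @[k --> \oo] --> (0 : R)^'.
  move=> S hS.
  have : \forall k \near \oo, t k != 0 -> S (t k) by exact: (@cvg_harmonic R _ hS).
  by apply: filterS => k; apply; rewrite gt_eqF.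
have cvp y : F k y @[k --> \oo] --> partial i f y.
  have /cvg_ex[l hl] := CkT_derivable i y hf.
  have <- : l = partial i f y by apply/esym/cvg_lim.
  have := cvg_comp _ _ ct hl.
  apply: cvg_trans; apply: near_eq_cvg; near=> k.
  by rewrite /F /= [y + _]addrC.
have [_ cv] := @rint_cvg R n F (partial i f) _ set0 measurable0 (measure0 _)
  (fun k => rintegrable_measurable (IF k)) (Ck_measurable hp)
  (rintegrableZ A (rintegrable_indic_eball _)) (fun k y _ => FA k y)
  (fun y _ => cvp y).
move: cv; rewrite (_ : (fun k => rint (F k)) = fun=> 0); last exact/funext.
by move=> cv; rewrite -(cvg_lim (@Rhausdorff R) cv) lim_cst//; exact: Rhausdorff.
Unshelve. all: by end_near. Qed.

Lemma rint_ibp1 r f g i : Ck 1 setT f -> Ck 1 setT g -> vanish r g ->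
  rint (fun y => partial i f y * g y) = - rint (fun y => f y * partial i g y).
Proof.
move=> hf hg h.
have I1 : rintegrable (fun y => partial i f y * g y).
  apply: (@rintegrable_Ck 0 r); last exact: vanishM.
  by apply: CkM; [exact: openT|exact: Ck_partial|exact: CkS].
have I2 : rintegrable (fun y => f y * partial i g y).
  apply: (@rintegrable_Ck 0 r); last by apply: vanishM; exact: vanish_partial.
  by apply: CkM; [exact: openT|exact: CkS|exact: Ck_partial].
apply/eqP; rewrite -addr_eq0 -rintD//.
rewrite -(@rint_partial r (fun y => f y * g y) i); last exact: vanishM.
  apply/eqP; congr rint; apply/funext => y.
  by rewrite (partialM (CkT_derivable i y hf) (CkT_derivable i y hg)).
by apply: CkM => //; exact: openT.
Qed.

Lemma rint_laplacian r f g : Ck 2 setT f -> Ck 2 setT g -> vanish r g ->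
  rint (fun y => laplacian f y * g y) = rint (fun y => f y * laplacian g y).
Proof.
move=> hf hg h; have oT := @openT V.
transitivity (\sum_(i < n) rint (fun y => partial i (partial i f) y * g y)).
  rewrite -rint_sum.
    by congr rint; apply/funext => y; rewrite /laplacian mulr_suml.
  move=> i; apply: (@rintegrable_Ck 0 r); last exact: vanishM.
  by apply: CkM => //; [exact: Ck_partial (Ck_partial i hf)|exact: (Ck_le _ hg)].
transitivity (\sum_(i < n) rint (fun y => f y * partial i (partial i g) y)); last first.
  rewrite -rint_sum.
    by congr rint; apply/funext => y; rewrite /laplacian mulr_sumr.
  move=> i; apply: (@rintegrable_Ck 0 r); last first.
    by apply: vanishM; apply: vanish_partial; exact: vanish_partial.
  by apply: CkM => //; [exact: (Ck_le _ hf)|exact: Ck_partial (Ck_partial i hg)].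
apply: eq_bigr => i _.
rewrite (rint_ibp1 i (Ck_partial i hf) (CkS hg) h).
rewrite (rint_ibp1 i (CkS hf) (Ck_partial i hg) (vanish_partial i h)).
by rewrite opprK.
Qed.

(** Both functions must be [Ck] on the whole space, while only [g] has bounded support. This shapes
    the later steps: the kernel is regularised or localised, and [U] is cut out around 0, before it
    is applied. *)
Lemma rint_polylap m r f g : Ck m.*2 setT f -> Ck m.*2 setT g -> vanish r g ->
  rint (fun y => polylap m f y * g y) = rint (fun y => f y * polylap m g y).
Proof.
elim: m g => [//|m IH] g hf hg h; have oT := @openT V.
have hm : Ck 2 setT (polylap m f).
  by apply: Ck_polylap => //; move: hf; rewrite doubleS addn2.
have hg2 : Ck 2 setT g by apply: Ck_le hg; rewrite doubleS.
have hlg : Ck m.*2 setT (fun y => - laplacian g y).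
  by apply: CkN => //; apply: Ck_laplacian.
have vlg : vanish r (fun y => - laplacian g y).
  by move=> y ry; rewrite (vanish_laplacian h)// oppr0.
have e : rint (fun y => polylap m.+1 f y * g y) =
         rint (fun y => polylap m f y * (- laplacian g y)).
  transitivity (- rint (fun y => laplacian (polylap m f) y * g y)).
    rewrite -rintN.
      by congr rint; apply/funext => y; rewrite polylapS mulNr.
    apply: (@rintegrable_Ck 0 r); last exact: vanishM.
    by apply: CkM => //; [exact: Ck_laplacian|exact: (Ck_le _ hg2)].
  rewrite (rint_laplacian hm hg2 h) -rintN.
    by congr rint; apply/funext => y; rewrite mulrN.
  apply: (@rintegrable_Ck 0 r); last by apply: vanishM; exact: vanish_laplacian.
  by apply: CkM => //; [exact: (Ck_le _ hm)|exact: Ck_laplacian].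
have hf' : Ck m.*2 setT f by apply: Ck_le hf; rewrite doubleS -addn2 leq_addr.
rewrite e; apply: (etrans (IH _ hf' hlg vlg)).
have -> // : polylap m.+1 g = polylap m (fun y => - laplacian g y).
by rewrite /polylap iterSr.
Qed.

End ibp.
Arguments CkT_derivable {R n k f} i x.

(** * Smoothness of inverses, logarithms and truncated powers *)

Section smooth_families.
Context {R : realType} {n : nat}.
Local Notation V := 'rV[R]_n.
Implicit Types (U : set V) (f : V -> R).

(** The [j]-th derivative of [1 / t], in the form required by [Ck_comp]. *)
Definition inv_fam (j : nat) (t : R) : R := (-1) ^+ j * j`!%:R * t ^- j.+1.

Lemma is_derive_expV (k : nat) (t : R) : t != 0 ->
  is_derive t 1 (fun t : R => t ^- k) (- k%:R * t ^- k.+1).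
Proof.
move=> t0.
have hid : derivable (id : R -> R) t 1 by exact: derivable_id.
have hV : is_derive t 1 (fun t : R => t^-1) (- t ^- 2).
  have dV := @derivableV R R id t 1 t0 hid.
  apply: DeriveDef; first exact: dV.
  apply: (etrans (@deriveV R R id t 1 t0 hid)).
  by rewrite derive_id [_ *: 1]mulr1.
case: k => [|k].
  by rewrite oppr0 mul0r; under eq_fun do rewrite expr0 invr1; exact: is_derive_cst.
have [h1 h2] := @is_deriveX R R (fun t : R => t^-1) k.+1 t 1 _ hV.
have e : (fun t : R => t ^- k.+1) = (fun t : R => t^-1) ^+ k.+1.
  by apply/funext => s; rewrite fctE exprVn.
apply: DeriveDef; rewrite e//; apply: (etrans h2).
rewrite /GRing.scale /= -exprVn -[in RHS]exprVn.
by rewrite [in RHS]exprS [in RHS]exprS mulr_natl; ring.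
Qed.

Lemma is_derive_inv_fam j (t : R) : 0 < t -> is_derive t 1 (inv_fam j) (inv_fam j.+1 t).
Proof.
move=> t0; have := is_derive_expV j.+1 (lt0r_neq0 t0).
move=> /(@is_deriveZ _ _ _ _ ((-1) ^+ j * j`!%:R)); congr is_derive.
rewrite /inv_fam /GRing.scale /= factS natrM [(-1) ^+ j.+1]exprS.
by set T := _ ^- _; ring.
Qed.

Definition ln_fam (j : nat) : R -> R := if j is j'.+1 then inv_fam j' else @ln R.

Lemma is_derive_ln_fam j (t : R) : 0 < t -> is_derive t 1 (ln_fam j) (ln_fam j.+1 t).
Proof.
case: j => [|j] t0; last exact: is_derive_inv_fam.
rewrite /= /inv_fam expr0 fact0 mul1r mul1r expr1; exact: is_derive1_ln.
Qed.

Lemma is_derive_continuous (g : R -> R) (t d : R) : is_derive t 1 g d -> {for t, continuous g}.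
Proof.
by move=> [h _]; apply: differentiable_continuous; exact/derivable1_diffP.
Qed.

Lemma Ck_inv k U f : open U -> (forall x, U x -> 0 < f x) -> Ck k U f ->
  Ck k U (fun y => (f y)^-1).
Proof.
move=> oU f0 hf.
have := @Ck_comp R n k U inv_fam [set t | 0 < t] f oU
  (fun j t _ => @is_derive_inv_fam j t)
  (fun j t _ t0 => is_derive_continuous (@is_derive_inv_fam j t t0)) f0 hf.
by apply: Ck_ext => // x _; rewrite /inv_fam expr0 fact0 !mul1r expr1.
Qed.

Lemma Ck_ln k U f : open U -> (forall x, U x -> 0 < f x) -> Ck k U f ->
  Ck k U (fun y => ln (f y)).
Proof.
move=> oU f0 hf.
exact: (@Ck_comp R n k U ln_fam [set t | 0 < t] f oU
  (fun j t _ => @is_derive_ln_fam j t)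
  (fun j t _ t0 => is_derive_continuous (@is_derive_ln_fam j t t0)) f0 hf).
Qed.

Lemma CkX k U f j : open U -> Ck k U f -> Ck k U (fun y => f y ^+ j).
Proof.
move=> oU hf; elim: j => [|j IH]; first exact: Ck_cst.
apply: (Ck_ext oU) (CkM oU hf IH) => x _.
by rewrite exprS.
Qed.

(** A function that is flat on the negative axis and of class C^(N-1); finite smoothness is all that
    a cutoff for an operator of order 2m has to have. *)
Definition pos_pow (N : nat) (t : R) : R := Num.max t 0 ^+ N.

Lemma pos_pow_le0 N t : (0 < N)%N -> t <= 0 -> pos_pow N t = 0.
Proof. by move=> N0 t0; rewrite /pos_pow (max_idPr _)// expr0n gtn_eqF. Qed.

Lemma pos_pow_ge0 N t : 0 <= t -> pos_pow N t = t ^+ N.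
Proof. by move=> t0; rewrite /pos_pow (max_idPl _). Qed.

Lemma is_derive_pos_pow N (t : R) :
  is_derive t 1 (pos_pow N.+2) (N.+2%:R * pos_pow N.+1 t).
Proof.
have hX (M : nat) (s : R) : is_derive s 1 (fun u : R => u ^+ M.+1) (M.+1%:R * s ^+ M).
  have [h1 h2] := @is_deriveX R R id M.+1 s 1 1 (is_derive_id _ _).
  have e : (fun u : R => u ^+ M.+1) = (id : R -> R) ^+ M.+1.
    by apply/funext => u; rewrite exprfctE.
  apply: DeriveDef; rewrite e//; apply: (etrans h2).
  by rewrite /GRing.scale /= mulr1.
have [t0|t0|t0] := ltgtP t 0.
- rewrite pos_pow_le0// ?mulr0; last exact: ltW.
  apply: (near_eq_is_derive _ (is_derive_cst (0 : R) t 1)).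
  near=> s; rewrite pos_pow_le0//; near: s; exact: lt_le_nbhsl.
- rewrite pos_pow_ge0; last exact: ltW.
  apply: (near_eq_is_derive _ (hX N.+1 t)).
  near=> s; rewrite pos_pow_ge0//; near: s; exact: lt_le_nbhsr.
- rewrite t0 pos_pow_le0// mulr0.
  have h : (fun h : R => h^-1 *: ((pos_pow N.+2 \o shift 0) (h *: 1) - pos_pow N.+2 0)) @ (0:R)^' --> (0:R).
    apply/cvgr0Pnorm_le => e e0; near=> h.
    rewrite pos_pow_le0// subr0 /= addr0 [h%:A]mulr1 /pos_pow.
    have h1 : `|h| <= 1 by near: h; apply: dnbhs0_le.
    have he : `|h| <= e by near: h; apply: dnbhs0_le.
    have hn : h != 0 by near: h; exact: nbhs_dnbhs_neq.
    have [hp|hp] := leP h 0.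
      by rewrite expr0n scaler0 normr0 ltW.
    rewrite normrZ normfV normrX exprS mulrA mulVf ?normr_eq0// mul1r exprS.
    by rewrite -[leRHS]mulr1 ler_pM// exprn_ile1.
  by apply: DeriveDef; [apply/cvg_ex; exists 0|exact: cvg_lim].
Unshelve. all: by end_near. Qed.

Lemma Ck_pos_pow k N U f : open U -> (k.+1 <= N)%N -> Ck k U f ->
  Ck k U (fun y => pos_pow N (f y)).
Proof.
move=> oU; elim: k N => [|k IH] [//|N] kN hf.
  move=> x xU; apply: (@continuous_comp _ _ _ f (pos_pow N.+1)); first exact: hf.
  apply: (@continuous_comp _ _ _ (fun t : R => Num.max t 0) (fun t : R => t ^+ N.+1)).
    apply: continuous_max; first exact: cvg_id.
    exact: cvg_cst.
  exact: exprn_continuous.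
case: N kN => [//|N] kN.
have df x i : U x -> is_derive x (evec R i) (fun y => pos_pow N.+2 (f y))
    (N.+2%:R * pos_pow N.+1 (f x) * partial i f x).
  move=> Ux; apply: is_derive_comp1; first exact: is_derive_pos_pow.
  exact: (derivableP (Ck_derivable i Ux hf)).
split.
  move=> x xU; apply: (@continuous_comp _ _ _ f (pos_pow N.+2)); first exact: (Ck_cont hf).
  exact: (is_derive_continuous (is_derive_pos_pow N (f x))).
split => [i x Ux|i]; first by have [] := df x i Ux.
apply: (Ck_ext oU) (CkM oU (CkZ N.+2%:R oU (IH N.+1 kN (CkS hf))) (Ck_partial i hf)).
by move=> x; rewrite inE => Ux; have [_] := df x i Ux; rewrite /partial => ->.
Qed.

End smooth_families.

(** * The logarithmic fundamental solution *)

Section radial.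
Context {R : realType} {n : nat}.
Local Notation V := 'rV[R]_n.
Variables (x : V) (d : R).

(** The shift [d] takes three kinds of values: [t ^+ 2] for the regularised logarithm, 0 for the
    logarithm itself, and -1 with centre 0 in [cutoff], where the sign tells the inside of the unit
    sphere from the outside. *)
Definition sq_dist (y : V) : R := d + \sum_(i < n) (y ord0 i - x ord0 i) ^+ 2.

Lemma sq_dist_enorm y : sq_dist y = d + enorm (x - y) ^+ 2.
Proof.
rewrite /sq_dist sqr_enorm; congr (_ + _); apply: eq_bigr => i _.
by rewrite !mxE -sqrrN opprB.
Qed.

Lemma Ck_sq_dist k U : open U -> Ck k U sq_dist.
Proof.
move=> oU; apply: CkD => //; first exact: Ck_cst.
apply: Ck_sum => // i; apply: CkX => //; apply: CkB => //; [exact: Ck_coord|exact: Ck_cst].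
Qed.

Lemma partial_coordB (i j : 'I_n) y :
  partial i (fun z : V => z ord0 j - x ord0 j) y = (i == j)%:R.
Proof.
rewrite (partialD (f := fun z : V => z ord0 j) (g := fun=> - x ord0 j)).
- by rewrite partial_coord partial_cst addr0.
- by have [] := is_derive_coord i j y.
- exact: derivable_cst.
Qed.

Lemma is_derive_sq_dist i y : is_derive y (evec R i) sq_dist (2 * (y ord0 i - x ord0 i)).
Proof.
have oT := @openT V.
have hc j : Ck 2 setT (fun z : V => z ord0 j - x ord0 j).
  by apply: CkB => //; [exact: Ck_coord|exact: Ck_cst].
apply: DeriveDef; first exact: (CkT_derivable i y (Ck_sq_dist 1 oT)).
rewrite -[LHS]/(partial i sq_dist y) /sq_dist.
rewrite (partialD (f := fun=> d) (g := fun y : V => \sum_(i < n) (y ord0 i - x ord0 i) ^+ 2)).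
- rewrite partial_cst add0r.
  have -> : partial i (fun y : V => \sum_(i < n) (y ord0 i - x ord0 i) ^+ 2) y =
     \sum_(j < n) partial i (fun y : V => (y ord0 j - x ord0 j) ^+ 2) y.
    rewrite /partial -derive_sum; last first.
      by move=> j; apply: (@CkT_derivable _ _ 0); apply: CkX => //; exact: (CkS (hc j)).
    by congr ('D_ _ _ _); apply/funext => z; rewrite fct_sumE.
  rewrite (bigD1 i)//= big1 ?addr0.
    have dc := CkT_derivable i y (hc i).
    have -> : (fun z : V => (z ord0 i - x ord0 i) ^+ 2) =
              (fun z : V => (z ord0 i - x ord0 i) * (z ord0 i - x ord0 i)).
      by apply/funext => z; rewrite expr2.
    by rewrite (partialM dc dc) partial_coordB eqxx mulr1n; ring.
  move=> j ji; have dc := CkT_derivable i y (hc j).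
  have -> : (fun z : V => (z ord0 j - x ord0 j) ^+ 2) =
              (fun z : V => (z ord0 j - x ord0 j) * (z ord0 j - x ord0 j)).
    by apply/funext => z; rewrite expr2.
  by rewrite (partialM dc dc) partial_coordB eq_sym (negbTE ji) mul0r mulr0 addr0.
- exact: derivable_cst.
- apply: (@CkT_derivable _ _ 0); apply: Ck_sum => // j; apply: CkX => //.
  exact: (CkS (hc j)).
Qed.

Lemma laplacian_radial (phi phi1 phi2 : R -> R) (U : set V) y : open U -> U y ->
  (forall z, U z -> is_derive (sq_dist z) 1 phi (phi1 (sq_dist z))) ->
  (forall z, U z -> is_derive (sq_dist z) 1 phi1 (phi2 (sq_dist z))) ->
  laplacian (fun z => phi (sq_dist z)) y =
  4 * (sq_dist y - d) * phi2 (sq_dist y) + 2 * n%:R * phi1 (sq_dist y).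
Proof.
move=> oU Uy h1 h2.
have p1 z i : U z -> partial i (fun z => phi (sq_dist z)) z =
    phi1 (sq_dist z) * (2 * (z ord0 i - x ord0 i)).
  by move=> Uz; have [_] := is_derive_comp1 (h1 z Uz) (is_derive_sq_dist i z).
have p2 i : partial i (partial i (fun z => phi (sq_dist z))) y =
   4 * phi2 (sq_dist y) * (y ord0 i - x ord0 i) ^+ 2 + 2 * phi1 (sq_dist y).
  rewrite (@partial_ext R n U _ (fun z => phi1 (sq_dist z) * (2 * (z ord0 i - x ord0 i))) y i)//;
    last by move=> z; rewrite inE => Uz; exact: p1.
  have [dp pE] := is_derive_comp1 (h2 y Uy) (is_derive_sq_dist i y).
  have dc : derivable (fun z : V => z ord0 i - x ord0 i) y (evec R i).
    by apply: (@CkT_derivable _ _ 0); apply: CkB; [exact: openT|exact: Ck_coord|exact: Ck_cst].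
  have dc2 : derivable (fun z : V => 2 * (z ord0 i - x ord0 i)) y (evec R i).
    apply: (@CkT_derivable _ _ 0); apply: CkZ; first exact: openT.
    by apply: CkB; [exact: openT|exact: Ck_coord|exact: Ck_cst].
  rewrite (partialM dp dc2) (partialZ 2 dc) partial_coordB eqxx mulr1n /partial pE; ring.
rewrite /laplacian (eq_bigr _ (fun i _ => p2 i)) big_split/= -mulr_sumr.
have -> : sq_dist y - d = \sum_(i < n) (y ord0 i - x ord0 i) ^+ 2.
  by rewrite /sq_dist addrC addKr.
by rewrite sumr_const card_ord -mulr_natr; ring.
Qed.
End radial.

(** * Iterated Laplacians of the regularised logarithm *)

Section bubble.
Context {R : realType} {m : nat}.
Local Notation V := 'rV[R]_(m.*2).
Variables (x : V) (d : R).
Hypothesis d0 : 0 < d.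
Local Notation s := (sq_dist x d).

Lemma sq_dist_gt0 y : 0 < s y.
Proof. by rewrite sq_dist_enorm ltr_wpDr// sqr_ge0. Qed.

Definition log_kernel (y : V) : R := - 2^-1 * ln (s y).

Lemma Ck_log_kernel k : Ck k setT log_kernel.
Proof.
have oT := @openT V.
by apply: CkZ => //; apply: Ck_ln => // [y _|]; [exact: sq_dist_gt0|exact: Ck_sq_dist].
Qed.

Lemma natr_double : (m.*2)%:R = 2 * m%:R :> R.
Proof. by rewrite -muln2 natrM mulrC. Qed.

Lemma laplacian_log_kernel y :
  - laplacian log_kernel y = 2 * (m%:R - 1) * s y ^- 1 + 2 * d * s y ^- 2.
Proof.
have oT := @openT V.
have hl : Ck 2 setT (fun y => ln (s y)).
  by apply: Ck_ln => // [z _|]; [exact: sq_dist_gt0|exact: Ck_sq_dist].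
rewrite (laplacianZ _ oT (I : setT y) hl).
have h1 z : setT z -> is_derive (s z) 1 (@ln R) ((fun t => t ^- 1) (s z)).
  by move=> _; rewrite expr1; apply: is_derive1_ln; exact: sq_dist_gt0.
have h2 z : setT z -> is_derive (s z) 1 (fun t : R => t ^- 1)
    ((fun t => - 1%:R * t ^- 2) (s z)).
  by move=> _; apply: is_derive_expV; rewrite gt_eqF// sq_dist_gt0.
rewrite (@laplacian_radial R _ x d (@ln R) (fun t => t ^- 1) (fun t => - 1%:R * t ^- 2)
  setT y oT I h1 h2) natr_double.
by have := lt0r_neq0 (sq_dist_gt0 y) => h; field; exact: h.
Qed.

(** Radial formula in dimension [2m], with [|x - y|^2] rewritten as [s - d]. One power of [s] thus
    produces two, the second with a factor [d]; the first coefficient vanishes for [k = m - 1]. *)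
Lemma laplacian_powV (k : nat) y :
  - laplacian (fun z => s z ^- k) y =
  4 * k%:R * (m%:R - 1 - k%:R) * s y ^- k.+1 + 4 * k%:R * (k%:R + 1) * d * s y ^- k.+2.
Proof.
have oT := @openT V.
have h1 z : setT z -> is_derive (s z) 1 (fun t : R => t ^- k)
    ((fun t => - k%:R * t ^- k.+1) (s z)).
  by move=> _; apply: is_derive_expV; rewrite gt_eqF// sq_dist_gt0.
have h2 z : setT z -> is_derive (s z) 1 (fun t : R => - k%:R * t ^- k.+1)
    ((fun t => - k%:R * (- k.+1%:R * t ^- k.+2)) (s z)).
  move=> _; have z0 : s z != 0 by rewrite gt_eqF// sq_dist_gt0.
  exact: (@is_deriveZ _ _ _ _ (- k%:R) _ _ _ (is_derive_expV k.+1 z0)).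
rewrite (@laplacian_radial R _ x d (fun t => t ^- k) (fun t => - k%:R * t ^- k.+1)
  (fun t => - k%:R * (- k.+1%:R * t ^- k.+2)) setT y oT I h1 h2) natr_double -natr1.
have -> : s y ^- k.+1 = s y * s y ^- k.+2.
  have := lt0r_neq0 (sq_dist_gt0 y) => h.
  by rewrite -!exprVn [in RHS]exprS mulrA divff// mul1r.
by set T := _ ^- k.+2; ring.
Qed.

(** The coefficient of [d^j s^-(k + j)] in the [k]-th iterate. It is the closed solution of the
    recursion imposed by [laplacian_powV]; the product of the [m - i] collects the factors that
    eventually cancel everything except [j = k = m]. *)
Definition bcoef (k j : nat) : R :=
  2^-1 * 4 ^+ k * 'C(k, j)%:R * ((k + j).-1)`!%:R * \prod_(j.+1 <= i < k.+1) (m%:R - i%:R).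

Lemma bcoefS0 k : (0 < k)%N -> bcoef k.+1 0 = 4 * k%:R * (m%:R - 1 - k%:R) * bcoef k 0.
Proof.
case: k => // k _; rewrite /bcoef !bin0 !addn0 big_nat_recr//= factS natrM exprS -!natr1; ring.
Qed.

(** Two terms feed the new coefficient: the one with index [j.+1], whose exponent rises by 1, and
    the one with index [j], which gains a factor [d]. After division by common factors this is
    Pascal's rule. *)
Lemma bcoefS k j : (0 < k)%N -> (j <= k)%N ->
  bcoef k.+1 j.+1 = 4 * (k + j.+1)%:R * (m%:R - 1 - (k + j.+1)%:R) * bcoef k j.+1
    + 4 * (k + j)%:R * ((k + j)%:R + 1) * bcoef k j.
Proof.
move=> k0; rewrite leq_eqVlt => /predU1P[->|jk].
  rewrite /bcoef !binn bin_small// mulr0 !mul0r mulr0 add0r !big_geq//.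
  rewrite addSn addnS /= factS.
  have -> : ((k + k)`! = (k + k) * (k + k).-1`!)%N.
    by case: k k0 => // k _; rewrite addSn factS.
  by rewrite !natrM exprS -natr1; ring.
rewrite /bcoef binS big_nat_recr/=; last by [].
rewrite [\prod_(j.+1 <= i < k.+1) _]big_ltn; last by rewrite ltnS.
set Q := \prod_(_ <= i < _) _.
rewrite ?addSn addnS /= factS.
have -> : ((k + j)`! = (k + j) * (k + j).-1`!)%N.
  by case: k k0 {jk Q} => // k _; rewrite addSn factS.
set F := (k + j).-1`!.
have e : j.+1%:R * 'C(k, j.+1)%:R = (k%:R - j%:R) * 'C(k, j)%:R :> R.
  by rewrite -natrM mul_bin_left natrM natrB// ltnW.
have e' : 'C(k, j.+1)%:R = (k%:R - j%:R) * 'C(k, j)%:R / j.+1%:R :> R.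
  by rewrite -e mulrC mulKf// pnatr_eq0.
rewrite !natrM natrD e' exprS -!natr1 !natrD.
field.
by rewrite natr1 pnatr_eq0.
Qed.

(** The range starts at [k = 1]: the first Laplacian turns the logarithm into powers of [s], and
    only from there on does [laplacian_powV] act. *)
Lemma polylap_log_kernel k y : (0 < k)%N ->
  polylap k log_kernel y = \sum_(j < k.+1) bcoef k j * d ^+ j * s y ^- (k + j).
Proof.
have oT := @openT V.
case: k => // k _; elim: k y => [|k IH] y.
  rewrite (_ : polylap 1 _ _ = - laplacian log_kernel y)// laplacian_log_kernel.
  rewrite !big_ord_recr big_ord0 /= add0r /bcoef big_nat1 big_geq//= bin0 binn expr0 expr1.
  rewrite /= addn0 addn1 /= fact0 (_ : 1`! = 1%N)// (_ : (1 + 1 = 2)%N)// !expr1.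
  by have := lt0r_neq0 (sq_dist_gt0 y) => h; field; exact: h.
rewrite polylapS (_ : polylap k.+1 log_kernel =
   fun y => \sum_(j < k.+2) bcoef k.+1 j * d ^+ j * s y ^- (k.+1 + j)); last exact/funext.
have hC j : Ck 2 setT (fun z => bcoef k.+1 j * d ^+ j * s z ^- (k.+1 + j)).
  apply: CkZ => //.
  have : Ck 2 setT (fun z => (s z)^-1 ^+ (k.+1 + j)).
    apply: CkX => //; apply: Ck_inv => // [z _|]; [exact: sq_dist_gt0|exact: Ck_sq_dist].
  by apply: Ck_ext => // z _; rewrite exprVn.
have hC' (j : nat) : Ck 2 setT (fun z => s z ^- (k.+1 + j)).
  have : Ck 2 setT (fun z => (s z)^-1 ^+ (k.+1 + j)).
    apply: CkX => //; apply: Ck_inv => // [z _|]; [exact: sq_dist_gt0|exact: Ck_sq_dist].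
  by apply: Ck_ext => // z _; rewrite exprVn.
rewrite (laplacian_sum (index_enum 'I_k.+2) oT (I : setT y)) => [|j]; last exact: hC.
rewrite -sumrN.
have tE (j : 'I_k.+2) : - laplacian (fun z => bcoef k.+1 j * d ^+ j * s z ^- (k.+1 + j)) y =
   4 * (k.+1 + j)%:R * (m%:R - 1 - (k.+1 + j)%:R) * bcoef k.+1 j * d ^+ j * s y ^- (k.+2 + j)
   + 4 * (k.+1 + j)%:R * ((k.+1 + j)%:R + 1) * bcoef k.+1 j * d ^+ j.+1 * s y ^- (k.+2 + j.+1).
  rewrite (laplacianZ _ oT (I : setT y) (hC' j)) -mulrN laplacian_powV.
  rewrite !addSn !addnS [d ^+ j.+1]exprS.
  by set T1 := _ ^- _; set T2 := _ ^- _; ring.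
rewrite (eq_bigr _ (fun j _ => tE j)) big_split/=.
rewrite [in RHS]big_ord_recl /= bcoefS0// expr0.
rewrite [X in X + _]big_ord_recl /= expr0 !addn0.
rewrite -addrA; congr (_ + _).
(* The sum is padded with a last term whose binomial coefficient is 0, so that both sums run over
   the same indices. *)
have -> : \sum_(i < k.+1) 4 * (k.+1 + bump 0 i)%:R * (m%:R - 1 - (k.+1 + bump 0 i)%:R) *
    bcoef k.+1 (bump 0 i) * d ^+ bump 0 i * s y ^- (k.+2 + bump 0 i) =
  \sum_(i < k.+2) 4 * (k.+1 + i.+1)%:R * (m%:R - 1 - (k.+1 + i.+1)%:R) *
    bcoef k.+1 i.+1 * d ^+ i.+1 * s y ^- (k.+2 + i.+1).
  rewrite [RHS]big_ord_recr /= /bcoef bin_small// !(mulr0, mul0r) addr0.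
  by apply: eq_bigr => i _; rewrite /bump /= add1n.
rewrite -big_split/=; apply: eq_bigr => i _; rewrite /bump /= add1n.
rewrite (bcoefS (k := k.+1))//.
  by set T := _ ^- _; ring.
by rewrite -ltnS.
Qed.

Definition bubble_coef : R := 2^-1 * 4 ^+ m * (m.*2.-1)`!%:R.

Lemma bubble_coef_gt0 : 0 < bubble_coef.
Proof. by rewrite !mulr_gt0// ?exprn_gt0// ?ltr0n ?fact_gt0. Qed.

(* All lower-order terms carry the vanishing factor m - m. *)
Lemma polylap_log_kernel_top y : (0 < m)%N ->
  polylap m log_kernel y = bubble_coef * d ^+ m * s y ^- m.*2.
Proof.
move=> m0; rewrite polylap_log_kernel// big_ord_recr/= big1 ?add0r.
  by rewrite /bcoef binn big_geq// !mulr1 addnn.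
move=> j _; rewrite /bcoef big_nat_recr/=; last by [].
by rewrite subrr !(mulr0, mul0r).
Qed.

End bubble.

(** * The bubble as an approximate identity *)

Section fundamental_solution.
Context {R : realType}.

Lemma rv_mu_set1_gt0 n (x : 'rV[R]_n) : (0 < n)%N -> (rv_mu n [set x] = 0)%E.
Proof. by case: n x => // n x _; exact: rv_mu_set1. Qed.

Lemma rintegrable_riesz n (s : R) : (0 < n)%N -> 0 < s < n%:R ->
  exists C : R, forall x : 'rV[R]_n,
    rintegrable (fun y => \1_(eball n 1) y * enorm (x - y) `^ (- s)) /\
    rint (fun y => \1_(eball n 1) y * enorm (x - y) `^ (- s)) <= C.
Proof.
case: n => // n _ hs; have [C hC] := integral_riesz_le hs.
exists C => x.
have f0 y : 0 <= \1_(@eball R n.+1 1) y * enorm (x - y) `^ (- s).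
  by rewrite mulr_ge0// powR_ge0.
split; last exact: rint_leC.
apply: (@rintegrable_leC _ _ _ C).
  apply: measurable_funM; last exact: measurable_riesz.
  by apply: measurable_indic; exact: measurable_eball.
by under eq_integral do rewrite ger0_norm//.
Qed.

Lemma rintegrable_indic_box n (a : 'rV[R]_n) (k : R) : 0 <= k ->
  rintegrable (\1_(rv_box a k) : 'rV[R]_n -> R) /\
  rint (\1_(rv_box a k) : 'rV[R]_n -> R) = (2 * k) ^+ n.
Proof.
move=> k0.
have e : (\int[rv_mu n]_y (\1_(rv_box a k) y)%:E = ((2 * k) ^+ n)%:E)%E.
  by rewrite integral_indic//; [rewrite setIT; exact: rv_mu_box|exact: measurable_rv_box].
have Ib : rintegrable (\1_(rv_box a k) : 'rV[R]_n -> R).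
  apply: (@rintegrable_leC _ _ _ ((2 * k) ^+ n)).
    by apply: measurable_indic; exact: measurable_rv_box.
  by under eq_integral do rewrite ger0_norm//; rewrite e.
by split => //; apply: EFin_inj; rewrite rintE.
Qed.

(** The profile obtained from [sq_dist x (t ^+ 2)] by the substitution [y = x + t z], with exponent
    equal to the dimension. *)
Definition bubble n (z : 'rV[R]_n) : R := (1 + enorm z ^+ 2) ^- n.

Lemma bubble_gt0 n (z : 'rV[R]_n) : 0 < bubble z.
Proof. by rewrite invr_gt0 exprn_gt0// ltr_wpDr// sqr_ge0. Qed.

Lemma measurable_bubble n : measurable_fun setT (@bubble n).
Proof.
apply: rv_continuous_measurable; first exact: openT.
have oT := @openT 'rV[R]_n.
have h : Ck 0 setT (fun z => (sq_dist (0 : 'rV[R]_n) 1 z)^-1 ^+ n).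
  apply: CkX => //; apply: Ck_inv => //; last exact: Ck_sq_dist.
  by move=> z _; rewrite sq_dist_enorm ltr_wpDr// sqr_ge0.
move: h => /(Ck_cont); apply: in_continuous_ext => // z _.
by rewrite /bubble sq_dist_enorm sub0r enormN exprVn.
Qed.

(** Each coordinate satisfies [1 + z_i^2 <= 1 + |z|^2], so the [n]-th power is dominated by a
    product of one-dimensional arctangent densities. *)
Lemma rintegrable_bubble n : rintegrable (@bubble n).
Proof.
apply: (@rintegrable_leC _ _ _ ((2 * (pi / 2)) ^+ n)); first exact: measurable_bubble.
apply: le_trans (@integral_prod_coord_le R n (fun=> fun t => (oneDsqr t)^-1) _ _ _ _); last 3 first.
- by move=> i; apply: continuous_measurable_fun => t; exact: continuous_oneDsqrV.
- by move=> i t; rewrite invr_ge0 (le_trans _ (oneDsqr_ge1 t)).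
- by move=> i; exact: integral_oneDsqrV_le.
apply: ge0_le_integral => //.
- by apply/measurable_EFinP; apply: measurableT_comp => //; exact: measurable_bubble.
- apply/measurable_EFinP; apply: (@measurable_prod_coord R n (fun=> fun t => (oneDsqr t)^-1)) => i.
  by apply: continuous_measurable_fun => t; exact: continuous_oneDsqrV.
move=> z _; rewrite lee_fin gtr0_norm ?bubble_gt0// /bubble -exprVn.
rewrite -[X in _ ^+ X]card_ord -prodr_const ler_prod// => i _.
rewrite invr_ge0 addr_ge0 ?sqr_ge0//= lef_pV2 ?posrE ?ltr_wpDr ?sqr_ge0//.
by rewrite lerD2l -[leLHS]real_normK ?num_real// ler_sqr ?nnegrE ?enorm_ge0// coord_le_enorm.
Qed.

Lemma rint_bubble_gt0 n : 0 < rint (@bubble n).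
Proof.
have [Ib eb] := @rintegrable_indic_box n 0 1 ler01.
pose c : R := (1 + (n%:R * 1) ^+ 2) ^- n.
have c0 : 0 < c by rewrite invr_gt0 exprn_gt0// ltr_wpDr// sqr_ge0.
apply: (@lt_le_trans _ _ (c * (2 * 1) ^+ n)); first by rewrite mulr_gt0// exprn_gt0// mulr1.
rewrite -eb -rintZ//; apply: rint_le; [exact: rintegrableZ|exact: rintegrable_bubble|].
move=> z; rewrite indicE; case: (boolP (z \in _)) => zb; last by rewrite mulr0 ltW// bubble_gt0.
rewrite mulr1 lef_pV2 ?posrE ?exprn_gt0 ?ltr_wpDr ?sqr_ge0//.
rewrite lerXn2r ?nnegrE ?addr_ge0 ?sqr_ge0// lerD2l ler_sqr ?nnegrE ?enorm_ge0 ?mulr_ge0//.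
by apply: enorm_le_coord => i; move: zb; rewrite inE => /(_ i); rewrite mxE subr0.
Qed.

(** The constant c0: the mass that (-Delta)^m of the logarithmic kernel places at its pole. The
    integral is left unevaluated; its positivity is what the estimates use. *)
Definition log_const m : R := @bubble_coef R m * rint (@bubble m.*2).

Lemma log_const_gt0 m : 0 < log_const m.
Proof. by rewrite mulr_gt0 ?rint_bubble_gt0// bubble_coef_gt0. Qed.

(** A majorant independent of [d]. It combines [- ln t <= 1 / t] for small distances with
    [ln (1 + t^2) <= t^2] for large ones. *)
Lemma log_kernel_bound m (x y : 'rV[R]_(m.*2)) (d : R) : 0 < d <= 1 -> y != x ->
  `|log_kernel x d y| <= enorm (x - y) `^ (- 1) + enorm (x - y) ^+ 2.
Proof.
move=> /andP[d0 d1] yx; rewrite /log_kernel sq_dist_enorm.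
have t0 : 0 < enorm (x - y) by rewrite enorm_gt0 subr_eq0 eq_sym.
set t := enorm _ in t0 *.
rewrite powR_inv1; last exact: ltW.
have s0 : 0 < d + t ^+ 2 by rewrite ltr_wpDr// sqr_ge0.
have l1 : ln (t ^+ 2) <= ln (d + t ^+ 2).
  by rewrite ler_ln ?posrE ?exprn_gt0// lerDr ltW.
have l2 : ln (d + t ^+ 2) <= t ^+ 2.
  apply: (@le_trans _ _ (ln (1 + t ^+ 2))).
    by rewrite ler_ln ?posrE// ?lerD2r// ltr_wpDr// sqr_ge0.
  by apply: le_ln1Dx; rewrite (lt_le_trans _ (sqr_ge0 _))// ltrN10.
have l3 : - ln t <= t^-1.
  by rewrite -lnV ?posrE// ltW// ln_sublinear// invr_gt0.
have e : ln (t ^+ 2) = 2 * ln t by rewrite lnXn// mulr2n mulrDl mul1r.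
have t1 : 0 <= t^-1 by rewrite invr_ge0 ltW.
have t2 : 0 <= t ^+ 2 by exact: sqr_ge0.
rewrite e in l1; rewrite ler_norml; apply/andP; split; lra.
Qed.

Lemma log_kernel_cvg m (x y : 'rV[R]_(m.*2)) : y != x ->
  log_kernel x (k.+1%:R^-1 ^+ 2) y @[k --> \oo] --> - ln (enorm (x - y)).
Proof.
move=> yx; have t0 : 0 < enorm (x - y) by rewrite enorm_gt0 subr_eq0 eq_sym.
have -> : - ln (enorm (x - y)) = - 2^-1 * ln (0 ^+ 2 + enorm (x - y) ^+ 2).
  by rewrite expr0n /= add0r lnXn// -mulr_natr; field.
under eq_cvg do rewrite /log_kernel sq_dist_enorm.
apply: cvgM; first exact: cvg_cst.
apply: continuous_cvg.
  by apply: continuous_ln; rewrite expr0n add0r exprn_gt0.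
apply: cvgD; last exact: cvg_cst.
exact: (cvg_comp _ (fun t : R => t ^+ 2) (@cvg_harmonic R) (@exprn_continuous R 2 0)).
Qed.

Lemma measurable_log_enorm n (x : 'rV[R]_n) :
  measurable_fun setT (fun y : 'rV[R]_n => - ln (enorm (x - y))).
Proof.
apply: measurableT_comp => //; apply: (measurableT_comp (@measurable_ln R)).
exact: measurable_enormB.
Qed.

(** All derivatives are moved onto the smooth kernel, then [y = x + t z]. The powers of [t] cancel:
    [t^2m] from [d ^+ m], [t^2m] from the Jacobian, [t^-4m] from the power of [s]. *)
Lemma rint_log_kernel m (x : 'rV[R]_(m.*2)) (t r : R) g : (0 < m)%N -> 0 < t ->
  Ck m.*2 setT g -> vanish r g ->
  rint (fun y => log_kernel x (t ^+ 2) y * polylap m g y) =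
  rint (fun z => @bubble_coef R m * bubble z * g (x + t *: z)).
Proof.
move=> m0 t0 hg vg; have d0 : 0 < t ^+ 2 by rewrite exprn_gt0.
rewrite -(rint_polylap (Ck_log_kernel x d0 _) hg vg).
have pE y : polylap m (log_kernel x (t ^+ 2)) y = @bubble_coef R m * (t ^+ 2) ^+ m *
    sq_dist x (t ^+ 2) y ^- m.*2 by exact: polylap_log_kernel_top.
rewrite (_ : (fun y => polylap m (log_kernel x (t ^+ 2)) y * g y) =
  fun y => @bubble_coef R m * (t ^+ 2) ^+ m * sq_dist x (t ^+ 2) y ^- m.*2 * g y); last first.
  by apply/funext => y; rewrite pE.
have oT := @openT 'rV[R]_(m.*2).
have Is : rintegrable (fun y => @bubble_coef R m * (t ^+ 2) ^+ m *
    sq_dist x (t ^+ 2) y ^- m.*2 * g y).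
  apply: (@rintegrable_Ck _ _ 0 r); last exact: vanishM.
  apply: CkM => //; last exact: (Ck_le _ hg).
  apply: CkZ => //.
  have h : Ck 0 setT (fun z => (sq_dist x (t ^+ 2) z)^-1 ^+ m.*2).
    apply: CkX => //; apply: Ck_inv => //; last exact: Ck_sq_dist.
    by move=> z _; exact: sq_dist_gt0.
  by move: h; apply: Ck_ext => // z _; rewrite exprVn.
rewrite (rint_affine x t0 Is) -rintZ; last exact: (rintegrable_affine x t0 Is).
congr rint; apply/funext => z.
have -> : sq_dist x (t ^+ 2) (x + t *: z) = t ^+ 2 * (1 + enorm z ^+ 2).
  rewrite sq_dist_enorm opprD addNKr enormN enormZ gtr0_norm//; ring.
rewrite /bubble; set S := 1 + enorm z ^+ 2.
have S0 : S != 0 by rewrite gt_eqF// ltr_wpDr// sqr_ge0.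
have -> : (t ^+ 2 * S) ^- m.*2 = (t ^+ m.*2)^-1 * (t ^+ m.*2)^-1 * S ^- m.*2.
  rewrite [(t ^+ 2 * S) ^+ _]exprMn invfM -exprM.
  by rewrite (_ : (2 * m.*2 = m.*2 + m.*2)%N) ?mul2n ?addnn// -addnn exprD invfM.
have -> : (t ^+ 2) ^+ m = t ^+ m.*2 by rewrite -exprM mul2n.
have tn : t ^+ m.*2 != 0 by rewrite expf_neq0// gt_eqF.
have Sn : S ^+ m.*2 != 0 by rewrite expf_neq0.
by field; rewrite Sn tn.
Qed.

(** The limit [t -> 0] of [rint_log_kernel], taken on both sides. The condition [r < 1] places the
    support in the unit ball, where the Riesz bounds are available. *)
Lemma fundamental_identity m (r : R) (g : 'rV[R]_(m.*2) -> R)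
    (x : 'rV[R]_(m.*2)) : (0 < m)%N -> r < 1 ->
  Ck m.*2 setT g -> vanish r g ->
  rintegrable (fun y => - ln (enorm (x - y)) * polylap m g y) /\
  log_const m * g x = rint (fun y => - ln (enorm (x - y)) * polylap m g y).
Proof.
move=> m0 r1 hg vg; have oT := @openT 'rV[R]_(m.*2).
have n0 : (0 < m.*2)%N by rewrite double_gt0.
have hG : Ck 0 setT (polylap m g) by apply: Ck_polylap; rewrite ?addn0.
have vG := vanish_polylap m vg.
have [A [A0 hA]] := vanish_bounded (Ck_cont hG) vG.
have [B [B0 hB]] := vanish_bounded (Ck_cont hg) vg.
pose t (k : nat) : R := k.+1%:R^-1.
have t0 k : 0 < t k by rewrite invr_gt0.
have t1 k : t k <= 1 by rewrite invf_le1// ler1n.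
(* The majorant of the kernel has a pole of order 1, integrable because the dimension [2m] is at
   least 2. *)
have s1 : (0 : R) < (1 : R) < (m.*2)%:R.
  apply/andP; split; first exact: ltr01.
  by rewrite (ltr_nat R 1); case: (m) m0 => // m' _; rewrite doubleS.
have [C /(_ x)[Ir _]] := rintegrable_riesz n0 s1.
pose D y := A * (\1_(eball m.*2 1) y * enorm (x - y) `^ (- 1)
   + (enorm x + 1) ^+ 2 * \1_(eball m.*2 1) y).
have ID : rintegrable D.
  apply: rintegrableZ; apply: rintegrableD => //; apply: rintegrableZ.
  exact: rintegrable_indic_eball.
have D0 y : 0 <= D y.
  by rewrite mulr_ge0 ?(ltW A0)// addr_ge0// mulr_ge0 ?powR_ge0 ?sqr_ge0.
have [||||Iln cv1] := @rint_cvg R _ (fun k y => log_kernel x (t k ^+ 2) y * polylap m g y)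
  (fun y => - ln (enorm (x - y)) * polylap m g y) D [set x] (rv_set1_measurable x)
  (rv_mu_set1_gt0 x n0) _ _ ID.
- move=> k; apply: measurable_funM; last exact: (Ck_measurable hG).
  by apply: (@Ck_measurable _ _ 0); apply: Ck_log_kernel; rewrite exprn_gt0.
- apply: measurable_funM; last exact: (Ck_measurable hG).
  exact: measurable_log_enorm.
- move=> k y /eqP yx; have [yr|yr] := leP (enorm y) r; last first.
    by rewrite vG// mulr0 normr0.
  rewrite normrM mulrC /D.
  have -> : \1_(eball m.*2 1) y = 1 :> R.
    by rewrite indicE mem_set//; exact: le_lt_trans r1.
  rewrite mul1r mulr1 ler_pM//.
  have dk : 0 < t k ^+ 2 <= 1 by rewrite exprn_gt0//= expr_le1// ltW.
  apply: (le_trans (log_kernel_bound dk yx)).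
  rewrite lerD2l ler_sqr ?nnegrE ?enorm_ge0 ?addr_ge0 ?enorm_ge0//.
  by rewrite (le_trans (ler_enormB _ _))// lerD2l ltW// (le_lt_trans yr).
- move=> y /eqP yx; apply: cvgM; last exact: cvg_cst.
  exact: log_kernel_cvg.
split => //.
have bc0 : 0 < @bubble_coef R m := @bubble_coef_gt0 R m.
(* The approximate identity: a bound for [g] times the bubble dominates, and continuity of [g] at
   [x] gives the limit. *)
have [||||_ cv2] := @rint_cvg R _ (fun k z => @bubble_coef R m * bubble z * g (x + t k *: z))
  (fun z => @bubble_coef R m * g x * bubble z) (fun z => @bubble_coef R m * B * bubble z)
  set0 measurable0 (measure0 _) _ _ (rintegrableZ _ (@rintegrable_bubble m.*2)).
- move=> k; apply: measurable_funM.
    by apply: measurable_funM => //; exact: measurable_bubble.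
  by apply: (measurableT_comp (Ck_measurable hg)); exact: measurable_affine.
- by apply: measurable_funM => //; exact: measurable_bubble.
- move=> k z _; rewrite normrM [`|_ * bubble z|]gtr0_norm; last by rewrite mulr_gt0// bubble_gt0.
  by rewrite [leRHS]mulrAC ler_pM2l// mulr_gt0// bubble_gt0.
- move=> z _; rewrite -mulrA [g x * _]mulrC mulrA; apply: cvgM; first exact: cvg_cst.
  have cg : {for x, continuous g} by apply: (Ck_cont hg); rewrite inE.
  apply: (continuous_cvg _ cg).
  have ct : (fun k => x + t k *: z) @ \oo --> x + 0 *: z.
    apply: cvgD; first exact: cvg_cst.
    by apply: cvgZr_tmp; exact: cvg_harmonic.
  by move: ct; rewrite scale0r addr0.
have e : (fun k => rint (fun y => log_kernel x (t k ^+ 2) y * polylap m g y)) =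
         (fun k => rint (fun z => @bubble_coef R m * bubble z * g (x + t k *: z))).
  by apply/funext => k; exact: (rint_log_kernel x m0 (t0 k) hg vg).
move: cv1; rewrite e => cv1.
rewrite -(cvg_lim (@Rhausdorff R) cv1) (cvg_lim (@Rhausdorff R) cv2).
rewrite rintZ; last exact: rintegrable_bubble.
by rewrite /log_const; ring.
Qed.

Lemma polylap0 n m : polylap m (fun=> 0) = (fun=> 0) :> ('rV[R]_n -> R).
Proof.
elim: m => [//|m IH]; rewrite polylapS IH; apply/funext => y.
by rewrite laplacian_cst oppr0.
Qed.

Lemma Ck_affine n k (U : set 'rV[R]_n) (a : R) (b : 'rV[R]_n) : open U ->
  Ck k U (fun y => a + dotp b y).
Proof.
move=> oU; apply: CkD => //; first exact: Ck_cst.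
by apply: Ck_sum => // i; apply: CkZ => //; exact: Ck_coord.
Qed.

Lemma partial_affine n (a : R) (b : 'rV[R]_n) i y :
  partial i (fun y => a + dotp b y) y = b ord0 i.
Proof.
have oT := @openT 'rV[R]_n.
have hd j : derivable (fun y : 'rV[R]_n => b ord0 j * y ord0 j) y (evec R i).
  by apply: (@CkT_derivable _ _ 0); apply: CkZ => //; exact: Ck_coord.
rewrite (partialD (f := fun=> a) (g := dotp b)); last 2 first.
- exact: derivable_cst.
- by apply: (@CkT_derivable _ _ 0); apply: Ck_sum => // j; apply: CkZ => //; exact: Ck_coord.
rewrite partial_cst add0r.
have -> : partial i (dotp b) y = \sum_(j < n) partial i (fun y : 'rV[R]_n => b ord0 j * y ord0 j) y.
  rewrite /partial -derive_sum//.
  by congr ('D_ _ _ _); apply/funext => z; rewrite fct_sumE.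
have hc j : derivable (fun y : 'rV[R]_n => y ord0 j) y (evec R i).
  by have [] := is_derive_coord i j y.
rewrite (bigD1 i)//= big1 ?addr0 => [|j ji].
  by rewrite (partialZ _ (hc i)) partial_coord eqxx mulr1.
by rewrite (partialZ _ (hc j)) partial_coord eq_sym (negbTE ji) mulr0.
Qed.

Lemma laplacian_affine n (a : R) (b : 'rV[R]_n) y : laplacian (fun y => a + dotp b y) y = 0.
Proof.
rewrite /laplacian big1// => i _.
rewrite (_ : partial i (fun y => a + dotp b y) = fun=> b ord0 i) ?partial_cst//.
by apply/funext => z; exact: partial_affine.
Qed.

(** One Laplacian already annihilates an affine function. This is what permits replacing the
    logarithm by its Taylor remainder at 0. *)
Lemma rint_affine_polylap n m (r a : R) (b : 'rV[R]_n) g : (0 < m)%N ->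
  Ck m.*2 setT g -> vanish r g -> rint (fun y => (a + dotp b y) * polylap m g y) = 0.
Proof.
case: m => // m _ hg vg.
rewrite -(rint_polylap (Ck_affine _ a b (@openT _)) hg vg).
rewrite (_ : (fun y => _) = fun=> 0) ?rint0//; apply/funext => y.
rewrite (_ : polylap m.+1 _ = polylap m (fun y => - laplacian (fun y => a + dotp b y) y)); last first.
  by rewrite /polylap iterSr.
rewrite (_ : (fun y => - laplacian _ y) = fun=> 0); last first.
  by apply/funext => z; rewrite laplacian_affine oppr0.
by rewrite polylap0 mul0r.
Qed.

End fundamental_solution.

(** * Representation formula *)

Section dbound.
Context {R : realType} {n : nat}.
Local Notation V := 'rV[R]_n.
Implicit Types (U S : set V) (f g : V -> R) (x y : V).

(* Each derivative costs a factor [1 / s]. *)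
Fixpoint dbound (k : nat) (U : set V) (s A : R) (f : V -> R) : Prop :=
  (forall x, U x -> `|f x| <= A) /\
  (if k is k'.+1 then forall i : 'I_n, dbound k' U s (A / s) (partial i f) else True).

Lemma dbound_fun k U s A f x : dbound k U s A f -> U x -> `|f x| <= A.
Proof. by case: k => [|k] [h _]; exact: h. Qed.

Lemma dbound_partial k U s A f i : dbound k.+1 U s A f -> dbound k U s (A / s) (partial i f).
Proof. by move=> [_]; exact. Qed.

Lemma dbound_ext k U s A f g : open U -> {in U, f =1 g} ->
  dbound k U s A f -> dbound k U s A g.
Proof.
move=> oU; elim: k A f g => [|k IH] A f g fg [h hp]; split.
- by move=> x Ux; rewrite -fg ?inE//; exact: h.
- by [].
- by move=> x Ux; rewrite -fg ?inE//; exact: h.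
- move=> i; apply: IH (hp i) => x; rewrite inE => Ux; exact: (partial_ext i oU Ux fg).
Qed.

Lemma dbound_sub k U S s A f : S `<=` U -> dbound k U s A f -> dbound k S s A f.
Proof.
move=> SU; elim: k A f => [|k IH] A f [h hp]; split => //.
- by move=> x /SU; exact: h.
- by move=> x /SU; exact: h.
- by move=> i; apply: IH; exact: hp.
Qed.

Lemma dbound_le k U s A B f : 0 < s -> A <= B -> dbound k U s A f -> dbound k U s B f.
Proof.
move=> s0; elim: k A B f => [|k IH] A B f AB [h hp]; split => //.
- by move=> x Ux; rewrite (le_trans (h x Ux)).
- by move=> x Ux; rewrite (le_trans (h x Ux)).
- by move=> i; apply: IH (hp i); rewrite ler_pM2r// invr_gt0.
Qed.

Lemma dbound_scale_le k U s s' A f : 0 < s <= s' -> 0 <= A ->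
  dbound k U s' A f -> dbound k U s A f.
Proof.
move=> /andP[s0 ss]; have s0' : 0 < s' by exact: lt_le_trans ss.
elim: k A f => [|k IH] A f A0 [h hp]; split => //.
move=> i; apply: (dbound_le (A := A / s')) => //.
  by rewrite ler_wpM2l// lef_pV2.
by apply: IH (hp i); rewrite divr_ge0// ltW.
Qed.

Lemma dboundS k U s A f : dbound k.+1 U s A f -> dbound k U s A f.
Proof.
elim: k A f => [|k IH] A f [h hp]; split => //.
by move=> i; apply: IH; exact: hp.
Qed.

Lemma dboundD k U s A B f g : open U -> Ck k U f -> Ck k U g ->
  dbound k U s A f -> dbound k U s B g -> dbound k U s (A + B) (fun y => f y + g y).
Proof.
move=> oU; elim: k A B f g => [|k IH] A B f g hf hg df dg; split => //.
- by move=> x Ux; rewrite (le_trans (ler_normD _ _))// lerD// ?(dbound_fun df)// (dbound_fun dg).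
- by move=> x Ux; rewrite (le_trans (ler_normD _ _))// lerD// ?(dbound_fun df)// (dbound_fun dg).
move=> i; rewrite mulrDl.
apply: (dbound_ext oU) (IH _ _ _ _ (Ck_partial i hf) (Ck_partial i hg)
  (dbound_partial i df) (dbound_partial i dg)) => x.
rewrite inE => Ux; apply/esym; exact: (partialD (Ck_derivable i Ux hf) (Ck_derivable i Ux hg)).
Qed.

(** Every application of the Leibniz rule doubles the number of terms, hence the factor [2 ^+ k];
    the scale [s] is shared by both factors. *)
Lemma dboundM k U s A B f g : open U -> 0 < s -> 0 <= A -> 0 <= B ->
  Ck k U f -> Ck k U g -> dbound k U s A f -> dbound k U s B g ->
  dbound k U s (2 ^+ k * A * B) (fun y => f y * g y).
Proof.
move=> oU s0; elim: k A B f g => [|k IH] A B f g A0 B0 hf hg df dg; split => //.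
- move=> x Ux; rewrite expr0 mul1r normrM ler_pM//; [exact: (dbound_fun df)|exact: (dbound_fun dg)].
- move=> x Ux; rewrite normrM -mulrA -[leLHS]mul1r ler_pM ?mulr_ge0//.
    by rewrite exprn_ege1// ler1n.
  by rewrite ler_pM//; [exact: (dbound_fun df)|exact: (dbound_fun dg)].
move=> i.
have As : 0 <= A / s by rewrite divr_ge0// ltW.
have Bs : 0 <= B / s by rewrite divr_ge0// ltW.
have -> : 2 ^+ k.+1 * A * B / s = 2 ^+ k * (A / s) * B + 2 ^+ k * A * (B / s).
  by rewrite exprS; ring.
have c1 := Ck_partial i hf; have c2 := Ck_partial i hg.
apply: (dbound_ext oU) (dboundD oU (CkM oU c1 (CkS hg)) (CkM oU (CkS hf) c2)
  (IH _ _ _ _ As B0 c1 (CkS hg) (dbound_partial i df) (dboundS dg))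
  (IH _ _ _ _ A0 Bs (CkS hf) c2 (dboundS df) (dbound_partial i dg))) => x.
rewrite inE => Ux; apply/esym; exact: (partialM (Ck_derivable i Ux hf) (Ck_derivable i Ux hg)).
Qed.

Lemma dboundN k U s A f : open U -> Ck k U f ->
  dbound k U s A f -> dbound k U s A (fun y => - f y).
Proof.
move=> oU; elim: k A f => [|k IH] A f hf df; split => //.
- by move=> x Ux; rewrite normrN (dbound_fun df).
- by move=> x Ux; rewrite normrN (dbound_fun df).
move=> i; apply: (dbound_ext oU) (IH _ _ (Ck_partial i hf) (dbound_partial i df)) => x.
rewrite inE => Ux; rewrite -mulN1r -(partialZ (-1) (Ck_derivable i Ux hf)).
by apply: (partial_ext i oU Ux) => y _; rewrite mulN1r.
Qed.

Lemma dbound_cst0 k U s A : 0 < s -> 0 <= A -> dbound k U s A (fun=> 0).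
Proof.
move=> s0; elim: k A => [|k IH] A A0; split => //.
- by move=> x _; rewrite normr0.
- by move=> x _; rewrite normr0.
move=> i; rewrite (_ : partial i _ = fun=> 0); first by apply: IH; rewrite divr_ge0// ltW.
by apply/funext => x; exact: partial_cst.
Qed.

Lemma dbound_sum k U s A (I : Type) (r : seq I) (F : I -> V -> R) : open U -> 0 < s ->
  (forall i, Ck k U (F i)) -> (forall i, dbound k U s A (F i)) ->
  dbound k U s ((size r)%:R * A) (fun y => \sum_(i <- r) F i y).
Proof.
move=> oU s0 hF dF; elim: r => [|i r IH].
  apply: (dbound_ext oU) (dbound_cst0 k U s0 _) => [x _|]; first by rewrite big_nil.
  by rewrite mul0r.
rewrite /= -natr1 mulrDl mul1r addrC.
by apply: (dbound_ext oU) (dboundD oU (hF i) (Ck_sum r oU hF) (dF i) IH) => x _; rewrite big_cons.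
Qed.

Lemma dbound_laplacian k U s A f : open U -> 0 < s -> Ck k.+2 U f ->
  dbound k.+2 U s A f -> dbound k U s (n%:R * (A / s / s)) (laplacian f).
Proof.
move=> oU s0 hf df.
have := @dbound_sum k U s (A / s / s) _ (index_enum 'I_n) (fun i => partial i (partial i f)) oU s0
  (fun i => Ck_partial i (Ck_partial i hf)) (fun i => dbound_partial i (dbound_partial i df)).
by rewrite -sum1_size sum1_card card_ord.
Qed.

Lemma dbound_polylap m k U s A f : open U -> 0 < s -> Ck (m.*2 + k) U f ->
  dbound (m.*2 + k) U s A f -> dbound k U s (n%:R ^+ m * A * s ^- m.*2) (polylap m f).
Proof.
move=> oU s0; elim: m k f => [|m IH] k f hf df.
  by rewrite expr0 mul1r invr1 mulr1.
have e : (m.+1.*2 + k = m.*2 + k.+2)%N by rewrite doubleS !addSn !addnS.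
rewrite e in hf df; rewrite polylapS.
have hm := Ck_polylap oU hf.
have := dbound_laplacian oU s0 hm (IH _ _ hf df).
move=> /(dboundN oU (Ck_laplacian oU hm)).
congr dbound; rewrite doubleS -!exprVn !exprS; ring.
Qed.

Lemma dbound_compact k U S f : compact S -> S `<=` U -> Ck k U f ->
  exists A : R, 0 < A /\ dbound k S 1 A f.
Proof.
move=> cS SU; elim: k f => [|k IH] f hf.
  have [A [A0 hA]] := compact_bounded_fun cS SU hf.
  by exists A.
have [A [A0 hA]] := compact_bounded_fun cS SU (Ck_cont hf).
have /choice[B hB] i := IH _ (Ck_partial i hf).
exists (A + \sum_(i < n) B i).
have B0 i : 0 <= B i by have [/ltW] := hB i.
have sB : 0 <= \sum_(i < n) B i by apply: sumr_ge0.
split; first by rewrite ltr_wpDr.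
split => [x Sx|i]; first by rewrite (le_trans (hA x Sx))// lerDl.
rewrite divr1; apply: (dbound_le _ _ (hB i).2) => //.
by rewrite (bigD1 i)//= addrA addrAC lerDr addr_ge0 ?(ltW A0)// sumr_ge0.
Qed.

Lemma is_derive_scale f (c : R) i y : derivable f (c *: y) (evec R i) ->
  is_derive y (evec R i) (fun z => f (c *: z)) (c * partial i f (c *: y)).
Proof.
move=> df; apply: is_derive_line0.
have h : is_derive (c *: y + (c * 0) *: evec R i) (evec R i) f (partial i f (c *: y)).
  by rewrite mulr0 scale0r addr0; exact: derivableP.
have := @is_derive1_comp R (fun h : R => f (c *: y + h *: evec R i)) (fun h : R => c * h) 0 _ c
   (is_derive_line h).
rewrite mulrC => hh.
have e : (fun h : R => f (c *: (y + h *: evec R i))) =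
   (fun h : R => f (c *: y + h *: evec R i)) \o (fun h : R => c * h).
  by apply/funext => t /=; rewrite scalerDr scalerA.
rewrite e; apply: hh.
have := @is_deriveM _ _ (cst c) id (0 : R) 1 0 1 (is_derive_cst _ _ _) (is_derive_id _ _).
by rewrite scaler0 addr0 [_ *: 1]mulr1.
Qed.

Lemma CkT_scale k f (c : R) : Ck k setT f -> Ck k setT (fun y => f (c *: y)).
Proof.
have cs (y : V) : {for y, continuous (fun z : V => c *: z)} by exact: scaler_continuous.
elim: k f => [|k IH] f hf.
  move=> y _; apply: (@continuous_comp _ _ _ (fun z : V => c *: z) f) => //.
  by apply: hf; rewrite inE.
have hd i y := is_derive_scale (CkT_derivable i (c *: y) hf).
split.
  move=> y _; apply: (@continuous_comp _ _ _ (fun z : V => c *: z) f) => //.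
  by apply: (Ck_cont hf); rewrite inE.
split => [i y _|i]; first by have [] := hd i y.
have oT := @openT V.
apply: (Ck_ext oT) (CkZ c oT (IH _ (Ck_partial i hf))) => y _.
by have [_] := hd i y; rewrite /partial => ->.
Qed.

(** Rescaling by [e] turns unit-scale bounds into bounds at scale [e] with the same constant. Hence
    all rescaled cutoffs share one constant. *)
Lemma dboundT_scale k f (e A : R) : 0 < e -> Ck k setT f ->
  dbound k setT 1 A f -> dbound k setT e A (fun y => f (e^-1 *: y)).
Proof.
move=> e0; elim: k A f => [|k IH] A f hf df; split => //.
- by move=> y _; exact: (dbound_fun df).
- by move=> y _; exact: (dbound_fun df).
move=> i; have oT := @openT V.
have h1 := IH _ _ (Ck_partial i hf) (dbound_partial i df); rewrite divr1 in h1.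
have hZ (j : nat) B (g : V -> R) : Ck j setT g -> dbound j setT e B g ->
    dbound j setT e (B / e) (fun y => e^-1 * g y).
  elim: j B g => [|j IHj] B g hg dg; split => //.
  - by move=> y _; rewrite normrM gtr0_norm ?invr_gt0// mulrC ler_pM2r ?invr_gt0// (dbound_fun dg).
  - by move=> y _; rewrite normrM gtr0_norm ?invr_gt0// mulrC ler_pM2r ?invr_gt0// (dbound_fun dg).
  move=> l; apply: (dbound_ext oT) (IHj _ _ (Ck_partial l hg) (dbound_partial l dg)) => y _.
  by rewrite (partialZ _ (CkT_derivable l y hg)).
apply: (dbound_ext oT) (hZ _ _ _ (CkT_scale _ (Ck_partial i hf)) h1) => y _.
by have [_] := is_derive_scale (CkT_derivable i (e^-1 *: y) hf); rewrite /partial => ->.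
Qed.

End dbound.

(** * Cutoff functions *)

Section cutoff.
Context {R : realType} {n : nat}.
Local Notation V := 'rV[R]_n.

(** The inner truncated power is 0 for [|y| <= 1] and at least 1 for [|y| >= 3/2], since
    [9/4 - 1 >= 1]; the outer one turns this into 1 and 0. The exponent [N.+1] makes the result of
    class C^N. *)
Definition cutoff (N : nat) (y : V) : R :=
  pos_pow N.+1 (1 - pos_pow N.+1 (sq_dist 0 (-1) y)).

Lemma Ck_cutoff N : Ck N setT (cutoff N).
Proof.
have oT := @openT V.
apply: Ck_pos_pow => //; apply: CkB => //; first exact: Ck_cst.
by apply: Ck_pos_pow => //; exact: Ck_sq_dist.
Qed.

Lemma cutoff1 N y : enorm y <= 1 -> cutoff N y = 1.
Proof.
move=> y1; rewrite /cutoff [pos_pow _ (sq_dist _ _ _)]pos_pow_le0//.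
  by rewrite subr0 pos_pow_ge0// expr1n.
by rewrite sq_dist_enorm sub0r enormN addrC subr_le0 expr_le1// enorm_ge0.
Qed.

Lemma cutoff0 N y : 3 / 2 <= enorm y -> cutoff N y = 0.
Proof.
move=> y1; rewrite /cutoff pos_pow_le0// subr_le0.
have h : 1 <= sq_dist 0 (-1) y.
  rewrite sq_dist_enorm sub0r enormN; nra.
by rewrite pos_pow_ge0 ?exprn_ege1// (le_trans _ h).
Qed.

Lemma cutoff_ge0 N y : 0 <= cutoff N y.
Proof. by rewrite /cutoff /pos_pow exprn_ge0// le_max lexx orbT. Qed.

Lemma cutoff_le1 N y : cutoff N y <= 1.
Proof.
rewrite /cutoff {1}/pos_pow exprn_ile1 ?le_max ?lexx ?orbT//.
rewrite ge_max ler01 andbT gerBl.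
by rewrite /pos_pow exprn_ge0// le_max lexx orbT.
Qed.

(** Compactness bounds the derivatives on the ball of radius 2 only; beyond radius 3/2 the function
    vanishes together with its derivatives. *)
Lemma dbound_cutoff N : exists A : R, 0 < A /\ dbound N setT 1 A (cutoff N).
Proof.
have [A [A0 dA]] := dbound_compact (@compact_ceball R n 2) (@subsetT _ _) (Ck_cutoff N).
exists A; split => //.
have key k f B : 0 <= B -> vanish (3 / 2) f -> dbound k [set x : V | enorm x <= 2] 1 B f ->
    dbound k setT 1 B f.
  elim: k f B => [|k IH] f B B0 vf [h hp]; split => //.
  - move=> x _; have [x2|x2] := leP (enorm x) 2; first exact: h.
    by rewrite vf ?normr0//; lra.
  - move=> x _; have [x2|x2] := leP (enorm x) 2; first exact: h.
    by rewrite vf ?normr0//; lra.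
  move=> i; apply: IH => //; [by rewrite divr1|exact: vanish_partial|exact: hp].
apply: key => //; first exact: ltW.
by move=> x /ltW; exact: cutoff0.
Qed.

End cutoff.

(** * Taylor remainder of the logarithmic kernel *)

Section taylor.
Context {R : realType} {m : nat}.
Local Notation V := 'rV[R]_(m.*2).
Implicit Types x y : V.

Lemma log_kernel0E x y : log_kernel x 0 y = - ln (enorm (x - y)).
Proof.
rewrite /log_kernel sq_dist_enorm add0r.
(* At the pole both sides are 0 by the convention [ln 0 = 0]. *)
have [->|t0] := eqVneq (enorm (x - y)) 0; first by rewrite expr0n /= ln0// mulr0 oppr0.
have {}t0 : 0 < enorm (x - y) by rewrite lt0r t0 enorm_ge0.
by rewrite lnXn// -mulr_natr; field.
Qed.

Lemma Ck_log_kernel0 k (U : set V) x : open U -> (forall y, U y -> y != x) ->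
  Ck k U (log_kernel x 0).
Proof.
move=> oU hU; apply: CkZ => //; apply: Ck_ln => //; last exact: Ck_sq_dist.
move=> y /hU yx; rewrite sq_dist_enorm add0r exprn_gt0// enorm_gt0 subr_eq0.
by rewrite eq_sym.
Qed.

Lemma partial_log_kernel0 x y i : y != x ->
  partial i (log_kernel x 0) y = (x ord0 i - y ord0 i) / enorm (x - y) ^+ 2.
Proof.
move=> yx.
have t0 : 0 < enorm (x - y) by rewrite enorm_gt0 subr_eq0 eq_sym.
have s0 : 0 < sq_dist x 0 y by rewrite sq_dist_enorm add0r exprn_gt0.
have [dl pl] := is_derive_comp1 (is_derive1_ln s0) (is_derive_sq_dist x 0 i y).
rewrite (partialZ _ dl) /partial pl sq_dist_enorm add0r; field.
by rewrite gt_eqF.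
Qed.

(** The remainder of [- ln |x - y|] after its first-order expansion [- ln |x| + x.y / |x|^2] at
    [y = 0]. The affine part is kept in the shape treated by [rint_affine_polylap]. *)
Definition log_taylor x y : R :=
  log_kernel x 0 y + (ln (enorm x) + dotp (- (enorm x ^- 2) *: x) y).

Lemma dotpZl (a : R) x y : dotp (a *: x) y = a * dotp x y.
Proof. by rewrite /dotp mulr_sumr; apply: eq_bigr => i _; rewrite mxE mulrA. Qed.

Lemma ln1D_bound (u : R) : `|u| <= 1 / 2 -> `|ln (1 + u) - u| <= 2 * u ^+ 2.
Proof.
move=> hu; have /andP[u1 u2] : - (1 / 2) <= u <= 1 / 2 by rewrite -ler_norml.
have p : 0 < 1 + u by lra.
have h1 : ln (1 + u) <= u by apply: le_ln1Dx; lra.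
have h2 : - ln (1 + u) <= (1 + u)^-1 - 1.
  rewrite -lnV ?posrE//.
  have := @le_ln1Dx R ((1 + u)^-1 - 1).
  rewrite addrCA subrr addr0; apply.
  have : 0 < (1 + u)^-1 by rewrite invr_gt0.
  lra.
have e : (1 + u)^-1 - 1 = - u + u ^+ 2 / (1 + u) by field; rewrite gt_eqF.
have h3 : u ^+ 2 / (1 + u) <= 2 * u ^+ 2.
  by rewrite ler_pdivrMr//; have := sqr_ge0 u; nra.
have h4 := sqr_ge0 u.
by rewrite ler_norml; apply/andP; split; lra.
Qed.

(** With [1 + u = |x - y|^2 / |x|^2], the remainder is [-(ln (1 + u) - u) / 2 - |y|^2 / (2 |x|^2)].
    As [|u| <= 3 |y| / |x|], the two terms contribute at most 9 and 1/2 times [|y|^2 / |x|^2]. *)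
Lemma log_taylor_bound x y : 0 < enorm x -> enorm y <= enorm x / 8 ->
  `|log_taylor x y| <= 10 * (enorm y ^+ 2 / enorm x ^+ 2).
Proof.
move=> x0 yx.
have y0 := enorm_ge0 y.
have xy : 0 < enorm (x - y).
  have := ler_enormBB x y; lra.
set a := enorm x in x0 yx *; set b := enorm y in yx y0 *.
pose u := (b ^+ 2 - 2 * dotp x y) / a ^+ 2.
have hd : `|dotp x y| <= a * b by exact: normr_dotp_le.
have /andP[d1 d2] : - (a * b) <= dotp x y <= a * b by rewrite -ler_norml.
have a2 : 0 < a ^+ 2 by rewrite exprn_gt0.
have ub : `|u| <= 3 * (b / a).
  rewrite /u normrM [`|(a ^+ 2)^-1|]gtr0_norm ?invr_gt0// ler_pdivrMr//.
  rewrite (_ : 3 * (b / a) * a ^+ 2 = 3 * (a * b)); last by field; rewrite gt_eqF.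
  by rewrite ler_norml; apply/andP; split; nra.
have ba : b / a <= 1 / 8 by rewrite ler_pdivrMr//; lra.
have ba0 : 0 <= b / a by rewrite divr_ge0// ltW.
have u2 : `|u| <= 1 / 2 by lra.
have lE : ln (enorm (x - y)) - ln a = 2^-1 * ln (1 + u).
  have -> : 1 + u = (enorm (x - y) / a) ^+ 2.
    rewrite exprMn exprVn sqr_enormB -/a -/b /u; field; rewrite gt_eqF//.
  by rewrite lnXn ?divr_gt0// ln_div ?posrE// -mulr_natr; field.
have tE : log_taylor x y = - (2^-1) * (ln (1 + u) - u) - 2^-1 * (b ^+ 2 / a ^+ 2).
  have -> : ln (1 + u) = 2 * (ln (enorm (x - y)) - ln a) by rewrite lE; field.
  by rewrite /log_taylor log_kernel0E -/a dotpZl /u; field; rewrite gt_eqF.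
have lb := ln1D_bound u2.
have usq : u ^+ 2 <= 9 * (b ^+ 2 / a ^+ 2).
  have -> : 9 * (b ^+ 2 / a ^+ 2) = (3 * (b / a)) ^+ 2 by field; rewrite gt_eqF.
  by rewrite -[leLHS]real_normK ?num_real// ler_sqr ?nnegrE// mulr_ge0.
have q0 : 0 <= b ^+ 2 / a ^+ 2 by rewrite divr_ge0// sqr_ge0.
move: lb; rewrite tE ler_norml => /andP[l1 l2].
by rewrite ler_norml; apply/andP; split; lra.
Qed.

Lemma partial_log_taylor x y i : y != x ->
  partial i (log_taylor x) y = (x ord0 i - y ord0 i) / enorm (x - y) ^+ 2 - x ord0 i / enorm x ^+ 2.
Proof.
move=> yx.
have oU : open [set y | 0 < enorm (y - x)].
  rewrite (_ : [set _ | _] = (fun y : V => enorm (y - x)) @^-1` `]0, +oo[%classic).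
    apply: open_comp; last exact: interval_open.
    move=> z _; apply: (@continuous_comp _ _ _ (fun y : V => y - x) (@enorm R _)).
      by apply: (@continuousB _ _ _ id (cst x)); [exact: cvg_id|exact: cst_continuous].
    exact: continuous_enorm.
  by apply/seteqP; split => z /=; rewrite in_itv/= andbT.
have Uy : [set y | 0 < enorm (y - x)] y by rewrite /= enorm_gt0 subr_eq0.
have hL : Ck 1 [set y | 0 < enorm (y - x)] (log_kernel x 0).
  by apply: Ck_log_kernel0 => // z; rewrite /= enorm_gt0 subr_eq0.
have hA : Ck 1 setT (fun y => ln (enorm x) + dotp (- (enorm x ^- 2) *: x) y).
  by apply: Ck_affine; exact: openT.
rewrite (partialD (Ck_derivable i Uy hL) (CkT_derivable i y hA)).
rewrite partial_log_kernel0// partial_affine mxE mulNr; congr (_ - _).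
by rewrite mulrC.
Qed.

(** Over the common denominator the numerator is at most [4 |x|^2 |y|], by cancellation of the terms
    of order zero in [y]; [|x - y| >= |x| / 2] supplies the other factor 4. *)
Lemma partial_log_taylor_bound x y i : 0 < enorm x -> enorm y <= enorm x / 2 ->
  `|partial i (log_taylor x) y| <= 16 * (enorm y / enorm x ^+ 2).
Proof.
move=> x0 yx.
have y0 := enorm_ge0 y.
have xy : enorm x / 2 <= enorm (x - y).
  have := ler_enormBB x y; lra.
have yx' : y != x.
  apply/eqP => e; move: yx; rewrite e; lra.
rewrite partial_log_taylor//.
set a := enorm x in x0 yx xy *; set b := enorm y in yx y0 *.
have c0 : 0 < enorm (x - y) by lra.
have cE := sqr_enormB x y; rewrite -/a -/b in cE.
have hd : `|dotp x y| <= a * b by exact: normr_dotp_le.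
have /andP[d1 d2] : - (a * b) <= dotp x y <= a * b by rewrite -ler_norml.
have xi : `|x ord0 i| <= a by exact: coord_le_enorm.
have yi : `|y ord0 i| <= b by exact: coord_le_enorm.
set c := enorm (x - y) in xy c0 cE *.
have a2 : 0 < a ^+ 2 by rewrite exprn_gt0.
have c2 : 0 < c ^+ 2 by rewrite exprn_gt0.
have -> : (x ord0 i - y ord0 i) / c ^+ 2 - x ord0 i / a ^+ 2 =
   (x ord0 i * (2 * dotp x y - b ^+ 2) - y ord0 i * a ^+ 2) / (c ^+ 2 * a ^+ 2).
  have -> : 2 * dotp x y - b ^+ 2 = a ^+ 2 - c ^+ 2 by rewrite cE; ring.
  by field; rewrite !gt_eqF.
rewrite normrM [`|(_ * _)^-1|]gtr0_norm ?invr_gt0 ?mulr_gt0// ler_pdivrMr ?mulr_gt0//.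
have e1 : `|2 * dotp x y - b ^+ 2| <= 3 * (a * b).
  by rewrite ler_norml; apply/andP; split; nra.
have e2 : `|x ord0 i * (2 * dotp x y - b ^+ 2) - y ord0 i * a ^+ 2| <= a * (3 * (a * b)) + b * a ^+ 2.
  apply: (le_trans (ler_normB _ _)); rewrite [`|x ord0 i * _|]normrM [`|y ord0 i * _|]normrM.
  apply: lerD; apply: ler_pM => //.
  by rewrite gtr0_norm.
apply: (le_trans e2).
have e3 : a ^+ 2 / 4 <= c ^+ 2 by nra.
have -> : 16 * (b / a ^+ 2) * (c ^+ 2 * a ^+ 2) = 16 * b * c ^+ 2 by field; rewrite gt_eqF.
have : 16 * b * (a ^+ 2 / 4) <= 16 * b * c ^+ 2 by rewrite ler_wpM2l// mulr_ge0.
by move=> h; apply: le_trans h; lra.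
Qed.

(** On the ball of radius [4 e] the values are O(e^2), first derivatives O(e), all later ones O(1):
    exactly the pattern of [dbound] at scale [e] with constant [C * e ^+ 2]. The numbers 160 and 64
    are [10 * 4^2] and [16 * 4]. *)
Lemma dbound_log_taylor k x : 0 < enorm x -> exists C : R, 0 < C /\
  forall e : R, 0 < e <= 1 -> 4 * e <= enorm x / 8 ->
  dbound k.+2 (eball m.*2 (4 * e)) e (C * e ^+ 2) (log_taylor x).
Proof.
move=> x0; set a := enorm x in x0 *.
have oB r := @open_eball R m.*2 r.
have hL : Ck k.+2 (eball m.*2 a) (log_kernel x 0).
  by apply: Ck_log_kernel0 => // y; apply: contraPneq => ->; rewrite /eball /= ltxx.
have SB : [set y : V | enorm y <= a / 2] `<=` eball m.*2 a.
  by move=> y /= h; rewrite /eball /=; lra.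
have [A [A0 dA]] := dbound_compact (@compact_ceball R m.*2 (a / 2)) SB hL.
exists (A + 160 / a ^+ 2 + 64 / a ^+ 2).
have a2 : 0 < a ^+ 2 by rewrite exprn_gt0.
have q1 : 0 < 160 / a ^+ 2 by rewrite divr_gt0.
have q2 : 0 < 64 / a ^+ 2 by rewrite divr_gt0.
set C := A + _ + _; have C0 : 0 < C by rewrite /C; lra.
split; first exact: C0.
move=> e /andP[e0 e1] ea.
split.
  move=> y; rewrite /eball /= => ye.
  have y0 := enorm_ge0 y.
  have h : enorm y <= a / 8 by lra.
  apply: (le_trans (log_taylor_bound x0 h)); rewrite -/a.
  have : enorm y ^+ 2 <= (4 * e) ^+ 2 by rewrite ler_sqr ?nnegrE//; lra.
  move=> h2; apply: (@le_trans _ _ (160 / a ^+ 2 * e ^+ 2)).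
    rewrite (_ : 160 / a ^+ 2 * e ^+ 2 = 10 * ((4 * e) ^+ 2 / a ^+ 2)); last by ring.
    by rewrite ler_pM2l// ler_pM2r// invr_gt0.
  by rewrite ler_pM2r ?exprn_gt0// /C; lra.
have eE : C * e ^+ 2 / e = C * e by field; rewrite gt_eqF.
move=> i; rewrite eE; split.
  move=> y; rewrite /eball /= => ye.
  have y0 := enorm_ge0 y.
  have h : enorm y <= a / 2 by lra.
  apply: (le_trans (partial_log_taylor_bound i x0 h)); rewrite -/a.
  apply: (@le_trans _ _ (64 / a ^+ 2 * e)).
    rewrite (_ : 64 / a ^+ 2 * e = 16 * (4 * e / a ^+ 2)); last by ring.
    by rewrite ler_pM2l// ler_pM2r ?invr_gt0// ltW.
  by rewrite ler_pM2r// /C; lra.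
(* From the second derivative on the affine part has dropped out. The kernel is smooth on the
   compact ball of radius [a / 2], and since [e <= 1] its bound at scale 1 is also one at scale
   [e]. *)
move=> j; have -> : C * e / e = C by field; rewrite gt_eqF.
have oe := oB (4 * e).
have sub : eball m.*2 (4 * e) `<=` [set y : V | enorm y <= a / 2].
  by move=> y; rewrite /eball /= => ye; lra.
apply: (@dbound_ext R _ k _ e C (partial j (partial i (log_kernel x 0)))
  (partial j (partial i (log_taylor x))) oe).
  move=> y; rewrite inE => Uy.
  have hL' : Ck k.+2 (eball m.*2 (4 * e)) (log_kernel x 0).
    by apply: Ck_sub hL => z /sub /SB.
  have cst z : eball m.*2 (4 * e) z ->
      partial i (log_taylor x) z = partial i (log_kernel x 0) z + (- (enorm x ^- 2) *: x) ord0 i.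
    move=> Uz.
    have hA : Ck 1 setT (fun y => ln (enorm x) + dotp (- (enorm x ^- 2) *: x) y).
      by apply: Ck_affine; exact: openT.
    by rewrite (partialD (Ck_derivable i Uz hL') (CkT_derivable i z hA)) partial_affine.
  rewrite (@partial_ext _ _ _ (partial i (log_taylor x)) (fun z => partial i (log_kernel x 0) z
     + (- (enorm x ^- 2) *: x) ord0 i) y j oe Uy); last first.
    by move=> z; rewrite inE; exact: cst.
  rewrite (partialD (Ck_derivable j Uy (Ck_partial i hL')) (derivable_cst _ _ _)).
  by rewrite partial_cst addr0.
apply: (@dbound_le _ _ _ _ _ A) => //; first by rewrite /C; lra.
apply: (@dbound_scale_le _ _ _ _ _ 1); rewrite ?e0 ?e1//; first exact: ltW.
have := dbound_sub sub (dbound_partial j (dbound_partial i dA)).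
by rewrite !divr1.
Qed.

End taylor.

(** * Representation by the Taylor-corrected kernel *)

Section representation.
Context {R : realType} {m : nat}.
Local Notation V := 'rV[R]_(m.*2).
Hypothesis m0 : (0 < m)%N.
Variables (U : V -> R) (r : R).
Hypothesis r1 : r < 1.
Hypothesis vU : vanish r U.
Hypothesis hU : Ck m.*2 [set y : V | 0 < enorm y] U.
Local Notation F := (polylap m U).
Hypothesis IF : rintegrable F.
Hypothesis smallU : forall eps : R, 0 < eps -> exists delta : R, 0 < delta /\
  forall rho : R, 0 < rho < delta ->
    rintegrable (fun y => \1_(pball m.*2 rho) y * `|U y|) /\
    rint (fun y => \1_(pball m.*2 rho) y * `|U y|) <= eps * rho ^+ (m.*2 - 2).

Let n0 : (0 < m.*2)%N. Proof. by rewrite double_gt0. Qed.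
Let oT := @openT V.
Let oO : open [set y : V | 0 < enorm y]. Proof. exact: open_enorm_gt. Qed.

Lemma abs_ln_le (t : R) : 0 <= t -> `|ln t| <= t `^ (- 1) + t.
Proof.
rewrite le_eqVlt => /predU1P[<-|t0].
  by rewrite ln0// normr0 powR0 ?addr0// oppr_eq0 oner_neq0.
rewrite powR_inv1; last exact: ltW.
have h1 := ln_sublinear t0.
have h2 : ln t^-1 < t^-1 by apply: ln_sublinear; rewrite invr_gt0.
rewrite lnV ?posrE// in h2.
have h3 : 0 < t^-1 by rewrite invr_gt0.
by rewrite ler_norml; apply/andP; split; lra.
Qed.

Lemma compact_annulus (a b : R) : compact [set y : V | enorm y <= b /\ a <= enorm y].
Proof.
apply: (subclosed_compact _ (@compact_ceball R m.*2 b)); last by move=> y [].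
rewrite (_ : [set _ | _] = ~` [set y : V | b < enorm y] `&` ~` (eball m.*2 a)).
  by apply: closedI; apply: open_closedC; [exact: open_enorm_gt|exact: open_eball].
apply/seteqP; split => y /=; rewrite /eball /=.
  by move=> [h1 h2]; split; apply/negP; rewrite -leNgt.
by move=> [/negP + /negP]; rewrite -!leNgt.
Qed.

Lemma source_continuous : Ck 0 [set y : V | 0 < enorm y] F.
Proof. by apply: Ck_polylap => //; rewrite addn0. Qed.

Lemma source_vanish : vanish r F. Proof. exact: vanish_polylap. Qed.

Lemma source_bounded_away (a : R) : 0 < a -> exists A : R, 0 < A /\
  forall y, a <= enorm y -> `|F y| <= A.
Proof.
move=> a0.
have [|A [A0 hA]] := compact_bounded_fun (@compact_annulus a 1) _ source_continuous.
  by move=> y /= [_]; exact: lt_le_trans.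
exists A; split => // y ay; have [yr|yr] := leP (enorm y) r.
  by apply: hA; split => //; rewrite (le_trans yr)// ltW.
by rewrite source_vanish// normr0 ltW.
Qed.

Lemma rintegrable_riesz1 : exists C : R, forall x : V,
    rintegrable (fun y => \1_(eball m.*2 1) y * enorm (x - y) `^ (- 1)) /\
    rint (fun y => \1_(eball m.*2 1) y * enorm (x - y) `^ (- 1)) <= C.
Proof.
apply: rintegrable_riesz => //; apply/andP; split; first exact: ltr01.
by rewrite (ltr_nat R 1); case: (m) m0 => // m' _; rewrite doubleS.
Qed.

(** Near 0 the kernel is bounded and [F] integrable; away from 0 the roles are exchanged, [F] being
    bounded and the kernel having an integrable pole at [x]. *)
Lemma log_taylor_source_integrable x : 0 < enorm x -> rintegrable (fun y => log_taylor x y * F y).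
Proof.
move=> x0; set a := enorm x in x0 *.
have a8 : 0 < a / 8 by lra.
have [A [A0 hA]] := source_bounded_away a8.
have [C /(_ x)[Ir _]] := rintegrable_riesz1.
pose B := a + 1 + `|ln a| + a^-1.
have ia : 0 < a^-1 by rewrite invr_gt0.
have B0 : 0 <= B by rewrite /B !addr_ge0// ltW.
have mF := rintegrable_measurable IF.
apply: (@rintegrable_le _ _ _ (fun y => `|F y| + A * (\1_(eball m.*2 1) y * enorm (x - y) `^ (- 1)
   + B * \1_(eball m.*2 1) y))); last first.
  apply: rintegrableD; first exact: rintegrable_norm.
  apply: rintegrableZ; apply: rintegrableD => //; apply: rintegrableZ.
  exact: rintegrable_indic_eball.
- move=> y; have [ya|ya] := leP (enorm y) (a / 8).
    rewrite normrM -[leLHS]addr0 lerD//; last first.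
      by rewrite mulr_ge0 ?(ltW A0)// addr_ge0// mulr_ge0// powR_ge0.
    rewrite -[leRHS]mul1r ler_wpM2r// (le_trans (log_taylor_bound x0 ya))//.
    have y0 := enorm_ge0 y.
    have : enorm y / a <= 1 / 8 by rewrite ler_pdivrMr//; lra.
    have : 0 <= enorm y / a by rewrite divr_ge0// ltW.
    rewrite -expr_div_n -/a; nra.
  have [yr|yr] := leP (enorm y) r; last first.
    rewrite source_vanish// mulr0 normr0 addr_ge0// mulr_ge0 ?(ltW A0)// addr_ge0//.
    by rewrite mulr_ge0// powR_ge0.
    by rewrite mulr_ge0.
  have y1 : enorm y <= 1 by rewrite (le_trans yr)// ltW.
  have -> : \1_(eball m.*2 1) y = 1 :> R.
    by rewrite indicE mem_set//; exact: le_lt_trans r1.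
  rewrite mul1r mulr1 normrM -[leLHS]add0r lerD// mulrC ler_pM//.
    by apply: hA; exact: ltW.
  rewrite /log_taylor log_kernel0E (le_trans (ler_normD _ _))//.
  rewrite normrN; apply: (le_trans (lerD (abs_ln_le (enorm_ge0 _)) (ler_normD _ _))).
  rewrite -addrA lerD2l -/a /B.
  have h1 : enorm (x - y) <= a + 1.
    by rewrite (le_trans (ler_enormB _ _))// lerD2l; lra.
  have h2 : `|dotp (- (a ^- 2) *: x) y| <= a^-1.
    rewrite (le_trans (normr_dotp_le _ _))// enormZ normrN gtr0_norm ?invr_gt0 ?exprn_gt0//.
    rewrite -/a (_ : a ^- 2 * a = a^-1); last by field; rewrite gt_eqF.
    by rewrite -[leRHS]mulr1 ler_pM2l//; lra.
  lra.
- apply: measurable_funM => //; rewrite /log_taylor; apply: measurable_funD.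
    rewrite (_ : log_kernel x 0 = fun y : V => - ln (enorm (x - y))).
      exact: measurable_log_enorm.
    by apply/funext => y; exact: log_kernel0E.
  by apply: (@Ck_measurable _ _ 0); exact: Ck_affine.
Qed.

(** The fundamental identity is applied to [g = U (1 - z1)] and the kernel is split by [z2]. On the
    far part [g] is [U]. On the near part the operator is moved onto [z2 * log_taylor x], which
    costs [e^2 e^-2m] and leaves only [|U|], so no derivative of [U] near 0 is estimated. *)
Lemma representation_error x : 0 < enorm x -> exists M : R, 0 < M /\
  forall e : R, 0 < e <= 1 -> 4 * e <= enorm x / 8 ->
    rintegrable (fun y => \1_(pball m.*2 (4 * e)) y * `|U y|) ->
    `|log_const m * U x - rint (fun y => (1 - cutoff m.*2 ((2 * e)^-1 *: y)) * (log_taylor x y * F y))|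
      <= M * (e ^+ 2 * e ^- m.*2) * rint (fun y => \1_(pball m.*2 (4 * e)) y * `|U y|).
Proof.
move=> x0.
have [C [C0 hC]] := @dbound_log_taylor R m (m.*2 - 2) x x0.
have [A [A0 hA]] := @dbound_cutoff R m.*2 m.*2.
pose M := (m.*2)%:R ^+ m * (2 ^+ m.*2 * A * C).
exists (M + 1); split.
  by rewrite ltr_wpDl// !mulr_ge0 ?exprn_ge0// ltW.
move=> e /andP[e0 e1] ea Ip.
have n2 : (2 <= m.*2)%N by case: (m) m0 => // m' _; rewrite doubleS.
have e20 : 0 < 2 * e by rewrite mulr_gt0.
(* The first cutoff lives at scale [e] and ends at [3 e / 2]; the second is 1 up to [2 e] and ends
   at [3 e]. So [z2] is 1 around the support of [z1]. *)
pose z1 (y : V) := cutoff m.*2 (e^-1 *: y).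
pose z2 (y : V) := cutoff m.*2 ((2 * e)^-1 *: y).
have nz (c : R) (y : V) : 0 < c -> enorm (c^-1 *: y) = enorm y / c.
  by move=> c0; rewrite enormZ gtr0_norm ?invr_gt0// mulrC.
have z11 y : enorm y <= e -> z1 y = 1.
  by move=> h; rewrite /z1 cutoff1// nz// ler_pdivrMr// mul1r.
have z10 y : 3 / 2 * e <= enorm y -> z1 y = 0.
  by move=> h; rewrite /z1 cutoff0// nz// ler_pdivlMr.
have z21 y : enorm y <= 2 * e -> z2 y = 1.
  by move=> h; rewrite /z2 cutoff1// nz// ler_pdivrMr// mul1r.
have z20 y : 3 * e <= enorm y -> z2 y = 0.
  by move=> h; rewrite /z2 cutoff0// nz// ler_pdivlMr//; lra.
have hz1 : Ck m.*2 setT z1 by apply: CkT_scale; exact: Ck_cutoff.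
have hz2 : Ck m.*2 setT z2 by apply: CkT_scale; exact: Ck_cutoff.
pose g y := U y * (1 - z1 y).
have hg : Ck m.*2 setT g.
  apply: Ck_local => y _; have [ye|ye] := ltP (enorm y) e.
    exists (eball m.*2 e); split => //.
    apply: (Ck_ext (@open_eball R _ e)) (Ck_cst _ _ 0) => z; rewrite inE => ze.
    by rewrite /g z11 ?subrr ?mulr0//; exact: ltW.
  exists [set y : V | 0 < enorm y]; split; first by rewrite /=; lra.
  apply: CkM => //; apply: CkB => //; first exact: Ck_cst.
  exact: (Ck_sub (@subsetT _ _) hz1).
have vg : vanish r g by move=> y ry; rewrite /g vU// mul0r.
have gx : g x = U x by rewrite /g z10 ?subr0 ?mulr1//; lra.
pose Psi y := z2 y * log_taylor x y.
have oB (s : R) := @open_eball R m.*2 s.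
have htay (s : R) : s <= enorm x -> Ck m.*2 (eball m.*2 s) (log_taylor x).
  move=> sx; apply: CkD => //; last exact: Ck_affine.
  apply: Ck_log_kernel0 => // y; apply: contraPneq => ->; rewrite /eball /=.
  by move/lt_le_trans => /(_ _ sx); rewrite ltxx.
have hPsi : Ck m.*2 setT Psi.
  apply: Ck_local => y _; have [ye|ye] := ltP (enorm y) (enorm x).
    exists (eball m.*2 (enorm x)); split => //.
    apply: CkM => //; last exact: htay.
    exact: (Ck_sub (@subsetT _ _) hz2).
  exists [set y : V | 3 * e < enorm y]; split; first by rewrite /=; lra.
  have oe : open [set y : V | 3 * e < enorm y] by exact: open_enorm_gt.
  apply: (Ck_ext oe) (Ck_cst _ _ 0) => z; rewrite inE /= => ze.
  by rewrite /Psi z20 ?mul0r//; exact: ltW.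
have vPsi : vanish (3 * e) Psi by move=> y ye; rewrite /Psi z20 ?mul0r//; exact: ltW.
have hG : Ck 0 setT (polylap m g) by apply: Ck_polylap; rewrite ?addn0.
have vG : vanish r (polylap m g) by exact: vanish_polylap.
have [Iln fE] := fundamental_identity x m0 r1 hg vg.
pose aff (y : V) := ln (enorm x) + dotp (- (enorm x ^- 2) *: x) y.
have Ia : rintegrable (fun y => aff y * polylap m g y).
  apply: (@rintegrable_Ck R _ 0 r); last exact: vanishM.
  by apply: CkM => //; exact: Ck_affine.
have E1 : log_const m * U x = rint (fun y => log_taylor x y * polylap m g y).
  rewrite -gx fE -[LHS]addr0 -(rint_affine_polylap (ln (enorm x)) (- (enorm x ^- 2) *: x) m0 hg vg).
  rewrite -rintD//; congr rint; apply/funext => y.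
  by rewrite /log_taylor log_kernel0E [RHS]mulrDl.
have I1 : rintegrable (fun y => Psi y * polylap m g y).
  apply: (@rintegrable_Ck R _ 0 r); last exact: vanishM.
  apply: CkM => //.
  exact: (Ck_le (leq0n _) hPsi).
have z01 y : 0 <= z2 y <= 1 by rewrite cutoff_ge0 cutoff_le1.
have I2 : rintegrable (fun y => (1 - z2 y) * (log_taylor x y * F y)).
  apply: (@rintegrable_le _ _ _ (fun y => `|log_taylor x y * F y|)).
  - apply: measurable_funM; last exact: rintegrable_measurable (log_taylor_source_integrable x0).
    by apply: (@Ck_measurable _ _ m.*2); apply: CkB => //; exact: Ck_cst.
  - move=> y; rewrite normrM -[leRHS]mul1r ler_wpM2r//.
    by have /andP[? ?] := z01 y; rewrite ler_norml; apply/andP; split; lra.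
  - by apply: rintegrable_norm; exact: log_taylor_source_integrable.
have E2 : rint (fun y => log_taylor x y * polylap m g y) =
    rint (fun y => Psi y * polylap m g y) + rint (fun y => (1 - z2 y) * (log_taylor x y * F y)).
  rewrite -rintD//; congr rint; apply/funext => y.
  have [ye|ye] := leP (enorm y) (2 * e).
    by rewrite /Psi z21// subrr mul0r addr0 mul1r.
  (* Beyond [3 e / 2] the functions [g] and [U] agree on an open set, hence so do their iterated
     Laplacians. *)
  have -> : polylap m g y = F y.
    have oe : open [set y : V | 3 / 2 * e < enorm y] by exact: open_enorm_gt.
    apply: (polylap_ext m oe); last by rewrite inE /=; lra.
    by move=> z; rewrite inE /= => ze; rewrite /g z10 ?subr0 ?mulr1//; exact: ltW.
  by rewrite /Psi; ring.
rewrite E1 E2 addrK.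
rewrite -(rint_polylap hPsi hg vg).
have bd y : `|polylap m Psi y * g y| <=
    M * (e ^+ 2 * e ^- m.*2) * (\1_(pball m.*2 (4 * e)) y * `|U y|).
  have Me : 0 <= M * (e ^+ 2 * e ^- m.*2).
    by rewrite !mulr_ge0 ?exprn_ge0 ?invr_ge0 ?exprn_ge0// ltW.
  have [y4|y4] := leP (4 * e) (enorm y).
    rewrite (vanish_polylap m vPsi) ?mul0r ?normr0; last by lra.
    by rewrite mulr_ge0// mulr_ge0.
  (* The punctured indicator is 0 at the origin, and so is [g]. *)
  have [y0|y0] := eqVneq y 0.
    rewrite /g z11 ?subrr ?mulr0 ?normr0; first by rewrite mulr_ge0// mulr_ge0.
    by rewrite y0 enorm0 ltW.
  have -> : \1_(pball m.*2 (4 * e)) y = 1 :> R.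
    by rewrite indicE mem_set//; apply/andP; split => //; rewrite enorm_gt0.
  rewrite mul1r normrM ler_pM//; last first.
    rewrite /g normrM -[leRHS]mulr1 ler_wpM2l//.
    have := cutoff_ge0 m.*2 (e^-1 *: y); have := cutoff_le1 m.*2 (e^-1 *: y).
    by rewrite -/(z1 y) => ? ?; rewrite ler_norml; apply/andP; split; lra.
  have d1 : dbound m.*2 (eball m.*2 (4 * e)) e A z2.
    apply: (dbound_sub (@subsetT _ _)).
    apply: (@dbound_scale_le _ _ _ _ _ (2 * e)); [by rewrite e0/=; lra|exact: ltW|].
    by apply: dboundT_scale => //; exact: Ck_cutoff.
  have d2 : dbound m.*2 (eball m.*2 (4 * e)) e (C * e ^+ 2) (log_taylor x).
    have := hC e; rewrite e0 e1 => /(_ isT ea).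
    by rewrite -addn2 subnK.
  have hz2' := Ck_sub (@subsetT _ (eball m.*2 (4 * e))) hz2.
  have ex : 4 * e <= enorm x by lra.
  have Ce : 0 <= C * e ^+ 2 by rewrite mulr_ge0 ?sqr_ge0// ltW.
  have d3 := dboundM (oB _) e0 (ltW A0) Ce hz2' (htay _ ex) d1 d2.
  have hPsi' : Ck (m.*2 + 0) (eball m.*2 (4 * e)) Psi.
    by rewrite addn0; exact: (Ck_sub (@subsetT _ _) hPsi).
  rewrite -[X in dbound X]addn0 in d3.
  have := dbound_fun (dbound_polylap (oB _) e0 hPsi' d3) y4.
  move=> h; apply: (le_trans h); rewrite /M.
  by set T := e ^- _; rewrite le_eqVlt; apply/orP; left; apply/eqP; ring.
have I3 : rintegrable (fun y => polylap m Psi y * g y).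
  apply: (@rintegrable_Ck R _ 0 r); last exact: vanishM.
  apply: CkM => //.
    by apply: Ck_polylap; rewrite ?addn0.
  exact: (Ck_le (leq0n _) hg).
apply: (le_trans (rint_norm_le I3 (rintegrableZ _ Ip) bd)).
rewrite rintZ// ler_wpM2r//; first by apply: rint_ge0 => y; rewrite mulr_ge0.
by rewrite ler_wpM2r ?lerDl// mulr_ge0 ?exprn_ge0 ?invr_ge0 ?exprn_ge0// ltW.
Qed.

(** The error is [e^(2 - 2m)] times an integral that the smallness hypothesis makes [o(e^(2m - 2))],
    while dominated convergence removes the cutoff from the main term. *)
Theorem representation x : 0 < enorm x ->
  log_const m * U x = rint (fun y => log_taylor x y * F y).
Proof.
move=> x0; have [M [M0 hM]] := representation_error x0.
have IT := log_taylor_source_integrable x0.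
(* The choice [enorm x / 32] ensures [4 * e <= enorm x / 8], so all cutoffs stay away from the
   pole. *)
pose e0 : R := Num.min 1 (enorm x / 32).
have e00 : 0 < e0 by rewrite lt_min ltr01/=; lra.
have e01 : e0 <= 1 by rewrite ge_min lexx.
have e02 : 4 * e0 <= enorm x / 8.
  have : e0 <= enorm x / 32 by rewrite ge_min lexx orbT.
  lra.
pose e (k : nat) : R := e0 * k.+1%:R^-1.
have ep k : 0 < e k by rewrite mulr_gt0// invr_gt0.
have ele k : e k <= e0 by rewrite ger_pMr// invf_le1// ler1n.
have ecv : e k @[k --> \oo] --> (0 : R).
  rewrite -(mulr0 e0); apply: cvgM; first exact: cvg_cst.
  exact: cvg_harmonic.
have [|||_ cv] := @rint_cvg R _ (fun k y => (1 - cutoff m.*2 ((2 * e k)^-1 *: y)) * (log_taylor x y * F y))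
  (fun y => log_taylor x y * F y) (fun y => `|log_taylor x y * F y|) [set 0] (rv_set1_measurable 0)
  (rv_mu_set1_gt0 0 n0) _ (rintegrable_measurable IT) (rintegrable_norm IT).
- move=> k; apply: measurable_funM; last exact: rintegrable_measurable IT.
  apply: (@Ck_measurable _ _ m.*2); apply: CkB => //; first exact: Ck_cst.
  by apply: CkT_scale; exact: Ck_cutoff.
- move=> k y _; rewrite normrM -[leRHS]mul1r ler_wpM2r//.
  have := cutoff_ge0 m.*2 ((2 * e k)^-1 *: y); have := cutoff_le1 m.*2 ((2 * e k)^-1 *: y).
  by move=> ? ?; rewrite ler_norml; apply/andP; split; lra.
- move=> y /eqP y0; have yp : 0 < enorm y by rewrite enorm_gt0.
  suff : (1 - cutoff m.*2 ((2 * e k)^-1 *: y)) * (log_taylor x y * F y) @[k --> \oo]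
      --> (1 - 0) * (log_taylor x y * F y) by rewrite subr0 mul1r.
  apply: cvgM; last exact: cvg_cst.
  apply: cvgB; first exact: cvg_cst.
  apply: cvg_near_cst; near=> k.
  rewrite cutoff0// enormZ gtr0_norm ?invr_gt0 ?mulr_gt0// [leRHS]mulrC ler_pdivlMr ?mulr_gt0//.
  have : e k < enorm y / 3.
    by near: k; apply: (cvgr_lt _ ecv); rewrite divr_gt0.
  lra.
apply/eqP; rewrite -subr_eq0; apply/eqP.
have cvd : log_const m * U x -
    rint (fun y => (1 - cutoff m.*2 ((2 * e k)^-1 *: y)) * (log_taylor x y * F y)) @[k --> \oo]
    --> log_const m * U x - rint (fun y => log_taylor x y * F y).
  by apply: cvgB cv; exact: cvg_cst.
rewrite -(cvg_lim (@Rhausdorff R) cvd); apply/cvg_lim; first exact: Rhausdorff.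
apply/cvgr0Pnorm_le => eps eps0.
(* The hypothesis is used on the ball of radius [4 e]; the divisor absorbs the resulting
   [4 ^+ (m.*2 - 2)] and the constant [M]. *)
pose eps' := eps / (M * 4 ^+ (m.*2 - 2)).
have M4 : 0 < M * 4 ^+ (m.*2 - 2) by rewrite mulr_gt0// exprn_gt0.
have eps'0 : 0 < eps' by rewrite divr_gt0.
have [d [d0 hd]] := smallU eps'0.
near=> k.
have ek : e k < d / 4 by near: k; apply: (cvgr_lt _ ecv); rewrite divr_gt0.
have h4 : 0 < 4 * e k < d by rewrite mulr_gt0//=; lra.
have [Ip rp] := hd _ h4.
have hk : 0 < e k <= 1 by rewrite ep/= (le_trans (ele k)).
have hk2 : 4 * e k <= enorm x / 8 by apply: le_trans e02; rewrite ler_pM2l.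
apply: (le_trans (hM _ hk hk2 Ip)).
have Mp : 0 <= M * (e k ^+ 2 * e k ^- m.*2).
  by rewrite !mulr_ge0 ?exprn_ge0 ?invr_ge0 ?exprn_ge0// ltW.
apply: (le_trans (ler_wpM2l Mp rp)).
have n2 : (2 <= m.*2)%N by case: (m) m0 => // m' _; rewrite doubleS.
have ekn : e k != 0 by rewrite gt_eqF.
have -> : M * (e k ^+ 2 * e k ^- m.*2) * (eps' * (4 * e k) ^+ (m.*2 - 2)) =
   eps' * (M * 4 ^+ (m.*2 - 2)) * (e k ^+ 2 * e k ^+ (m.*2 - 2) * e k ^- m.*2).
  by rewrite [(4 * e k) ^+ _]exprMn; ring.
rewrite -exprD subnKC// divff ?mulr1; last by rewrite expf_neq0.
by rewrite /eps' divfK// gt_eqF.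
Unshelve. all: by end_near. Qed.

End representation.

(** * Null sets and shrinking boxes *)

Section rint_extra.
Context {R : realType} {n : nat}.
Local Notation V := 'rV[R]_n.
Local Notation mu := (@rv_mu R n).
Implicit Types (f g : V -> R) (x y : V).

(** Dominated convergence for the constant sequence [f], which tends to [g] off the null set. *)
Lemma rint_ae_eq f g (N : set V) : measurable N -> (mu N = 0)%E ->
  rintegrable f -> measurable_fun setT g -> (forall x, ~ N x -> f x = g x) ->
  rintegrable g /\ rint f = rint g.
Proof.
move=> mN muN If mg fg.
have [||Ig cv] := @rint_cvg R n (fun _ => f) g (fun x => `|f x|) N mN muN
  (fun _ => rintegrable_measurable If) mg (rintegrable_norm If).
- by [].
- by move=> x Nx; rewrite -fg//; exact: cvg_cst.
split => //; rewrite -(cvg_lim (@Rhausdorff R) cv).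
by rewrite lim_cst//; exact: Rhausdorff.
Qed.

Lemma rint_norm_le_ae f g (N : set V) : measurable N -> (mu N = 0)%E ->
  rintegrable f -> rintegrable g -> (forall x, ~ N x -> `|f x| <= g x) ->
  `|rint f| <= rint g.
Proof.
move=> mN muN If Ig fg.
have mI : measurable_fun setT (\1_(~` N) : V -> R).
  by apply: measurable_indic; exact: measurableC.
have off (h : V -> R) x : ~ N x -> h x = \1_(~` N) x * h x.
  by move=> Nx; rewrite indicE mem_set// mul1r.
have [If' ->] := rint_ae_eq mN muN If
  (measurable_funM mI (rintegrable_measurable If)) (off f).
have [Ig' ->] := rint_ae_eq mN muN Ig
  (measurable_funM mI (rintegrable_measurable Ig)) (off g).
apply: rint_norm_le => // x; rewrite /= indicE.
case: (boolP (x \in _)) => [|_]; last by rewrite !mul0r normr0.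
by rewrite inE => Nx; rewrite !mul1r; exact: fg.
Qed.

Lemma rintegrable_le_ae f g (N : set V) : measurable N -> (mu N = 0)%E ->
  measurable_fun setT f -> rintegrable g -> (forall x, ~ N x -> `|f x| <= g x) ->
  rintegrable f.
Proof.
move=> mN muN mf Ig fg.
have [||Ih _] := @rint_cvg R n (fun _ => f) f g N mN muN (fun _ => mf) mf Ig => //.
by move=> x Nx; exact: cvg_cst.
Qed.

Lemma set2_null x y : (0 < n)%N -> measurable [set x; y] /\ (mu [set x; y] = 0)%E.
Proof.
move=> n0; have m1 (z : V) := @rv_set1_measurable R n z.
split; first exact: measurableU.
by rewrite null_set_setU//; exact: rv_mu_set1_gt0.
Qed.

Lemma measurable_indicM (O : set V) f : open O -> {in O, continuous f} ->
  measurable_fun setT (fun y => \1_O y * f y).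
Proof.
move=> oO cf.
have mO := rv_open_measurable oO.
have := (measurable_restrictT f mO).1 (rv_continuous_measurable oO cf).
congr measurable_fun; apply/funext => y; rewrite /patch indicE.
by case: (y \in O); rewrite ?mul1r ?mul0r.
Qed.

Lemma open_preimage_in (O : set V) f (B : set R) : open O -> {in O, continuous f} ->
  open B -> open (O `&` f @^-1` B).
Proof.
move=> oO cf oB; rewrite openE => x [Ox fx]; apply: filterI.
  exact: open_nbhs_nbhs.
apply: cf; first by rewrite inE.
exact: open_nbhs_nbhs.
Qed.

Lemma open_box (O : set V) x : open O -> O x -> exists k : R, 0 < k /\ rv_box x k `<=` O.
Proof.
move=> oO Ox.
have /nbhs_ballP[e /= e0 eO] : nbhs x O by exact: open_nbhs_nbhs.
exists (e / 2); split; first by rewrite divr_gt0.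
move=> y yb; apply: eO; split => // i j; rewrite (ord1 i) /ball /= distrC.
by rewrite (le_lt_trans (yb j))// ltr_pdivrMr// ltr_pMr// ltr1n.
Qed.

(** A nonempty open set contains a cube of positive measure. Since [S] differs from [A] by at most
    the origin, it is measurable, and only then can its iterated integral be read as a measure. *)
Lemma null_open_empty (A S : set V) : open A -> A `<=` S -> S `<=` A `|` [set 0] ->
  rn_measure S = 0%E -> forall x, ~ A x.
Proof.
move=> oA AS SA S0 x Ax.
have mA := rv_open_measurable oA.
have mS : measurable S.
  have -> : S = A `|` (S `&` [set 0]).
    apply/seteqP; split => y; last by move=> [/AS|[]].
    by move=> Sy; have [|y0] := SA y Sy; [left|right].
  apply: measurableU => //.
  have [S00|S00] := pselect (S 0).
    have -> : S `&` [set 0] = [set 0] by apply/seteqP; split => y; [move=> []|move=> ->].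
    exact: rv_set1_measurable.
  have -> : S `&` [set 0] = set0 by apply/seteqP; split => y // [Sy y0]; apply: S00; rewrite -y0.
  exact: measurable0.
have : rn_measure S = mu S.
  rewrite /rn_measure rn_integralE; first by rewrite integral_indic// setIT.
  - by apply/measurable_EFinP; exact: measurable_indic.
  - by move=> y; rewrite lee_fin.
rewrite S0 => /esym muS.
have [k [k0 kA]] := open_box oA Ax.
have : (mu (rv_box x k) <= mu S)%E.
  apply: le_measure; rewrite ?inE//; first exact: measurable_rv_box.
  by move=> y /kA /AS.
rewrite muS rv_mu_box; last exact: ltW.
by rewrite lee_fin leNgt exprn_gt0// mulr_gt0.
Qed.

Lemma measurable_off0 f : {in [set y : V | 0 < enorm y], continuous f} ->
  measurable_fun setT f.
Proof.
move=> cf.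
have oO : open [set y : V | 0 < enorm y] by exact: open_enorm_gt.
have h1 := measurable_indicM oO cf.
have h2 : measurable_fun setT (fun y : V => \1_[set 0] y * f 0).
  by apply: measurable_funM => //; apply: measurable_indic; exact: rv_set1_measurable.
have := measurable_funD h1 h2; congr measurable_fun; apply/funext => y /=.
have [->|y0] := eqVneq y 0.
  rewrite !indicE memNset ?mul0r ?add0r; last by rewrite /= enorm0 ltxx.
  by rewrite mem_set// mul1r.
rewrite !indicE mem_set ?mul1r; last by rewrite /= enorm_gt0.
by rewrite memNset ?mul0r ?addr0//; apply/eqP.
Qed.

(* A function bounded below by [c r^-n] on boxes of size [r] shrinking to 0 is
   not integrable: each box carries a mass bounded away from 0. *)
Lemma not_integrable_of_boxes (g : V -> R) (w : V) (k c rho : R) : (0 < n)%N ->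
  0 < k -> 0 < c -> 0 < rho -> (forall y, 0 <= g y) ->
  rintegrable (fun y => \1_(pball n 1) y * g y) ->
  (forall r, 0 < r < rho -> forall y, rv_box (r *: w) (k * r) y ->
     0 < enorm y < 1 /\ c <= r ^+ n * g y) -> False.
Proof.
move=> n0 k0 c0 rho0 g0 Ig h.
(* Chosen so that the box at scale [r] lies in the ball of radius [D * r]. *)
pose D := enorm w + n%:R * k + 1.
have D0 : 0 < D by rewrite /D ltr_wpDl// addr_ge0 ?enorm_ge0// mulr_ge0// ltW.
pose r (j : nat) : R := rho / 2 * j.+1%:R^-1.
have r0 j : 0 < r j by rewrite mulr_gt0 ?invr_gt0// divr_gt0.
have rr j : r j < rho.
  rewrite (@le_lt_trans _ _ (rho / 2))//; last by lra.
  by rewrite ger_pMr ?divr_gt0// invf_le1// ler1n.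
have rcv : r j @[j --> \oo] --> (0 : R).
  rewrite -(mulr0 (rho / 2)); apply: cvgM; first exact: cvg_cst.
  exact: cvg_harmonic.
(* The mass on these shrinking balls tends to 0 by dominated convergence, yet the boxes force it to
   stay above [c * (2 * k) ^+ n]. *)
pose f j (y : V) := \1_(eball n (D * r j)) y * (\1_(pball n 1) y * g y).
have mf j : measurable_fun setT (f j).
  apply: measurable_funM; last exact: rintegrable_measurable Ig.
  by apply: measurable_indic; exact: measurable_eball.
have p0 y : 0 <= \1_(pball n 1) y * g y by rewrite mulr_ge0.
have fg j y : `|f j y| <= \1_(pball n 1) y * g y.
  rewrite /f indicE; case: (y \in _); rewrite ?mul1r ?mul0r ?normr0 ?ger0_norm//.
have [|I0 cv] := @rint_cvg R n f (fun=> 0) _ set0 measurable0 (measure0 _) mf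
  (measurable_cst _) Ig (fun j y _ => fg j y).
  move=> y _; have [->|y0] := eqVneq y 0.
    apply: cvg_near_cst; near=> j; rewrite /f [\1_(pball n 1) 0]indicE memNset ?mul0r ?mulr0//.
    by rewrite /pball /= enorm0 ltxx.
  have yp : 0 < enorm y by rewrite enorm_gt0.
  apply: cvg_near_cst; near=> j; rewrite /f indicE memNset ?mul0r//.
  rewrite /eball /=; apply/negP; rewrite -leNgt mulrC -ler_pdivlMr// ltW//.
  by near: j; apply: (cvgr_lt _ rcv); rewrite divr_gt0.
have If j : rintegrable (f j) by exact: (rintegrable_le (mf j) (fg j) Ig).
have lb j : c * (2 * k) ^+ n <= rint (f j).
  have krj : 0 <= k * r j by rewrite mulr_ge0// ltW.
  have [Ib bE] := rintegrable_indic_box (r j *: w) krj.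
  have -> : c * (2 * k) ^+ n = rint (fun y => c * (r j) ^- n * \1_(rv_box (r j *: w) (k * r j)) y).
    rewrite rintZ// bE mulrA [(_ * r j) ^+ n]exprMn.
    by field; rewrite expf_neq0// gt_eqF.
  apply: rint_le => //; first exact: rintegrableZ.
  move=> y; rewrite [X in _ * X <= _]indicE; case: (boolP (y \in _)) => [|_]; last first.
    by rewrite mulr0 /f mulr_ge0.
  rewrite inE mulr1 => yb.
  have [|y1 gy] := h (r j) _ y yb; first by rewrite r0 rr.
  have yD : enorm y < D * r j.
    rewrite -(subrK (r j *: w) y) (le_lt_trans (ler_enormD _ _))//.
    have h1 : enorm (y - r j *: w) <= n%:R * (k * r j).
      by apply: enorm_le_coord => i; have := yb i; rewrite !mxE.
    rewrite enormZ gtr0_norm// /D.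
    by have := r0 j; move: h1; nra.
  rewrite /f !indicE !mem_set// !mul1r.
  by rewrite ler_pdivrMr ?exprn_gt0// mulrC.
have : 0 < c * (2 * k) ^+ n by rewrite mulr_gt0// exprn_gt0// mulr_gt0.
rewrite ltNge => /negP; apply.
rewrite -[X in _ <= X](rint0 (n := n)) -(cvg_lim (@Rhausdorff R) cv).
apply: limr_ge; first by apply/cvg_ex; eexists; exact: cv.
by near=> j; exact: lb.
Unshelve. all: by end_near. Qed.

End rint_extra.

(** * The singular part *)

Section potential.
Context {R : realType} {m : nat}.
Local Notation n := m.*2.
Local Notation V := 'rV[R]_(m.*2).
Hypothesis m0 : (0 < m)%N.
Variables (u F : V -> R) (c0 M : R).
Hypothesis c0_gt0 : 0 < c0.
Hypothesis IF : rintegrable F.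
Hypothesis F0 : F 0 = 0.
Hypothesis vF : vanish (3 / 4) F.
Hypothesis F_u : forall y, 0 < enorm y < 1 / 2 -> 0 <= F y <= M * expR (u y).
Hypothesis Ieu : rintegrable (fun y => \1_(pball n 1) y * expR (u y)).
Hypothesis ItF : forall x, 0 < enorm x -> rintegrable (fun y => log_taylor x y * F y).
Hypothesis rep : forall x, 0 < enorm x < 1 / 2 ->
  c0 * u x = rint (fun y => log_taylor x y * F y).

Let n0 : (0 < n)%N. Proof. by rewrite double_gt0. Qed.
Let mF := rintegrable_measurable IF.
Let nF : rintegrable (fun y => `|F y|). Proof. exact: rintegrable_norm. Qed.

Lemma source_ge0 y : enorm y < 1 / 2 -> 0 <= F y.
Proof.
move=> y2; have [->|y0] := eqVneq y 0; first by rewrite F0.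
have hy : 0 < enorm y < 1 / 2 by rewrite enorm_gt0 y0.
by have /andP[] := F_u hy.
Qed.

Definition pot x : R := rint (fun y => - ln (enorm (x - y)) * F y).
Let a := rint F.
Let b : V := \row_i rint (fun y => y ord0 i * F y).

Lemma coordF_integrable i : rintegrable (fun y : V => y ord0 i * F y).
Proof.
apply: (rintegrable_le _ _ nF).
  by apply: measurable_funM => //; exact: measurable_coord.
move=> y; have [y1|y1] := leP (enorm y) (3 / 4); last by rewrite vF// mulr0 normr0.
rewrite normrM -[leRHS]mul1r ler_wpM2r// (le_trans (coord_le_enorm y i))//; lra.
Qed.

Lemma dotpF_integrable (w : V) : rintegrable (fun y => dotp w y * F y).
Proof.
have : rintegrable (fun y => \sum_(i < n) w ord0 i * (y ord0 i * F y)).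
  by apply: rintegrable_sum => i; apply: rintegrableZ; exact: coordF_integrable.
congr rintegrable; apply/funext => y; rewrite /dotp mulr_suml.
by apply: eq_bigr => i _; rewrite mulrA.
Qed.

Lemma rint_dotpF (w : V) : rint (fun y => dotp w y * F y) = dotp w b.
Proof.
transitivity (rint (fun y => \sum_(i < n) w ord0 i * (y ord0 i * F y))).
  congr rint; apply/funext => y; rewrite /dotp mulr_suml.
  by apply: eq_bigr => i _; rewrite mulrA.
rewrite rint_sum => [|i]; last by apply: rintegrableZ; exact: coordF_integrable.
apply: eq_bigr => i _; rewrite rintZ; last exact: coordF_integrable.
by rewrite mxE.
Qed.

Lemma pot_integrable x : 0 < enorm x -> rintegrable (fun y => - ln (enorm (x - y)) * F y).
Proof.
move=> x0.
have := rintegrableB (ItF x0) (rintegrableD (rintegrableZ (ln (enorm x)) IF)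
  (dotpF_integrable (- (enorm x ^- 2) *: x))).
congr rintegrable; apply/funext => y.
by rewrite /log_taylor log_kernel0E; ring.
Qed.

Lemma u_pot x : 0 < enorm x < 1 / 2 ->
  c0 * u x = pot x + a * ln (enorm x) - enorm x ^- 2 * dotp x b.
Proof.
move=> /[dup] hx /andP[x0 _]; rewrite rep//.
have Ip := pot_integrable x0.
transitivity (rint (fun y => - ln (enorm (x - y)) * F y
   + (ln (enorm x) * F y + dotp (- (enorm x ^- 2) *: x) y * F y))).
  by congr rint; apply/funext => y; rewrite /log_taylor log_kernel0E; ring.
have I1 := rintegrableZ (ln (enorm x)) IF.
have I2 := dotpF_integrable (- (enorm x ^- 2) *: x).
rewrite rintD//; last exact: rintegrableD.
by rewrite rintD// rintZ// rint_dotpF dotpZl -/(pot x) -/a; ring.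
Qed.

Lemma ln_bound_away (t c : R) : 0 < c -> c <= t -> `|ln t| <= c^-1 + t.
Proof.
move=> c00 ct; have t0 : 0 < t by exact: lt_le_trans ct.
rewrite (le_trans (abs_ln_le (ltW t0)))// powR_inv1; last exact: ltW.
by rewrite lerD2r lef_pV2.
Qed.

Let C := 5 * rint (fun y => `|F y|).

(** Where [|y| < 1/2], both [- ln |x - y|] and [F y] are nonnegative. In the remaining shell
    [1/4 <= |x - y| <= 1], so the logarithm is at most [4 + 1 = 5], the factor in [C]. *)
Lemma pot_ge x : 0 < enorm x < 1 / 4 -> - C <= pot x.
Proof.
move=> /andP[x0 x4].
rewrite /C -mulNr -rintZ//; apply: rint_le; [exact: rintegrableZ|exact: pot_integrable|].
move=> y; have [y2|y2] := ltP (enorm y) (1 / 2).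
  apply: (@le_trans _ _ 0); first by rewrite mulNr oppr_le0 mulr_ge0.
  rewrite mulr_ge0 ?source_ge0// oppr_ge0 ln_le0//.
  by have := ler_enormB x y; lra.
have [y3|y3] := leP (enorm y) (3 / 4); last by rewrite vF// normr0 !mulr0.
have t1 : 1 / 4 <= enorm (x - y) by rewrite enormB; have := ler_enormBB y x; lra.
have t2 : enorm (x - y) <= 1 by have := ler_enormB x y; lra.
have h : `|ln (enorm (x - y))| <= 5.
  rewrite (le_trans (ln_bound_away _ t1))//; lra.
have : `|- ln (enorm (x - y)) * F y| <= 5 * `|F y| by rewrite normrM normrN ler_wpM2r.
by move/ler_normlP => [h1 _]; lra.
Qed.

(** If [b] were nonzero, then on boxes around [- r b] the term [- x.b / |x|^2] would be at least
    [1 / (4 r)]. This beats the logarithm and the lower bound of the potential, so [e^u >= r^-n]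
    there, against integrability. *)
Lemma dipole_eq0 : b = 0.
Proof.
apply/eqP/negP => /negP b0; have bp : 0 < enorm b by rewrite enorm_gt0.
have np : 0 < n%:R :> R by rewrite ltr0n.
set be := enorm b in bp.
have C0 : 0 <= C by rewrite mulr_ge0// rint_ge0.
(* Bounds [|ln (|x| / r)|], as the ratio lies between 3/4 and 5/4 of [|b|] in the box. *)
pose C2 := (3 / 4 * be)^-1 + 5 / 4 * be.
have C20 : 0 <= C2.
  by rewrite addr_ge0 ?invr_ge0 ?mulr_ge0// ltW.
(* Threshold for [r^(-1/2)] beyond which the quadratic [q^2 / 4] outweighs all terms that are at
   most linear in [q]. *)
pose Q := 4 * (2 * (`|a| + n%:R * c0) + C + `|a| * C2) + 1.
have Q1 : 1 <= Q.
  by rewrite /Q lerDr mulr_ge0// !addr_ge0// ?mulr_ge0// ?addr_ge0// ?mulr_ge0// ltW.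
have Q0 : 0 < Q by exact: lt_le_trans Q1.
pose rho := Num.min (Q ^- 2) (1 / (5 * be)).
have rho0 : 0 < rho by rewrite lt_min invr_gt0 exprn_gt0//= divr_gt0// mulr_gt0.
have k0 : 0 < be / (4 * n%:R) by rewrite divr_gt0// mulr_gt0.
apply: (@not_integrable_of_boxes R n (fun y => expR (u y)) (- b) (be / (4 * n%:R)) 1 rho n0 k0 ltr01 rho0
  (fun y => ltW (expR_gt0 _)) Ieu).
move=> r /andP[r0 rr] x xb.
have r1 : r < Q ^- 2 by apply: lt_le_trans rr _; rewrite ge_min lexx.
have r2 : r < 1 / (5 * be) by apply: lt_le_trans rr _; rewrite ge_min lexx orbT.
have rb : r * be < 1 / 5.
  by move: r2; rewrite ltr_pdivlMr ?mulr_gt0//; lra.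
pose v := x + r *: b.
have xE : x = v - r *: b by rewrite /v addrK.
have vb : enorm v <= be * r / 4.
  have : enorm v <= n%:R * (be / (4 * n%:R) * r).
    apply: enorm_le_coord => i; have := xb i; rewrite !mxE.
    by rewrite mulrN opprK.
  move=> h; apply: (le_trans h); rewrite le_eqVlt; apply/orP; left; apply/eqP; field.
  by rewrite gt_eqF.
have rbE : enorm (r *: b) = r * be by rewrite enormZ gtr0_norm.
have x1 : enorm x <= 5 / 4 * (be * r).
  by rewrite xE (le_trans (ler_enormB _ _))// rbE; lra.
have x2 : 3 / 4 * (be * r) <= enorm x.
  rewrite xE enormB; have := ler_enormBB (r *: b) v; rewrite rbE; lra.
have br0 : 0 < be * r by rewrite mulr_gt0.
have xp : 0 < enorm x by lra.
have x4 : enorm x < 1 / 4 by lra.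
split; first by rewrite xp/=; lra.
(* In the box [x.b <= - (3/4) r |b|^2] and [|x|^2 <= (25/16) r^2 |b|^2]; the quotient is
   [12 / (25 r)], above [1 / (4 r)]. *)
have dx : 1 / (4 * r) <= - (enorm x ^- 2 * dotp x b).
  have -> : dotp x b = dotp v b - r * be ^+ 2.
    rewrite xE /be -dotpxx -dotpZl /dotp -sumrB; apply: eq_bigr => i _.
    by rewrite !mxE; ring.
  have hv : dotp v b <= be * r / 4 * be.
    by rewrite (le_trans (dotp_le _ _))// ler_wpM2r// ltW.
  have ib : enorm x ^+ 2 <= (5 / 4 * (be * r)) ^+ 2.
    by rewrite ler_sqr ?nnegrE ?enorm_ge0//; lra.
  rewrite -mulrN [leRHS]mulrC ler_pdivlMr ?exprn_gt0//.
  rewrite mulrAC.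
  rewrite mul1r ler_pdivrMr ?mulr_gt0// [leRHS]mulrC.
  apply: (le_trans ib).
  have : 4 * r * (3 / 4 * (r * be ^+ 2)) <= 4 * r * - (dotp v b - r * be ^+ 2).
    by rewrite ler_wpM2l; lra.
  move=> h; apply: le_trans h.
  by have := sqr_ge0 (be * r); nra.
have hx2 : 0 < enorm x < 1 / 2 by rewrite xp/=; lra.
have up := u_pot hx2.
have hx4 : 0 < enorm x < 1 / 4 by rewrite xp.
have pg := pot_ge hx4.
(* In terms of [q = r^(-1/2)] the dipole gives [q^2 / 4], while [|ln r| <= 2 q]: the comparison
   becomes polynomial. *)
set s := Num.sqrt r; have s0 : 0 < s by rewrite sqrtr_gt0.
have sE : r = s ^+ 2 by rewrite sqr_sqrtr// ltW.
have lr : `|ln r| <= 2 * s^-1.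
  have r1' : r <= 1.
    rewrite (le_trans (ltW r1))// invf_le1 ?exprn_gt0// exprn_ege1//.
  have := ln_le0 r1' => l0.
  rewrite ler0_norm// sE; have -> : ln (s ^+ 2) = 2 * ln s by rewrite lnXn// mulr_natl.
  by rewrite -mulrN -lnV ?posrE// ler_pM2l// ltW// ln_sublinear// invr_gt0.
have lx : `|ln (enorm x)| <= C2 + 2 * s^-1.
  have -> : enorm x = enorm x / r * r by rewrite divfK// gt_eqF.
  rewrite lnM ?posrE ?divr_gt0// (le_trans (ler_normD _ _))// lerD//.
  have h1 : 3 / 4 * be <= enorm x / r by rewrite ler_pdivlMr//; lra.
  have bp' : 0 < 3 / 4 * be by rewrite mulr_gt0.
  rewrite (le_trans (ln_bound_away bp' h1))// lerD2l ler_pdivrMr//; lra.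
have la : - (`|a| * (C2 + 2 * s^-1)) <= a * ln (enorm x).
  have : `|a * ln (enorm x)| <= `|a| * (C2 + 2 * s^-1).
    by rewrite normrM; apply: ler_wpM2l.
  by rewrite ler_norml => /andP[].
have rn : r ^+ n = expR (n%:R * ln r).
  by rewrite expRM_natl lnK ?posrE.
rewrite rn -expRD -[leLHS]expR0 ler_expR.
have ln' : - (2 * s^-1) <= ln r by move: lr; rewrite ler_norml => /andP[].
have q1 : Q <= s^-1.
  have h : s <= Q^-1.
    rewrite leNgt; apply/negP => h; have Qi0 : 0 < Q^-1 by rewrite invr_gt0.
    have : Q^-1 ^+ 2 < s ^+ 2 by rewrite ltr_pXn2r// nnegrE ltW.
    by rewrite exprVn -sE ltNge (ltW r1).
  by rewrite -[Q]invrK lef_pV2 ?posrE ?invr_gt0.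
have e4 : 1 / (4 * r) = s^-1 ^+ 2 / 4.
  by rewrite sE; field; rewrite gt_eqF.
set q := s^-1 in lr lx la ln' q1 e4 *.
rewrite -(ler_pM2l c0_gt0) mulr0 mulrDr up.
have hn : c0 * (n%:R * - (2 * q)) <= c0 * (n%:R * ln r).
  by rewrite ler_pM2l// ler_pM2l.
have : 0 <= q ^+ 2 / 4 - C - `|a| * (C2 + 2 * q) - c0 * (n%:R * (2 * q)).
  have qq : Q * q <= q ^+ 2 by rewrite expr2 ler_wpM2r//; lra.
  have q00 : 1 <= q by exact: le_trans q1.
  have e5 : C <= C * q by rewrite ler_peMr.
  have e6 : `|a| * C2 <= `|a| * C2 * q by rewrite ler_peMr// mulr_ge0.
  have : Q * q = 4 * (2 * (`|a| + n%:R * c0) * q + C * q + `|a| * C2 * q) + q.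
    by rewrite /Q; ring.
  move: qq e5 e6 q00; clearbody q Q C2; rewrite -/C.
  move: (C) (`|a|) => CC A; move: (n%:R : R) => N qq e5 e6 q00 e7; lra.
rewrite -e4; lra.
Qed.

Let alpha := a / c0.

(** Once the dipole is gone, [alpha <= - n] would give [e^u] at least a constant times [|x|^-n] near
    0, contradicting integrability on boxes around [r (1, ..., 1)]. *)
Lemma log_coef_gt : - n%:R < alpha.
Proof.
have np : 0 < n%:R :> R by rewrite ltr0n.
rewrite ltNge; apply/negP => hal.
have an : a <= - n%:R * c0 by rewrite -ler_pdivrMr.
(* In the box all coordinates lie between [r / 2] and [3 r / 2], so [|x| <= (3/2) n r]; the
   exponential comes from the lower bound of the potential. *)
pose c := ((3 / 2 * n%:R) ^- n) * expR (- (C / c0)).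
have c00 : 0 < c by rewrite mulr_gt0 ?expR_gt0// invr_gt0 exprn_gt0// mulr_gt0.
pose rho : R := (6 * n%:R)^-1.
have rho0 : 0 < rho by rewrite invr_gt0 mulr_gt0.
apply: (@not_integrable_of_boxes R n (fun y => expR (u y)) (const_mx 1) (1 / 2) c rho n0 _ c00 rho0
  (fun y => ltW (expR_gt0 _)) Ieu); first by lra.
move=> r /andP[r0 rr] x xb.
have xi i : r / 2 <= x ord0 i <= 3 / 2 * r.
  have := xb i; rewrite !mxE mulr1 ler_distl => /andP[h1 h2].
  by apply/andP; split; lra.
have x1 : enorm x <= 3 / 2 * n%:R * r.
  rewrite -mulrA mulrCA; apply: enorm_le_coord => i.
  by have /andP[h1 h2] := xi i; rewrite ler_norml; apply/andP; split; lra.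
have x2 : r / 2 <= enorm x.
  have := coord_le_enorm x (Ordinal n0); have /andP[h _] := xi (Ordinal n0).
  by have := ler_norm (x ord0 (Ordinal n0)); lra.
have xp : 0 < enorm x by lra.
have rn : r * (6 * n%:R) < 1 by move: rr; rewrite /rho -[X in _ < X]div1r ltr_pdivlMr// mulr_gt0.
have x4 : enorm x < 1 / 4.
  rewrite (le_lt_trans x1)//.
  have -> : 3 / 2 * n%:R * r = r * (6 * n%:R) / 4 by field.
  by rewrite ltr_pM2r.
split; first by rewrite xp/=; lra.
have hx2 : 0 < enorm x < 1 / 2 by rewrite xp/=; lra.
have hx4 : 0 < enorm x < 1 / 4 by rewrite xp.
have := u_pot hx2; rewrite dipole_eq0.
have -> : dotp x 0 = 0 by rewrite /dotp big1// => i _; rewrite mxE mulr0.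
rewrite mulr0 subr0 => up.
have pg := pot_ge hx4.
have l0 : ln (enorm x) <= 0 by apply: ln_le0; lra.
have ul : - n%:R * ln (enorm x) - C / c0 <= u x.
  rewrite -(ler_pM2l c0_gt0) up mulrBr [c0 * (C / c0)]mulrC divfK ?gt_eqF//.
  have : - n%:R * c0 * ln (enorm x) <= a * ln (enorm x) by rewrite ler_wnM2r.
  lra.
have eu : enorm x ^- n * expR (- (C / c0)) <= expR (u x).
  apply: le_trans (_ : expR (- n%:R * ln (enorm x) - C / c0) <= _); last by rewrite ler_expR.
  have -> : enorm x ^- n = expR (- n%:R * ln (enorm x)).
    by rewrite mulNr expRN expRM_natl lnK ?posrE.
  by rewrite -expRD.
rewrite /c.
apply: (@le_trans _ _ (r ^+ n * (enorm x ^- n * expR (- (C / c0))))); last first.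
  by rewrite ler_wpM2l// exprn_ge0// ltW.
rewrite mulrA ler_wpM2r ?(ltW (expR_gt0 _))//.
rewrite -exprVn -exprVn -exprMn lerXn2r ?nnegrE ?invr_ge0 ?mulr_ge0 ?invr_ge0 ?(ltW r0) ?enorm_ge0//.
rewrite ler_pdivlMr// ler_pdivrMl ?mulr_gt0//.
Qed.

End potential.

(** * Hoelder continuity of the potential *)

Section log_estimates.
Context {R : realType}.
Implicit Types (a b c t tau : R).

Lemma ln_le_powR tau t : 0 < tau -> 0 < t -> ln t <= tau^-1 * (t `^ tau - 1).
Proof.
move=> tau0 t0; have p0 : 0 < t `^ tau by rewrite powR_gt0.
have : ln (1 + (t `^ tau - 1)) <= t `^ tau - 1 by apply: le_ln1Dx; lra.
rewrite [1 + _]addrC subrK ln_powR => h.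
by rewrite -ler_pdivrMl ?invr_gt0// invrK.
Qed.

Lemma abs_ln_le_powR tau t : 0 < tau -> 0 <= t -> `|ln t| <= tau^-1 * t `^ (- tau) + t.
Proof.
move=> tau0; have ti : 0 < tau^-1 by rewrite invr_gt0.
rewrite le_eqVlt => /predU1P[<-|t0].
  by rewrite ln0// normr0 addr0 mulr_ge0 ?powR_ge0// ltW.
have p0 : 0 < t `^ (- tau) by rewrite powR_gt0.
have [t1|t1] := leP 1 t.
  rewrite ger0_norm ?ln_ge0//; have := ln_sublinear t0 => h.
  by rewrite (le_trans (ltW h))// lerDr mulr_ge0// ltW.
rewrite ler0_norm ?ln_le0//; last exact: ltW.
have hp : 0 < t^-1 by rewrite invr_gt0.
rewrite -lnV ?posrE// (le_trans (ln_le_powR tau0 hp))//.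
have -> : t^-1 `^ tau = t `^ (- tau).
  by rewrite -(powR_inv1 (ltW t0)) -powRrM mulN1r.
by rewrite mulrBr mulr1; lra.
Qed.

Lemma ln1D_le_powR tau t : 0 < tau < 1 -> 0 < t -> ln (1 + t) <= tau^-1 * t `^ tau.
Proof.
move=> /andP[tau0 tau1] t0.
have ti : 1 <= tau^-1 by rewrite invf_ge1// ltW.
have p0 : 0 < t `^ tau by rewrite powR_gt0.
have [t1|t1] := leP t 1.
  have h : t <= t `^ tau.
    rewrite -{1}(powRr1 (ltW t0)); apply: ger_powR; last exact: ltW.
    by rewrite t0.
  rewrite (@le_trans _ _ t)//; first by apply: le_ln1Dx; lra.
  by rewrite (le_trans h)// ler_peMl// ltW.
have h : ln (1 + t) <= ln 2 + ln t.
  by rewrite -lnM ?posrE// ler_ln ?posrE; lra.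
have l2 : ln 2 <= 1 :> R.
  by have := @le_ln1Dx R 1; rewrite -[1 + 1]/(2 : R); apply; lra.
have := ln_le_powR tau0 t0; rewrite mulrBr mulr1; lra.
Qed.

(** For [a < b] the difference is [ln (1 + (b - a) / a)], at most [tau^-1 ((b - a) / a)^tau]. It
    trades a Hoelder factor for a Riesz kernel of order [tau]; the sum of two powers makes the bound
    symmetric. *)
Lemma ln_dist_le tau a b : 0 < tau < 1 -> 0 < a -> 0 < b ->
  `|ln a - ln b| <= tau^-1 * `|a - b| `^ tau * (a `^ (- tau) + b `^ (- tau)).
Proof.
move=> htau; have /andP[tau0 tau1] := htau.
have ti : 0 < tau^-1 by rewrite invr_gt0.
wlog ab : a b / a <= b.
  move=> W a0 b0; have [|/ltW] := leP a b; first by move=> ?; exact: W.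
  by move=> ba; rewrite distrC [`|a - b|]distrC [_ + b `^ _]addrC; exact: W ba b0 a0.
move=> a0 b0; move: ab; rewrite le_eqVlt => /predU1P[<-|ab].
  by rewrite !subrr normr0 mulr_ge0 ?addr_ge0 ?powR_ge0// mulr_ge0 ?powR_ge0// ltW.
rewrite distrC [`|a - b|]distrC !gtr0_norm ?subr_gt0//; last by rewrite ltr_ln ?posrE.
have q0 : 0 < (b - a) / a by rewrite divr_gt0// subr_gt0.
have -> : ln b - ln a = ln (1 + (b - a) / a).
  have -> : 1 + (b - a) / a = b / a by field; rewrite gt_eqF.
  by rewrite ln_div ?posrE.
rewrite (le_trans (ln1D_le_powR htau q0))// -mulrA ler_pM2l//.
rewrite powRM ?subr_ge0 ?invr_ge0 ?(ltW ab) ?(ltW a0)//.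
rewrite -(powR_inv1 (ltW a0)) -powRrM mulN1r ler_wpM2l ?powR_ge0//.
by rewrite lerDl powR_ge0.
Qed.

Lemma expRN_ln_le t : 0 <= t -> expR (- ln t) <= t `^ (-1) + 1.
Proof.
rewrite le_eqVlt => /predU1P[<-|t0].
  by rewrite ln0// oppr0 expR0 lerDr powR_ge0.
by rewrite expRN lnK ?posrE// (powR_inv1 (ltW t0)) lerDl.
Qed.

(** The exponents add up to 1 and each base is at most the sum, so the product is at most the sum to
    the power 1. *)
Lemma young3 tau a b c : 0 < tau < 1 / 2 -> 0 <= a -> 0 <= b -> 0 <= c ->
  a `^ tau * b `^ (1 - 2 * tau) * c `^ tau <= a + b + c.
Proof.
move=> /andP[t0 t1] a0 b0 c0; set S := a + b + c.
have S0 : 0 <= S by rewrite !addr_ge0.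
have tw : 0 <= 1 - 2 * tau by lra.
have pa : a `^ tau <= S `^ tau by apply: ge0_ler_powR; rewrite ?nnegrE ?/S; lra.
have pb : b `^ (1 - 2 * tau) <= S `^ (1 - 2 * tau).
  by apply: ge0_ler_powR; rewrite ?nnegrE ?/S; lra.
have pc : c `^ tau <= S `^ tau by apply: ge0_ler_powR; rewrite ?nnegrE ?/S; lra.
have SE : S `^ tau * S `^ (1 - 2 * tau) * S `^ tau = S.
  rewrite -powRD; last by apply/implyP => /eqP h; exfalso; lra.
  rewrite -powRD; last by apply/implyP => /eqP h; exfalso; lra.
  have -> : tau + (1 - 2 * tau) + tau = 1 by lra.
  by rewrite powRr1.
by rewrite -[leRHS]SE !ler_pM ?mulr_ge0 ?powR_ge0.
Qed.

End log_estimates.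

(** * Jensen's inequality, Riesz potentials and small balls *)

Section integral_estimates.
Context {R : realType} {n : nat}.
Local Notation V := 'rV[R]_n.
Local Notation mu := (@rv_mu R n).
Implicit Types (f g : V -> R) (x y z : V).

(* Jensen's inequality for the subprobability density [f], by integrating the
   tangent line of [expR] at [L := rint (g f)]; the case [L < 1] is trivial. *)
Lemma expR_rint_le f g : (forall y, 0 <= f y) -> rintegrable f -> rint f <= 1 ->
  rintegrable (fun y => g y * f y) -> rintegrable (fun y => expR (g y) * f y) ->
  expR (rint (fun y => g y * f y)) <= expR 1 + rint (fun y => expR (g y) * f y).
Proof.
move=> f0 If f1 Igf Ie; set L := rint (fun y => g y * f y).
have e0 : 0 <= rint (fun y => expR (g y) * f y).
  by apply: rint_ge0 => y; rewrite mulr_ge0// expR_ge0.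
have [L1|L1] := leP L 1; first by rewrite ler_wpDr// ler_expR.
suff h : expR L <= rint (fun y => expR (g y) * f y).
  by rewrite (le_trans h)// lerDr expR_ge0.
have -> : rint (fun y => expR (g y) * f y)
    = expR L * rint (fun y => expR (g y - L) * f y).
  rewrite -rintZ.
    by congr rint; apply/funext => y; rewrite mulrA -expRD addrC subrK.
  have := rintegrableZ (expR (- L)) Ie; congr rintegrable; apply/funext => y.
  by rewrite mulrA -expRD addrC.
rewrite ler_peMr ?expR_ge0//.
have I1 : rintegrable (fun y => (1 - L) * f y + g y * f y).
  by apply: rintegrableD => //; exact: rintegrableZ.
have : rint (fun y => (1 - L) * f y + g y * f y) <= rint (fun y => expR (g y - L) * f y).
  apply: rint_le => //.
    have := rintegrableZ (expR (- L)) Ie; congr rintegrable; apply/funext => y.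
    by rewrite mulrA -expRD addrC.
  move=> y; rewrite -mulrDl ler_wpM2r//.
  by have := expR_ge1Dx (g y - L); lra.
rewrite rintD//; last exact: rintegrableZ.
rewrite rintZ// -/L; apply: le_trans.
have /= := rint_ge0 f0; nra.
Qed.

Lemma measurable_riesz2 (s : R) :
  measurable_fun setT (fun p : V * V => enorm (p.1 - p.2) `^ (- s)).
Proof.
apply: (measurableT_comp (@measurable_powR R (- s))).
apply: (measurableT_comp (@measurable_enorm R n)).
apply: measurable_fun_rv => i.
under eq_fun do rewrite !mxE.
apply: measurable_funB.
  exact: (measurableT_comp (measurable_coord i) measurable_fst).
exact: (measurableT_comp (measurable_coord i) measurable_snd).
Qed.

(** [h] is the Riesz potential of [g]. Tonelli moves the integral over the unit ball onto the
    kernel, where it is bounded uniformly in the pole. *)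
Lemma riesz_potential_integrable (s : R) g : (0 < n)%N -> 0 < s < n%:R ->
  (forall y, 0 <= g y) -> rintegrable g ->
  exists h : V -> R, [/\ forall y, 0 <= h y,
    rintegrable (fun y => \1_(eball n 1) y * h y) &
    forall y, rintegrable (fun z => enorm (y - z) `^ (- s) * g z) ->
      h y = rint (fun z => enorm (y - z) `^ (- s) * g z)].
Proof.
move=> n0 hs g0 Ig; have [C hC] := rintegrable_riesz n0 hs.
pose k (p : V * V) := (enorm (p.1 - p.2) `^ (- s) * g p.2)%:E.
have k0 p : (0 <= k p)%E by rewrite lee_fin mulr_ge0// powR_ge0.
have mk : measurable_fun setT k.
  apply/measurable_EFinP; apply: measurable_funM; first exact: measurable_riesz2.
  exact: (measurableT_comp (rintegrable_measurable Ig) measurable_snd).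
have mH := @measurable_fun_fubini_tonelli_F _ _ _ _ _ mu _ mk k0.
have me : measurable_fun setT (\1_(eball n 1) : V -> R).
  by apply: measurable_indic; exact: measurable_eball.
exists (fun y => fine (\int[mu]_z k (y, z))%E).
have h0 y : 0 <= fine (\int[mu]_z k (y, z))%E.
  by apply: fine_ge0; apply: integral_ge0.
have mh : measurable_fun setT (fun y : V => fine (\int[mu]_z k (y, z))%E).
  exact: (measurableT_comp (fine_measurable measurableT) mH).
split => //.
apply: (@rintegrable_leC _ _ _ (C * rint g)); first exact: measurable_funM.
pose k1 (p : V * V) := ((\1_(eball n 1) p.1)%:E * k p)%E.
have k10 p : (0 <= k1 p)%E by rewrite mule_ge0// lee_fin.
have mk1 : measurable_fun setT k1.
  apply: emeasurable_funM => //; apply/measurable_EFinP.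
  exact: (measurableT_comp me measurable_fst).
apply: (@le_trans _ _ (\int[mu]_y \int[mu]_z k1 (y, z))%E).
  apply: ge0_le_integral => //.
  - by apply/measurable_EFinP/measurableT_comp => //; exact: measurable_funM.
  - exact: (@measurable_fun_fubini_tonelli_F _ _ _ _ _ mu _ mk1 k10).
  move=> y _; rewrite ger0_norm ?mulr_ge0// EFinM.
  have -> : (\int[mu]_z k1 (y, z) = (\1_(eball n 1) y)%:E * \int[mu]_z k (y, z))%E.
    have my : measurable_fun setT (fun z => k (y, z)).
      by apply: measurableT_comp mk _; exact: measurable_pair1.
    rewrite -(@ge0_integralZl _ _ R mu _ measurableT (fun z => k (y, z)) my)//.
  rewrite lee_wpmul2l ?lee_fin//.
  (* [fine] sends an infinite inner integral to 0, so passing to the real-valued [h] can only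
     decrease the left side. *)
  have : (0 <= \int[mu]_z k (y, z))%E by apply: integral_ge0.
  by case: (\int[mu]_z _)%E => //= r _; rewrite leey.
rewrite (@fubini_tonelli _ _ _ _ _ mu mu _ mk1 k10).
apply: (@le_trans _ _ (\int[mu]_z (C * g z)%:E)%E); last first.
  by rewrite -rintE ?rintZ//; exact: rintegrableZ.
apply: ge0_le_integral => //.
- by move=> z _; apply: integral_ge0.
- exact: (@measurable_fun_fubini_tonelli_G _ _ _ _ _ mu _ mk1 k10).
- by apply/measurable_EFinP; apply: measurable_funM => //; exact: rintegrable_measurable.
move=> z _; have [Iz hz] := hC z.
have -> : (\int[mu]_y k1 (y, z) =
    \int[mu]_y (g z * (\1_(eball n 1) y * enorm (z - y) `^ (- s)))%:E)%E.
  apply: eq_integral => y _; rewrite /k1 /k -EFinM /= enormB; congr EFin; ring.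
rewrite -rintE; last exact: rintegrableZ.
by rewrite rintZ// lee_fin mulrC ler_wpM2r.
Qed.

(** Provides the ball whose mass is small enough for Jensen. The bound [d < 1/2] keeps it where the
    source is nonnegative; [f 0 = 0] makes the pointwise limit 0 at the centre too. *)
Lemma rint_eball_small f (eps : R) : f 0 = 0 -> rintegrable f -> 0 < eps ->
  exists2 d : R, 0 < d < 1 / 2 & rint (fun y => \1_(eball n d) y * `|f y|) <= eps.
Proof.
move=> f0 If eps0.
pose d (j : nat) : R := 1 / 3 * j.+1%:R^-1.
have d0 j : 0 < d j by rewrite mulr_gt0 ?invr_gt0// divr_gt0.
have d1 j : d j <= 1 / 3.
  by rewrite ger_pMr ?divr_gt0// invf_le1// ler1n.
have dcv : d j @[j --> \oo] --> (0 : R).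
  rewrite -(mulr0 (1 / 3)); apply: cvgM; first exact: cvg_cst.
  exact: cvg_harmonic.
pose h j (y : V) := \1_(eball n (d j)) y * `|f y|.
have nf := rintegrable_norm If.
have mh j : measurable_fun setT (h j).
  apply: measurable_funM; last exact: rintegrable_measurable nf.
  by apply: measurable_indic; exact: measurable_eball.
have hf j y : `|h j y| <= `|f y|.
  by rewrite /h indicE; case: (y \in _); rewrite ?mul1r ?mul0r ?normr0 ?normr_id.
have [|I0 cv] := @rint_cvg R n h (fun=> 0) _ set0 measurable0 (measure0 _) mh
  (measurable_cst _) nf (fun j y _ => hf j y).
  move=> y _; have [->|y0] := eqVneq y 0.
    by apply: cvg_near_cst; near=> j; rewrite /h f0 normr0 mulr0.
  have yp : 0 < enorm y by rewrite enorm_gt0.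
  apply: cvg_near_cst; near=> j; rewrite /h indicE memNset ?mul0r//.
  rewrite /eball /=; apply/negP; rewrite -leNgt ltW//.
  by near: j; exact: (cvgr_lt _ dcv).
have [j _ hj] : \forall j \near \oo, rint (h j) < eps.
  by apply: (cvgr_lt _ cv); rewrite rint0.
exists (d j); first by rewrite d0/=; have := d1 j; lra.
by apply: ltW; apply: hj => /=.
Unshelve. all: by end_near. Qed.

End integral_estimates.

Section pot_holder.
Context {R : realType} {m : nat}.
Local Notation n := m.*2.
Local Notation V := 'rV[R]_(m.*2).
Hypothesis m0 : (0 < m)%N.
Variables (F : V -> R) (c0 M alpha : R).
Hypothesis c0_gt0 : 0 < c0.
Hypothesis M_gt0 : 0 < M.
Hypothesis IF : rintegrable F.
Hypothesis F0 : F 0 = 0.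
Hypothesis vF : vanish (3 / 4) F.
Hypothesis F_bounded : forall a : R, 0 < a -> exists A : R, 0 < A /\
  forall y, a <= enorm y -> `|F y| <= A.
Hypothesis F_nneg : forall y, enorm y < 1 / 2 -> 0 <= F y.
Hypothesis alpha_gtN : - n%:R < alpha.
Hypothesis F_le : forall y, 0 < enorm y < 1 / 2 ->
  F y <= M * expR (alpha * ln (enorm y) + pot F y / c0).
Hypothesis Ipot : forall x, 0 < enorm x ->
  rintegrable (fun y => - ln (enorm (x - y)) * F y).

Let n0 : (0 < n)%N. Proof. by rewrite double_gt0. Qed.
Let one_lt_n : 0 < (1 : R) < n%:R. Proof. by rewrite ltr01 ltr1n; lia. Qed.
Let mF := rintegrable_measurable IF.
Let nF : rintegrable (fun y => `|F y|). Proof. exact: rintegrable_norm. Qed.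

(** Split at [|y| = |x| / 2]: outside, [F] is bounded and the kernel integrable; inside, the kernel
    is bounded and [F] integrable. *)
Lemma rieszF_integrable x : 0 < enorm x ->
  rintegrable (fun y => enorm (x - y) `^ (-1) * `|F y|).
Proof.
move=> x0; have x20 : 0 < enorm x / 2 by rewrite divr_gt0.
have [A [A0 hA]] := F_bounded x20.
have [C hC] := rintegrable_riesz n0 one_lt_n.
have [Ix _] := hC x.
apply: (rintegrable_le _ _ (rintegrableD (rintegrableZ A Ix)
  (rintegrableZ (enorm x / 2)^-1 nF))).
  apply: measurable_funM; first exact: measurable_riesz.
  exact: rintegrable_measurable nF.
move=> y; rewrite ger0_norm ?mulr_ge0 ?powR_ge0//.
have i0 : 0 <= (enorm x / 2)^-1 by rewrite invr_ge0 ltW.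
have [y2|y2] := leP (enorm x / 2) (enorm y).
  have [y3|y3] := leP (enorm y) (3 / 4); last first.
    by rewrite vF// normr0 !mulr0 addr0 mulr_ge0 ?mulr_ge0 ?powR_ge0// ltW.
  rewrite indicE mem_set/=; last by rewrite /eball /=; lra.
  rewrite mul1r ler_wpDr ?mulr_ge0//.
  by rewrite mulrC ler_wpM2r ?powR_ge0// hA.
have h : enorm x / 2 <= enorm (x - y) by have := ler_enormBB x y; lra.
have t0 : 0 < enorm (x - y) by lra.
rewrite ler_wpDl ?mulr_ge0 ?powR_ge0//; first exact: ltW.
by rewrite (powR_inv1 (ltW t0)) ler_wpM2r// lef_pV2.
Qed.

Section local.
Variables (tau d : R).
Hypothesis tau_d : 0 < d < 1 / 2.
Hypothesis tau01 : 0 < tau < 1 / 2.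
Let Fd (y : V) := \1_(eball n d) y * `|F y|.
Let Fd0 y : 0 <= Fd y. Proof. by rewrite mulr_ge0. Qed.
Hypothesis Fd_small : rint Fd <= c0 * tau.
(** The value serves twice: [lam * Fd] has mass at most 1, as Jensen requires, and
    [lam * tau = 1 / c0], so [e^(Vd / c0)] is the power [tau] of [e^(lam Vd)]. *)
Let lam := (c0 * tau)^-1.
Let CW := (2 / d + 2) * rint (fun y => `|F y|).
Let Vd (x : V) := rint (fun y => - ln (enorm (x - y)) * Fd y).

Let tau0 : 0 < tau. Proof. by case/andP: tau01. Qed.
Let d0 : 0 < d. Proof. by case/andP: tau_d. Qed.
Let lam0 : 0 < lam. Proof. by rewrite invr_gt0 mulr_gt0. Qed.

Let Fd_le y : Fd y <= `|F y|.
Proof. by rewrite /Fd indicE; case: (y \in _); rewrite ?mul1r ?mul0r. Qed.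

Let mFd : measurable_fun setT Fd.
Proof.
apply: measurable_funM; last exact: rintegrable_measurable nF.
by apply: measurable_indic; exact: measurable_eball.
Qed.

Let IFd : rintegrable Fd.
Proof. by apply: (rintegrable_le mFd _ nF) => y; rewrite ger0_norm. Qed.

Let IVd x : 0 < enorm x -> rintegrable (fun y => - ln (enorm (x - y)) * Fd y).
Proof.
move=> x0; apply: (rintegrable_le _ _ (rintegrable_norm (Ipot x0))).
  by apply: measurable_funM => //; exact: measurable_log_enorm.
by move=> y; rewrite normrM [leRHS]normrM (ger0_norm (Fd0 y)) ler_wpM2l//; exact: Fd_le.
Qed.

(** The part of the source beyond radius [d] is seen from distance between [d / 2] and 2, which
    gives the factor [2 / d + 2] in [CW]. *)
Lemma pot_le_near x : 0 < enorm x < d / 2 -> pot F x <= Vd x + CW.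
Proof.
move=> /andP[x0 xd]; have /andP[_ d2] := tau_d.
have Ip := Ipot x0; have Iv := IVd x0.
rewrite addrC -lerBlDr -rintB// /CW -rintZ//.
apply: rint_le; [exact: rintegrableB|exact: rintegrableZ|].
have dd : 0 < 2 / d by rewrite divr_gt0.
move=> y; rewrite -mulrBr.
have [yd|yd] := ltP (enorm y) d.
  have -> : Fd y = F y.
    by rewrite /Fd indicE mem_set// mul1r ger0_norm// F_nneg//; lra.
  by rewrite subrr mulr0 mulr_ge0//; lra.
rewrite /Fd indicE memNset ?mul0r ?subr0; last by rewrite /eball /=; apply/negP; rewrite -leNgt.
have [y3|y3] := leP (enorm y) (3 / 4); last by rewrite vF// normr0 !mulr0.
have dh : 0 < d / 2 by rewrite divr_gt0.
have t1 : d / 2 <= enorm (x - y) by rewrite enormB; have := ler_enormBB y x; lra.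
have t2 : enorm (x - y) <= 2 by have := ler_enormB x y; lra.
rewrite (le_trans (ler_norm _))// normrM normrN ler_wpM2r//.
rewrite (le_trans (ln_bound_away dh t1))//.
by rewrite invf_div lerD2l.
Qed.

(** Jensen with density [lam * Fd] replaces the exponential of a logarithmic potential by a Riesz
    potential of order 1, through [e^(- ln t) <= 1 / t + 1]. *)
Lemma expR_Vd_le (h : V -> R) y : 0 < enorm y ->
  (rintegrable (fun z => enorm (y - z) `^ (-1) * Fd z) ->
    h y = rint (fun z => enorm (y - z) `^ (-1) * Fd z)) ->
  expR (lam * Vd y) <= expR 1 + lam * (h y + rint Fd).
Proof.
move=> y0 hy.
have Ir : rintegrable (fun z => enorm (y - z) `^ (-1) * Fd z).
  apply: (rintegrable_le _ _ (rieszF_integrable y0)).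
    by apply: measurable_funM => //; exact: measurable_riesz.
  by move=> z; rewrite ger0_norm ?mulr_ge0 ?powR_ge0// ler_wpM2l ?powR_ge0.
have Irl : rintegrable (fun z => lam * (enorm (y - z) `^ (-1) * Fd z + Fd z)).
  by apply: rintegrableZ; exact: rintegrableD.
have eb z : expR (- ln (enorm (y - z))) * (lam * Fd z) <=
    lam * (enorm (y - z) `^ (-1) * Fd z + Fd z).
  rewrite mulrCA ler_pM2l// -[X in _ <= _ + X]mul1r -mulrDl ler_wpM2r//.
  by rewrite expRN_ln_le// enorm_ge0.
have Ie : rintegrable (fun z => expR (- ln (enorm (y - z))) * (lam * Fd z)).
  apply: (rintegrable_le _ _ Irl).
    apply: measurable_funM; last exact: measurable_funM.
    by apply: (measurableT_comp (@measurable_expR R)); exact: measurable_log_enorm.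
  by move=> z; rewrite ger0_norm ?mulr_ge0 ?expR_ge0// ltW.
have -> : lam * Vd y = rint (fun z => - ln (enorm (y - z)) * (lam * Fd z)).
  rewrite -rintZ; last exact: IVd.
  by congr rint; apply/funext => z; rewrite mulrCA.
have le1 : rint (fun z => lam * Fd z) <= 1.
  by rewrite rintZ// ler_pdivrMl ?mulr1// mulr_gt0.
have lF0 z : 0 <= lam * Fd z by rewrite mulr_ge0// ltW.
apply: le_trans (expR_rint_le lF0 (rintegrableZ lam IFd) le1 _ Ie) _.
  have := rintegrableZ lam (IVd y0); congr rintegrable.
  by apply/funext => z; rewrite mulrCA.
rewrite lerD2l hy// -rintD// -rintZ; last exact: rintegrableD.
exact: rint_le.
Qed.

(** The bound on [F] contributes [|y|^-beta] and the power [tau] of [e^(lam Vd)]. Writing the three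
    factors with exponents [tau], [1 - 2 tau], [tau] prepares [young3]. *)
Lemma riesz_tauF_le (beta : R) x y : 0 < beta -> - alpha <= beta ->
  0 < enorm y < d / 2 ->
  enorm (x - y) `^ (- tau) * `|F y| <= M * expR (CW / c0) *
   (enorm (x - y) `^ (-1) + enorm y `^ (- (beta / (1 - 2 * tau))) + expR (lam * Vd y)).
Proof.
move=> beta0 ab hy; have /andP[y0 yd] := hy.
have /andP[_ d2] := tau_d; have /andP[_ tau2] := tau01.
have y1 : enorm y < 1 / 2 by lra.
have hy1 : 0 < enorm y < 1 / 2 by rewrite y0.
have M10 : 0 < M * expR (CW / c0) by rewrite mulr_gt0 ?expR_gt0.
have FyE : `|F y| <= M * expR (CW / c0) * (enorm y `^ (- beta) * expR (lam * Vd y) `^ tau).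
  rewrite ger0_norm ?F_nneg// (le_trans (F_le hy1))// -mulrA ler_pM2l//.
  rewrite -expRM; have -> : lam * Vd y * tau = Vd y / c0.
    by rewrite /lam; field; rewrite !gt_eqF.
  rewrite /powR gt_eqF// -!expRD ler_expR.
  have ly : ln (enorm y) <= 0 by apply: ln_le0; lra.
  have h1 : alpha * ln (enorm y) <= - beta * ln (enorm y) by rewrite ler_wnM2r//; lra.
  have h2 : pot F y / c0 <= Vd y / c0 + CW / c0.
    by rewrite -mulrDl ler_pM2r ?invr_gt0//; exact: pot_le_near.
  lra.
rewrite (le_trans (ler_wpM2l (powR_ge0 _ _) FyE))// mulrCA ler_pM2l//.
have -> : enorm (x - y) `^ (- tau) = (enorm (x - y) `^ (-1)) `^ tau.
  by rewrite -powRrM mulN1r.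
have -> : enorm y `^ (- beta) = (enorm y `^ (- (beta / (1 - 2 * tau)))) `^ (1 - 2 * tau).
  rewrite -powRrM; congr (_ `^ _); field; apply/eqP => h; lra.
by rewrite mulrA; apply: young3; rewrite ?powR_ge0 ?expR_ge0.
Qed.

(** Each summand from Young is integrable on the unit ball, uniformly in [x]: the first has a pole
    of order 1, the second one of order below [n], the third is controlled by a Riesz potential. For
    [|y| >= d / 2] the kernel is bounded, because [|x - y| >= d / 4]. *)
Lemma riesz_tauF_bounded (beta : R) : 0 < beta -> - alpha <= beta ->
  beta / (1 - 2 * tau) < n%:R ->
  exists N0 : R, forall x, enorm x < d / 4 ->
    rintegrable (fun y => enorm (x - y) `^ (- tau) * `|F y|) /\
    rint (fun y => enorm (x - y) `^ (- tau) * `|F y|) <= N0.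
Proof.
move=> beta0 ab sn; have /andP[_ d2] := tau_d; have /andP[_ tau2] := tau01.
have ball1 (y : V) : enorm y < d / 2 -> \1_(eball n 1) y = 1 :> R.
  by move=> yd; rewrite indicE mem_set// /eball /=; lra.
have h4 (x y : V) : enorm x < d / 4 -> d / 2 <= enorm y -> d / 4 <= enorm (x - y).
  by move=> xd yd; have := ler_enormBB y x; rewrite enormB; lra.
set s := beta / (1 - 2 * tau) in sn.
have s0 : 0 < s by rewrite divr_gt0//; lra.
have hs : 0 < s < n%:R by rewrite s0.
have [C1 hC1] := rintegrable_riesz n0 one_lt_n.
have [C2 hC2] := rintegrable_riesz n0 hs.
have [h [h0 Ih hE]] := riesz_potential_integrable n0 one_lt_n Fd0 IFd.
have I1 := rintegrable_indic_eball (n := n) (1 : R).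
pose M1 := M * expR (CW / c0).
have M10 : 0 < M1 by rewrite mulr_gt0 ?expR_gt0.
pose c1 := expR 1 + lam * rint Fd.
have c10 : 0 <= c1 by rewrite addr_ge0 ?expR_ge0// mulr_ge0 ?rint_ge0// ltW.
pose c2 := (d / 4) `^ (- tau).
pose J1 := rint (\1_(eball n 1) : V -> R); pose J2 := rint (fun y => \1_(eball n 1) y * h y).
exists (M1 * (C1 + (C2 + (c1 * J1 + lam * J2))) + c2 * rint (fun y => `|F y|)).
move=> x xd; have [Ix1 x1] := hC1 x; have [Ix2 x2] := hC2 0.
have Ia := rintegrableD (rintegrableZ c1 I1) (rintegrableZ lam Ih).
have Ib := rintegrableD Ix2 Ia.
have Ic := rintegrableD Ix1 Ib.
have Id := rintegrableD (rintegrableZ M1 Ic) (rintegrableZ c2 nF).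
have mG : measurable_fun setT (fun y : V => enorm (x - y) `^ (- tau) * `|F y|).
  apply: measurable_funM; first exact: measurable_riesz.
  exact: rintegrable_measurable nF.
have i0 (A : set V) y : 0 <= \1_A y :> R by [].
have bnd y : enorm (x - y) `^ (- tau) * `|F y| <= M1 * (\1_(eball n 1) y * enorm (x - y) `^ (-1)
   + (\1_(eball n 1) y * enorm (0 - y) `^ (- s) + (c1 * \1_(eball n 1) y +
     lam * (\1_(eball n 1) y * h y)))) + c2 * `|F y|.
  have p1 : 0 <= M1 * (\1_(eball n 1) y * enorm (x - y) `^ (-1)
   + (\1_(eball n 1) y * enorm (0 - y) `^ (- s) + (c1 * \1_(eball n 1) y +
     lam * (\1_(eball n 1) y * h y)))).
    by rewrite mulr_ge0 ?(ltW M10)// !addr_ge0// mulr_ge0 ?powR_ge0// ?mulr_ge0// ltW.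
  have [yE|yn0] := eqVneq y 0.
    have -> : F y = 0 by rewrite yE.
    by rewrite normr0 !mulr0 addr0.
  have y0 : 0 < enorm y by rewrite enorm_gt0.
  have [yd|yd] := ltP (enorm y) (d / 2).
    have hy : 0 < enorm y < d / 2 by rewrite y0.
    rewrite ler_wpDr ?mulr_ge0 ?powR_ge0//.
    rewrite (le_trans (riesz_tauF_le x beta0 ab hy))// ler_pM2l//.
    rewrite (ball1 y yd).
    rewrite sub0r enormN !mul1r mulr1 -addrA lerD2l lerD2l.
    by rewrite (le_trans (expR_Vd_le y0 (hE y)))// mulrDr [lam * h y + _]addrC addrA.
  have d40 : 0 < d / 4 by rewrite divr_gt0.
  have hxy := h4 x y xd yd; have xy0 := lt_le_trans d40 hxy.
  rewrite ler_wpDl// ler_wpM2r// /c2 !powRN.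
  have pd := powR_gt0 tau d40; have pxy := powR_gt0 tau xy0.
  rewrite lef_pV2 ?posrE//.
  by apply: ge0_ler_powR; rewrite ?nnegrE ?enorm_ge0//; exact: ltW.
have IG : rintegrable (fun y => enorm (x - y) `^ (- tau) * `|F y|).
  apply: (rintegrable_le mG _ Id) => y.
  by rewrite ger0_norm ?mulr_ge0 ?powR_ge0//; exact: bnd.
split => //; apply: le_trans (rint_le IG Id bnd) _.
rewrite rintD; [|exact: rintegrableZ|exact: rintegrableZ].
rewrite rintZ// rintZ// rintD// rintD// rintD; [|exact: rintegrableZ|exact: rintegrableZ].
rewrite rintZ// rintZ// lerD2r ler_pM2l//.
by rewrite lerD// lerD.
Qed.

End local.

Lemma pot_holder_on : exists rho gamma : R, [/\ 0 < rho < 1 / 2, 0 < gamma < 1 &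
  holder_on gamma (eball n rho) (fun x => pot F x / c0)].
Proof.
have np : 0 < n%:R :> R by rewrite ltr0n.
(* The midpoint between [max (- alpha) 0] and [n]; this is where [alpha > - n] enters. *)
pose beta := (Num.max (- alpha) 0 + n%:R) / 2.
have b1 : - alpha <= Num.max (- alpha) 0 by rewrite le_max lexx.
have b2 : 0 <= Num.max (- alpha) 0 by rewrite le_max lexx orbT.
have b3 : Num.max (- alpha) 0 < n%:R by rewrite gt_max np andbT; move: alpha_gtN; lra.
have beta0 : 0 < beta by rewrite /beta; lra.
have betan : beta < n%:R by rewrite /beta; lra.
have ab : - alpha <= beta by rewrite /beta; lra.
(* With this value [n (1 - 2 tau)] is the midpoint of [beta] and [n], so the exponent
   [beta / (1 - 2 tau)] stays below [n]. *)
pose tau := (1 - beta / n%:R) / 4.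
have q1 : beta / n%:R < 1 by rewrite ltr_pdivrMr// mul1r.
have q0 : 0 < beta / n%:R by rewrite divr_gt0.
have tau0 : 0 < tau by rewrite /tau; lra.
have tau1 : tau < 1 / 4 by rewrite /tau; lra.
have htau : 0 < tau < 1 / 2 by rewrite tau0/=; lra.
have htau1 : 0 < tau < 1 by rewrite tau0/=; lra.
have sn : beta / (1 - 2 * tau) < n%:R.
  rewrite ltr_pdivrMr; last by lra.
  have -> : n%:R * (1 - 2 * tau) = (n%:R + beta) / 2.
    by rewrite /tau; field; rewrite gt_eqF.
  lra.
have [d hd Fd_small] := rint_eball_small F0 IF (mulr_gt0 c0_gt0 tau0).
have /andP[d0 d2] := hd.
have [N0 hN] := riesz_tauF_bounded hd htau Fd_small beta0 ab sn.
have ti : 0 < tau^-1 by rewrite invr_gt0.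
pose LF := rint (fun y => `|F y|).
have lnb x y : enorm x < d / 4 -> `|- ln (enorm (x - y)) * F y| <=
    tau^-1 * (enorm (x - y) `^ (- tau) * `|F y|) + `|F y|.
  move=> xd; have [y3|y3] := leP (enorm y) (3 / 4); last by rewrite vF// normr0 !mulr0 addr0 normr0.
  rewrite normrM normrN mulrA -[X in _ <= _ + X]mul1r -mulrDl ler_wpM2r//.
  rewrite (le_trans (abs_ln_le_powR tau0 (enorm_ge0 _)))// lerD2l.
  by have := ler_enormB x y; lra.
have Ib x : enorm x < d / 4 ->
    rintegrable (fun y => tau^-1 * (enorm (x - y) `^ (- tau) * `|F y|) + `|F y|).
  by move=> /hN[h _]; apply: rintegrableD => //; exact: rintegrableZ.
have Ip x : enorm x < d / 4 -> rintegrable (fun y => - ln (enorm (x - y)) * F y).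
  move=> xd; apply: (rintegrable_le _ _ (Ib x xd)); last by move=> y; exact: lnb.
  by apply: measurable_funM => //; exact: measurable_log_enorm.
exists (d / 4), tau; split => //; first by apply/andP; split; lra.
have ci : 0 < c0^-1 by rewrite invr_gt0.
split.
  exists ((tau^-1 * N0 + LF) / c0) => x xd.
  rewrite normrM (gtr0_norm ci) ler_pM2r//.
  have [h1 h2] := hN x xd.
  apply: le_trans (rint_norm_le (Ip x xd) (Ib x xd) (fun y => lnb x y xd)) _.
  rewrite rintD//; last exact: rintegrableZ.
  by rewrite rintZ// lerD2r ler_pM2l.
exists (2 * tau^-1 * N0 / c0) => x z xd zd.
have [Gx Nx] := hN x xd; have [Gz Nz] := hN z zd.
rewrite -mulrBl normrM (gtr0_norm ci) mulrAC ler_pM2r// -rintB; [|exact: Ip|exact: Ip].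
set T := enorm (x - z) `^ tau.
have T0 : 0 <= T by exact: powR_ge0.
(* [ln_dist_le] needs both distances positive, so the poles [x] and [z] are excluded as a null
   set. *)
have [mN muN] := set2_null x z n0.
have IS := rintegrableZ (tau^-1 * T) (rintegrableD Gx Gz).
apply: (@le_trans _ _ (rint (fun y => tau^-1 * T *
    (enorm (x - y) `^ (- tau) * `|F y| + enorm (z - y) `^ (- tau) * `|F y|)))).
  apply: (rint_norm_le_ae mN muN _ IS).
    by apply: rintegrableB; exact: Ip.
  move=> y yN.
  have x0 : 0 < enorm (x - y).
    by rewrite enorm_gt0 subr_eq0; apply/eqP => xy; apply: yN; left; rewrite xy.
  have z0 : 0 < enorm (z - y).
    by rewrite enorm_gt0 subr_eq0; apply/eqP => xy; apply: yN; right; rewrite xy.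
  rewrite -mulrBl normrM -mulrDl mulrA ler_wpM2r//.
  rewrite -opprD normrN.
  have h := ln_dist_le htau1 x0 z0.
  rewrite (le_trans h)// ler_wpM2r ?addr_ge0 ?powR_ge0// ler_pM2l//.
  apply: ge0_ler_powR; rewrite ?nnegrE ?enorm_ge0//; first exact: ltW.
  by rewrite (le_trans (ler_dist_enorm _ _))// opprB addrA subrK.
rewrite (rintZ (tau^-1 * T) (rintegrableD Gx Gz)) (rintD Gx Gz).
have -> : 2 * tau^-1 * N0 * T = tau^-1 * T * (N0 + N0) by ring.
exact: (ler_wpM2l (mulr_ge0 (ltW ti) T0) (lerD Nx Nz)).
Qed.

End pot_holder.

(** * Localization at the origin *)

Section localization.
Context {R : realType} {m : nat}.
Local Notation n := m.*2.
Local Notation V := 'rV[R]_(m.*2).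
Hypothesis m0 : (0 < m)%N.
Variables K u : V -> R.
Hypothesis Cu : Ck n (pball n 1) u.
Hypothesis eqn : forall x, pball n 1 x -> polylap m u x = K x * expR (u x).

Let n0 : (0 < n)%N. Proof. by rewrite double_gt0. Qed.

(** By the equation this function is [K] on the punctured ball, so [K] is continuous there although
    it is given only up to null sets. *)
Lemma curvature_continuous :
  {in pball n 1, continuous (fun x : V => polylap m u x * expR (- u x))}.
Proof.
have h0 : Ck 0 (pball n 1) (polylap m u).
  by apply: Ck_polylap; [exact: open_pball|rewrite addn0].
move=> x xb; apply: continuousM; first exact: (Ck_cont h0 xb).
apply: (@continuous_comp _ _ _ (fun y => - u y)); last exact: continuous_expR.
by apply: continuousN; exact: (Ck_cont Cu xb).
Qed.

(** For a continuous function a null preimage of an open set is empty; this upgrades the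
    almost-everywhere bounds on [K] to pointwise ones. *)
Lemma curvature_avoids (B : set R) : open B ->
  rn_measure (eball n 1 `&` [set x | B (K x)]) = 0%E ->
  forall x, pball n 1 x -> ~ B (K x).
Proof.
move=> oB h0 x xb BK.
have KE y : pball n 1 y -> polylap m u y * expR (- u y) = K y.
  by move=> /eqn ->; rewrite -mulrA -expRD subrr expR0 mulr1.
have oA := open_preimage_in (@open_pball R n 1) curvature_continuous oB.
apply: (null_open_empty oA _ _ h0 (x := x)).
- move=> y [yb /=]; rewrite KE// => ?; split => //.
  by case/andP: yb.
- move=> y [/= y1 By]; have [->|y0] := eqVneq y 0; first by right.
  have yb : pball n 1 y by rewrite /pball /= enorm_gt0 y0.
  by left; split => //=; rewrite KE.
- by split => //=; rewrite KE.
Qed.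

Lemma curvature_bounds :
  (exists M : R, rn_measure (eball n 1 `&` [set x | `|K x| > M]) = 0%E) ->
  rn_measure (eball n 1 `&` [set x | K x < 0]) = 0%E ->
  exists M : R, 0 < M /\ forall x, pball n 1 x -> 0 <= K x <= M.
Proof.
move=> [M hM] h0; exists (`|M| + 1); split; first by rewrite ltr_wpDl.
move=> x xb; apply/andP; split.
  rewrite leNgt; apply/negP.
  exact: (@curvature_avoids [set t | t < 0] (@open_lt R 0) h0 x xb).
have oM : open [set t : R | `|t| > M].
  have -> : [set t : R | `|t| > M] = (fun t : R => `|t|) @^-1` [set t | M < t] by [].
  by apply: open_comp => [t _|]; [exact: norm_continuous|exact: open_gt].
have := @curvature_avoids [set t | `|t| > M] oM hM x xb.
move=> /negP; rewrite -leNgt => h.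
rewrite (le_trans (ler_norm _))// (le_trans h)// (le_trans (ler_norm _))//.
by rewrite lerDl.
Qed.

(** The dilation by 2 makes the cutoff 1 up to radius 1/2 and 0 from radius 3/4 on, inside the ball
    where [u] is defined. *)
Let chi (y : V) := cutoff n (2 *: y).
Let U (y : V) := u y * chi y.
Let P := polylap m U.

Let chi1 y : enorm y <= 1 / 2 -> chi y = 1.
Proof. by move=> h; apply: cutoff1; rewrite enormZ ger0_norm//; lra. Qed.

Let chi0 y : 3 / 4 <= enorm y -> chi y = 0.
Proof. by move=> h; apply: cutoff0; rewrite enormZ ger0_norm//; lra. Qed.

Let vU : vanish (3 / 4) U.
Proof. by move=> y /ltW y4; rewrite /U chi0// mulr0. Qed.

Let U_near y : enorm y <= 1 / 2 -> U y = u y.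
Proof. by move=> h; rewrite /U chi1// mulr1. Qed.

Let CU : Ck n [set y | 0 < enorm y] U.
Proof.
apply: Ck_local => x /= x0; have [x1|x1] := ltP (enorm x) 1.
  exists (pball n 1); split; first by rewrite /pball /= x0.
  apply: CkM => //; first exact: open_pball.
  by apply: (@Ck_sub _ _ _ setT) => //; apply: CkT_scale; exact: Ck_cutoff.
exists [set y | 3 / 4 < enorm y]; split; first by rewrite /=; lra.
apply: (@Ck_ext _ _ _ _ (fun=> 0)); [exact: open_enorm_gt| |exact: Ck_cst].
by move=> y; rewrite inE => /= y4; rewrite vU.
Qed.

Let PE y : 0 < enorm y < 1 / 2 -> P y = K y * expR (u y).
Proof.
move=> /[dup] hy /andP[y0 y2].
rewrite -eqn; last by rewrite /pball /= y0/=; lra.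
apply: (polylap_ext m (@open_pball R n (1 / 2))); last by rewrite inE.
by move=> z; rewrite inE => /andP[_ z2]; rewrite U_near// ltW.
Qed.

Variable M : R.
Hypothesis M_gt0 : 0 < M.
Hypothesis K_bnd : forall x, pball n 1 x -> 0 <= K x <= M.
Hypothesis fin_eu : (rn_integral (fun x => (\1_(pball n 1) x * expR (u x))%:E) < +oo)%E.
Hypothesis small_u : forall eps : R, 0 < eps -> exists delta : R, 0 < delta /\
  forall r : R, 0 < r -> r < delta ->
    (rn_integral (fun x => (\1_(pball n r) x * `|u x|)%:E) <= (eps * r ^+ (n - 2)%N)%:E)%E.

Let Ieu : rintegrable (fun y : V => \1_(pball n 1) y * expR (u y)).
Proof.
have mf : measurable_fun setT (fun y : V => \1_(pball n 1) y * expR (u y)).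
  apply: measurable_indicM; first exact: open_pball.
  move=> x xb; apply: continuous_comp; last exact: continuous_expR.
  exact: (Ck_cont Cu xb).
have f0 y : 0 <= \1_(pball n 1) y * expR (u y) by rewrite mulr_ge0// expR_ge0.
apply: rintegrable_lty => //.
under eq_integral do rewrite (ger0_norm (f0 _)).
by rewrite -rn_integralE//; exact/measurable_EFinP.
Qed.

(** Inside radius 1/2 the source is [K e^u], at most [M e^u]; between 1/2 and 3/4 it is bounded by
    compactness, and beyond it vanishes. The uncontrolled value at 0 is a null set. *)
Let IP : rintegrable P.
Proof.
have h2 : 0 < 1 / 2 :> R by lra.
have [A [A0 hA]] := source_bounded_away (ltac:(lra) : 3 / 4 < 1 :> R) vU CU h2.
have I1 := rintegrable_indic_eball (n := n) (1 : R).
apply: (rintegrable_le_ae (@rv_set1_measurable R n 0) (rv_mu_set1_gt0 0 n0) _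
  (rintegrableD (rintegrableZ M Ieu) (rintegrableZ A I1))).
  by apply: measurable_off0; exact: Ck_cont (source_continuous CU).
move=> y /eqP yn0; have y0 : 0 < enorm y by rewrite enorm_gt0.
have [y2|y2] := ltP (enorm y) (1 / 2).
  have yb : pball n 1 y by rewrite /pball /= y0/=; lra.
  rewrite PE ?y0// [\1_(pball n 1) y]indicE mem_set// mul1r.
  have /andP[K0 KM] := K_bnd yb.
  rewrite ger0_norm; last by rewrite mulr_ge0 ?expR_ge0.
  rewrite ler_wpDr; [by []|by rewrite mulr_ge0// ltW|].
  by rewrite ler_wpM2r ?expR_ge0.
rewrite ler_wpDl; [by []|by rewrite mulr_ge0 ?mulr_ge0 ?expR_ge0// ltW|].
have [y4|y4] := ltP (3 / 4) (enorm y).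
  have -> : P y = 0 by exact: (source_vanish vU y4).
  by rewrite normr0 mulr_ge0// ltW.
rewrite [\1_(eball n 1) y]indicE mem_set; last by rewrite /eball /=; lra.
by rewrite mulr1; exact: hA.
Qed.

Let smallU eps : 0 < eps -> exists delta : R, 0 < delta /\ forall rho, 0 < rho < delta ->
  rintegrable (fun y : V => \1_(pball n rho) y * `|U y|) /\
  rint (fun y : V => \1_(pball n rho) y * `|U y|) <= eps * rho ^+ (n - 2).
Proof.
(* Radii up to 1/2 stay where the cutoff is 1 and [U] equals [u]. *)
move=> /small_u[d [d0 hd]]; exists (Num.min d (1 / 2)).
split; first by rewrite lt_min d0/=; lra.
move=> rho /andP[r0]; rewrite lt_min => /andP[rd r2].
have -> : (fun y : V => \1_(pball n rho) y * `|U y|) =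
    (fun y : V => \1_(pball n rho) y * `|u y|).
  apply/funext => y; rewrite indicE; case: (boolP (y \in _)) => [|_]; last by rewrite !mul0r.
  by rewrite inE => /andP[_ yr]; rewrite U_near//; lra.
have mf : measurable_fun setT (fun y : V => \1_(pball n rho) y * `|u y|).
  apply: measurable_indicM; first exact: open_pball.
  move=> x; rewrite inE => /andP[x0 xr].
  apply: (@continuous_comp _ _ _ u); last exact: norm_continuous.
  by apply: (Ck_cont Cu); rewrite inE /pball /= x0/=; lra.
have f0 y : 0 <= \1_(pball n rho) y * `|u y| by rewrite mulr_ge0.
have hi : (\int[rv_mu n]_y (\1_(pball n rho) y * `|u y|)%:E <= (eps * rho ^+ (n - 2))%:E)%E.
  rewrite -rn_integralE; [exact: hd|exact/measurable_EFinP|by move=> y; rewrite lee_fin].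
split; last exact: rint_leC.
apply: (rintegrable_leC mf); under eq_integral do rewrite (ger0_norm (f0 _)).
exact: hi.
Qed.

(** At the origin [P] has no meaningful value; [F] is set to 0 there, so that its nonnegativity
    holds on a full ball and no integral changes. *)
Let F (y : V) := \1_[set z | 0 < enorm z] y * P y.

Let off0 (f : V -> R) : rintegrable f ->
  rintegrable (fun y => \1_[set z | 0 < enorm z] y * f y) /\
  rint f = rint (fun y => \1_[set z | 0 < enorm z] y * f y).
Proof.
move=> If; apply: (rint_ae_eq (@rv_set1_measurable R n 0) (rv_mu_set1_gt0 0 n0) If).
  apply: measurable_funM; last exact: rintegrable_measurable.
  by apply: measurable_indic; apply: rv_open_measurable; exact: open_enorm_gt.
by move=> y /eqP y0; rewrite indicE mem_set ?mul1r//= enorm_gt0.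
Qed.

Let FE y : 0 < enorm y -> F y = P y.
Proof. by move=> y0; rewrite /F indicE mem_set ?mul1r. Qed.

(** Here [alpha] is the mass of the source divided by c0, and [phi] is the potential divided by c0.
    The dipole has vanished, and the radius is below 1/2, where [U] and [u] coincide. *)
Lemma singular_expansion : exists (alpha rho gamma : R) (phi : V -> R),
  - n%:R < alpha /\ 0 < rho < 1 /\ 0 < gamma < 1 /\
  holder_on gamma (eball n rho) phi /\
  forall x, pball n rho x -> u x = alpha * ln (enorm x) + phi x.
Proof.
have r1 : 3 / 4 < 1 :> R by lra.
have c0 : 0 < log_const m :> R by exact: log_const_gt0.
have [IF _] := off0 IP.
have F00 : F 0 = 0 by rewrite /F indicE memNset ?mul0r//= enorm0 ltxx.
have vF : vanish (3 / 4) F.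
  move=> y y4; have Py : P y = 0 by exact: (source_vanish vU y4).
  by rewrite /F Py mulr0.
have F_b a : 0 < a -> exists A : R, 0 < A /\ forall y, a <= enorm y -> `|F y| <= A.
  move=> a0; have [A [A0 hA]] := source_bounded_away r1 vU CU a0.
  exists A; split => // y ay; rewrite FE; last exact: lt_le_trans ay.
  exact: hA.
have F_u y : 0 < enorm y < 1 / 2 -> 0 <= F y <= M * expR (u y).
  move=> /[dup] hy /andP[y0 y2]; rewrite FE// PE//.
  have yb : pball n 1 y by rewrite /pball /= y0/=; lra.
  have /andP[K0 KM] := K_bnd yb.
  by rewrite mulr_ge0 ?expR_ge0//= ler_wpM2r ?expR_ge0.
have tayE x : (fun y => log_taylor x y * F y) =
    (fun y => \1_[set z | 0 < enorm z] y * (log_taylor x y * P y)).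
  by apply/funext => y; rewrite /F mulrCA.
have ItP x : 0 < enorm x -> rintegrable (fun y => log_taylor x y * P y).
  exact: (log_taylor_source_integrable m0 r1 vU CU IP).
have ItF x : 0 < enorm x -> rintegrable (fun y => log_taylor x y * F y).
  by move=> x0; rewrite tayE; have [] := off0 (ItP x x0).
have rep x : 0 < enorm x < 1 / 2 -> log_const m * u x = rint (fun y => log_taylor x y * F y).
  move=> /andP[x0 x2]; rewrite tayE; have [_ <-] := off0 (ItP x x0).
  rewrite -(U_near (ltW x2)).
  exact: (representation m0 r1 vU CU IP smallU x0).
have al := log_coef_gt m0 c0 IF F00 vF F_u Ieu ItF rep.
set alpha := rint F / log_const m in al.
have uE x : 0 < enorm x < 1 / 2 ->
    u x = alpha * ln (enorm x) + pot F x / log_const m.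
  move=> hx; have := u_pot IF vF ItF rep hx.
  rewrite (dipole_eq0 m0 c0 IF F00 vF F_u Ieu ItF rep).
  have -> : dotp x 0 = 0 by rewrite /dotp big1// => i _; rewrite mxE mulr0.
  rewrite mulr0 subr0 => h.
  apply: (mulfI (lt0r_neq0 c0)); rewrite h /alpha; field.
  by rewrite lt0r_neq0.
have F_le y : 0 < enorm y < 1 / 2 ->
    F y <= M * expR (alpha * ln (enorm y) + pot F y / log_const m).
  by move=> hy; rewrite -uE//; have /andP[] := F_u y hy.
have [rho [gamma [/andP[rho0 rho2] hg hol]]] := pot_holder_on m0 c0 M_gt0 IF F00 vF F_b
  (source_ge0 F00 F_u) al F_le (pot_integrable IF vF ItF).
exists alpha, rho, gamma, (fun x => pot F x / log_const m).
do !split => //; first by apply/andP; split; lra.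
by move=> x /andP[x0 xr]; apply: uE; rewrite x0/=; lra.
Qed.

End localization.

Unset Implicit Arguments. Set Strict Implicit. Set Printing Implicit Defensive.

Theorem theorem1p2 (R : realType) (m : nat) (hm : (2 <= m)%N)
    (K u : 'rV[R]_(m.*2) -> R) :
  (* K in L^infty(B_1), K >= 0 a.e. *)
  (exists M : R, rn_measure (eball (m.*2) 1 `&` [set x | `|K x| > M]) = 0%E) ->
  rn_measure (eball (m.*2) 1 `&` [set x | K x < 0]) = 0%E ->
  (* u in C^{2m}(B_1 \ {0}) *)
  Ck (m.*2) (pball (m.*2) 1) u ->
  (* (-Delta)^m u = K e^u pointwise in B_1 \ {0} *)
  (forall x, pball (m.*2) 1 x -> polylap m u x = K x * expR (u x)) ->
  (* int_{B_1 \ {0}} e^u < +oo *)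
  (rn_integral (fun x => (\1_(pball (m.*2) 1) x * expR (u x))%:E) < +oo)%E ->
  (* int_{B_r \ {0}} |u| = o(r^{2m-2}) as r -> 0 *)
  (forall eps : R, 0 < eps -> exists delta : R, 0 < delta /\
     forall r : R, 0 < r -> r < delta ->
       (rn_integral (fun x => (\1_(pball (m.*2) r) x * `|u x|)%:E)
          <= (eps * r ^+ (m.*2 - 2)%N)%:E)%E) ->
  exists (alpha rho gamma : R) (phi : 'rV[R]_(m.*2) -> R),
    - (m.*2)%:R < alpha /\ 0 < rho < 1 /\ 0 < gamma < 1 /\
    holder_on gamma (eball (m.*2) rho) phi /\
    forall x, pball (m.*2) rho x -> u x = alpha * ln (enorm x) + phi x.
Proof.
move=> K_bnd K_nneg Cu eqn fin_eu small_u.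
have m0 : (0 < m)%N by exact: ltnW.
have [M [M0 hM]] := curvature_bounds Cu eqn K_bnd K_nneg.
exact: (singular_expansion m0 Cu eqn M0 hM fin_eu small_u).
Qed.
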